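(* Let $\mathbf f\in l^{2,1}(\mathbb N;L^2(\Omega))$, and let $B$ be an operator such that $B:l^2(\mathbb N;L^2(\Omega))\to l^{2,1}(\mathbb N;L^2(\Omega))$ and $B:l^2(\mathbb N;H^1(\Omega))\to l^{2,1}(\mathbb N;H^1(\Omega))$ are bounded. Let $C_B>0$ be such that $$\|B\mathbf v\|_{1,0}\le C_B\|\mathbf v\|\quad \forall\,\mathbf v\in l^2(\mathbb N;L^2(\Omega)),\qquad \|B\mathbf v\|_{1,1}\le C_B\|\mathbf v\|_{0,1}\quad\forall\,\mathbf v\in l^2(\mathbb N;H^1(\Omega)).$$ Assume that $B$ is such that $$\epsilon:=\sqrt{2\mu}\,C_B<\sqrt2-1,$$ where $\mu$ is the constant in the Poincar\'e inequality $\|\mathbf u\|^2\le\mu\left(\|\partial\mathbf u\|^2+\|\mathbf u|_\Gamma\|_{0,\frac12}^2\right)$, $\mathbf u\in l^2(\mathbb N;H^1(\Omega))$. If $\mathbf v\in l^{2,\frac12}(\mathbb N;H^1(\Omega))$ is a solution of the inhomogeneous Bukhgeim-Beltrami equation $$\overline\partial\mathbf v+L^2\partial\mathbf v=B\mathbf v+\mathbf f\quad\text{in }\Omega,$$ then $$0\le\|\partial\mathbf v\|\le\frac{b+\sqrt{b^2+4ac}}{2a},$$ where $$a=1-2\epsilon-\epsilon^2>0,\qquad b=2\epsilon\|\mathbf v|_\Gamma\|_{0,\frac12}+2\sqrt2\,\|\mathbf f\|_{1,0},\qquad c=\epsilon^2\|\mathbf v|_\Gamma\|_{0,\frac12}^2+\pi\|\mathbf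 v|_\Gamma\|_{\frac12,\frac12}^2+2\|\mathbf f\|_{1,0}^2.$$
   Context: $\Omega\subset\mathbb R^2\cong\mathbb C$ is the unit disc and $\Gamma=\partial\Omega$ the unit circle. $\overline\partial=(\partial_x+i\partial_y)/2$ and $\partial=(\partial_x-i\partial_y)/2$ act on the spatial variable, componentwise on sequences. Sequence valued maps are written $\mathbf v=\langle v_0,v_{-1},v_{-2},\dots\rangle$ with complex valued components, and $L\langle v_0,v_{-1},v_{-2},\dots\rangle=\langle v_{-1},v_{-2},\dots\rangle$ is the left translation; $L^2=L\circ L$. For $p\in\{0,\frac12,1\}$, $q\in\{0,1\}$, $l^{2,p}(\mathbb N;H^q(\Omega))$ is the space of sequences with $$\|\mathbf u\|_{p,q}^2:=\sum_{j=0}^\infty(1+j^2)^p\|u_{-j}\|_{H^q(\Omega)}^2<\infty,$$ where $H^0=L^2$; $l^2:=l^{2,0}$ and $\|\mathbf u\|:=\|\mathbf u\|_{0,0}$. In particular $\|\partial\mathbf v\|^2=\sum_{j\ge0}\|\partial v_{-j}\|_{L^2(\Omega)}^2$. For traces on $\Gamma$, $\|\mathbf g\|_{p,\frac12}^2:=\sum_{j\ge0}(1+j^2)^p\|g_{-j}\|^2_{H^{1/2}(\Gamma)}$, where, if $g_{-j}(e^{i\beta})=\sum_{k\in\mathbb Z}g_{-j,k}e^{ik\beta}$, then $\|g_{-j}\|^2_{H^{1/2}(\Gamma)}=\sum_{k\in\mathbb Z}(1+k^2)^{1/2}|g_{-j,k}|^2$. $\mu>0$ denotes a constant depending only on $\Omega$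 for which the Poincar\'e inequality displayed in the claim holds for all $\mathbf u\in l^2(\mathbb N;H^1(\Omega))$. *)

(* Defs.v *)
From HB Require Import structures.
From mathcomp Require Import all_boot all_order all_algebra.
From mathcomp Require Import all_classical all_reals all_analysis.
From mathcomp Require Import complex.

Set Implicit Arguments.
Unset Strict Implicit.
Unset Printing Implicit Defensive.

Import Order.TTheory GRing.Theory Num.Theory.
Import numFieldNormedType.Exports.

Local Open Scope classical_set_scope.
Local Open Scope ring_scope.
Local Open Scope complex_scope.

Section Disc.
Context {R : realType}.

Definition leb2 := (@lebesgue_measure R \x @lebesgue_measure R)%E.

Definition disc : set (R * R) := [set z | z.1 ^+ 2 + z.2 ^+ 2 < 1].

(* The unit circle is parametrized by the angle: a function on it is given by
   g : R -> R[i], of which only the values on [0, 2 pi] matter, and stands for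
   e^(i beta) |-> g beta. *)
Definition angles : set R := `[0, 2 * pi].
Definition circ (beta : R) : R * R := (cos beta, sin beta).

Definition ex : R * R := (1, 0).
Definition ey : R * R := (0, 1).

Definition cmeasurable d (T : measurableType d) (D : set T) (u : T -> R[i]) :=
  measurable_fun D (fun x => complex.Re (u x)) /\
  measurable_fun D (fun x => complex.Im (u x)).

Definition cintegral d (T : measurableType d) (mu : {measure set T -> \bar R})
    (D : set T) (u : T -> R[i]) : R[i] :=
  Rintegral mu D (fun x => complex.Re (u x)) +i*
  Rintegral mu D (fun x => complex.Im (u x)).

Definition sqmod (z : R[i]) : R := complex.Re z ^+ 2 + complex.Im z ^+ 2.

Definition L2sq d (T : measurableType d) (mu : {measure set T -> \bar R})
    (D : set T) (u : T -> R[i]) : \bar R :=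
  (\int[mu]_(x in D) (sqmod (u x))%:E)%E.

Definition inL2 d (T : measurableType d) (mu : {measure set T -> \bar R})
    (D : set T) (u : T -> R[i]) : Prop :=
  cmeasurable D u /\ (L2sq mu D u < +oo)%E.

(* Elements of L^2 are handled through representatives; this is their equality
   as elements of L^2(disc). *)
Definition ae_eq_disc (u w : R * R -> R[i]) : Prop :=
  {ae leb2, forall z, disc z -> u z = w z}.

(* C^infinity on the plane: every iterated directional derivative is
   (Frechet) differentiable everywhere. *)
Definition smooth (phi : R * R -> R) : Prop :=
  forall (s : seq (R * R)) (z : R * R),
    differentiable (foldr (fun e h => 'D_e h) phi s) z.

Definition test_function (phi : R * R -> R) : Prop :=
  [/\ smooth phi, compact (closure [set z | phi z != 0])
    & closure [set z | phi z != 0] `<=` disc].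

Definition csmooth (w : R * R -> R[i]) : Prop :=
  smooth (fun z => complex.Re (w z)) /\ smooth (fun z => complex.Im (w z)).

Definition cderive (e : R * R) (w : R * R -> R[i]) (z : R * R) : R[i] :=
  'D_e (fun z => complex.Re (w z)) z +i* 'D_e (fun z => complex.Im (w z)) z.

Definition is_weak_derive (e : R * R) (u g : R * R -> R[i]) : Prop :=
  forall phi, test_function phi ->
    cintegral leb2 disc (fun z => u z * ('D_e phi z)%:C) =
    - cintegral leb2 disc (fun z => g z * (phi z)%:C).

(* A representative of the weak derivative in L^2(disc); 0 if there is none. *)
Definition wderive (e : R * R) (u : R * R -> R[i]) : R * R -> R[i] :=
  xget (fun=> 0) [set g | inL2 leb2 disc g /\ is_weak_derive e u g].

Definition inH1 (u : R * R -> R[i]) : Prop :=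
  inL2 leb2 disc u /\
  forall e, e = ex \/ e = ey ->
    exists g, inL2 leb2 disc g /\ is_weak_derive e u g.

Definition H1sq (u : R * R -> R[i]) : \bar R :=
  (L2sq leb2 disc u + L2sq leb2 disc (wderive ex u)
   + L2sq leb2 disc (wderive ey u))%E.

Definition del (u : R * R -> R[i]) (z : R * R) : R[i] :=
  (wderive ex u z - 'i%C * wderive ey u z) / 2.

Definition delbar (u : R * R -> R[i]) (z : R * R) : R[i] :=
  (wderive ex u z + 'i%C * wderive ey u z) / 2.

(* g = u|_Gamma: the trace operator is the extension by density and continuity
   of the restriction of functions smooth up to the boundary, i.e. g is the
   L^2(Gamma) limit of the restrictions of smooth w_n converging to u in
   H^1(disc). *)
Definition is_trace (u : R * R -> R[i]) (g : R -> R[i]) : Prop :=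
  inL2 lebesgue_measure angles g /\
  exists w : nat -> R * R -> R[i],
    [/\ forall n, csmooth (w n),
        (fun n => L2sq leb2 disc (w n \- u)) @ \oo --> 0%E,
        (fun n => L2sq leb2 disc (cderive ex (w n) \- wderive ex u))
          @ \oo --> 0%E,
        (fun n => L2sq leb2 disc (cderive ey (w n) \- wderive ey u))
          @ \oo --> 0%E
      & (fun n => L2sq lebesgue_measure angles ((w n \o circ) \- g))
          @ \oo --> 0%E].

Definition fourier_coef (g : R -> R[i]) (k : int) : R[i] :=
  ((2 * pi)^-1)%:C *
  cintegral lebesgue_measure angles
    (fun beta => g beta * (cos (k%:~R * beta) -i* sin (k%:~R * beta))).

Definition Hhalfsq (g : R -> R[i]) : \bar R :=
  (\esum_(k in [set: int])
     (Num.sqrt (1 + k%:~R ^+ 2) * sqmod (fourier_coef g k))%:E)%E.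

(* A sequence <v_0, v_{-1}, v_{-2}, ...> is encoded by v : nat -> _ with
   v j = v_{-j}. *)
Definition wsum (p : R) (N : nat -> \bar R) : \bar R :=
  (\sum_(0 <= j <oo) ((1 + j%:R ^+ 2) `^ p)%:E * N j)%E.

Definition l2L2sq (p : R) (u : nat -> R * R -> R[i]) : \bar R :=
  wsum p (fun j => L2sq leb2 disc (u j)).
Definition l2H1sq (p : R) (u : nat -> R * R -> R[i]) : \bar R :=
  wsum p (fun j => H1sq (u j)).
Definition l2Hhalfsq (p : R) (g : nat -> R -> R[i]) : \bar R :=
  wsum p (fun j => Hhalfsq (g j)).

Definition in_l2L2 (p : R) (u : nat -> R * R -> R[i]) : Prop :=
  (forall j, inL2 leb2 disc (u j)) /\ (l2L2sq p u < +oo)%E.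
Definition in_l2H1 (p : R) (u : nat -> R * R -> R[i]) : Prop :=
  (forall j, inH1 (u j)) /\ (l2H1sq p u < +oo)%E.

(* ||u||_{p,0}, ||u||_{p,1} and ||g||_{p,1/2}. Since fine +oo = 0, these are
   the norms only on the corresponding spaces; by the trace theorem this covers
   norm_l2Hhalf p g when g is the trace of an element of l^{2,p}(N; H^1). *)
Definition norm_l2L2 (p : R) (u : nat -> R * R -> R[i]) : R :=
  Num.sqrt (fine (l2L2sq p u)).
Definition norm_l2H1 (p : R) (u : nat -> R * R -> R[i]) : R :=
  Num.sqrt (fine (l2H1sq p u)).
Definition norm_l2Hhalf (p : R) (g : nat -> R -> R[i]) : R :=
  Num.sqrt (fine (l2Hhalfsq p g)).

Definition is_trace_seq (u : nat -> R * R -> R[i]) (g : nat -> R -> R[i]) :=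
  forall j, is_trace (u j) (g j).

Definition del_seq (u : nat -> R * R -> R[i]) : nat -> R * R -> R[i] :=
  fun j => del (u j).
Definition delbar_seq (u : nat -> R * R -> R[i]) : nat -> R * R -> R[i] :=
  fun j => delbar (u j).

Definition shiftL (u : nat -> R * R -> R[i]) : nat -> R * R -> R[i] :=
  fun j => u j.+1.

Definition ae_eq_seq (u w : nat -> R * R -> R[i]) : Prop :=
  forall j, ae_eq_disc (u j) (w j).

(* B induces a complex-linear operator on the space l^2(N; L^2(disc)) of
   sequences of classes modulo almost everywhere equality. *)
Definition linear_operator
    (B : (nat -> R * R -> R[i]) -> nat -> R * R -> R[i]) : Prop :=
  (forall u w, in_l2L2 0 u -> in_l2L2 0 w ->
     ae_eq_seq u w -> ae_eq_seq (B u) (B w)) /\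
  (forall (c : R[i]) u w, in_l2L2 0 u -> in_l2L2 0 w ->
     ae_eq_seq (B (fun j z => c * u j z + w j z))
               (fun j z => c * B u j z + B w j z)).

Definition poincare_constant (mu : R) : Prop :=
  forall (u : nat -> R * R -> R[i]) (g : nat -> R -> R[i]),
    in_l2H1 0 u -> is_trace_seq u g ->
    norm_l2L2 0 u ^+ 2 <=
      mu * (norm_l2L2 0 (del_seq u) ^+ 2 + norm_l2Hhalf 0 g ^+ 2).

Definition bukhgeim_beltrami
    (B : (nat -> R * R -> R[i]) -> nat -> R * R -> R[i])
    (f v : nat -> R * R -> R[i]) : Prop :=
  ae_eq_seq (delbar_seq v \+ shiftL (shiftL (del_seq v))) (B v \+ f).

End Disc.

(* Main.v *)
Require Import Defs.
From HB Require Import structures.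
From mathcomp Require Import all_boot all_order all_algebra.
From mathcomp Require Import all_classical all_reals all_analysis.
From mathcomp Require Import measurable_realfun complex.
From mathcomp Require Import zify ring lra.

(** The proof rests on an energy identity. For u smooth on the closed disc with
    Fourier coefficients u_k on the circle,
      |del u|^2 - |delbar u|^2 = pi * sum_k k |u_k|^2,
    since the integrand on the left is the Jacobian determinant of u and hence
    a divergence. Dropping the negative frequencies gives
      |del u|^2 <= |delbar u|^2 + pi * |u|_Gamma|^2_(H^(1/2)).
    The equation replaces delbar v_(-j) by B v + f - del v_(-j-2), so this
    inequality bounds |del v_(-j)|^2 by |del v_(-j-2)|^2 plus terms in f, B v and
    the trace. Iterating over j, j + 2, j + 4, ... and summing over j counts the
    index j exactly j./2 + 1 <= (1 + j^2)^(1/2) times, which explains the weights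
    in the norms of the data ([iterated_energy]). The bound of B and Poincare's
    inequality then leave a quadratic inequality a X^2 <= b X + c for the norm X
    of del v ([closing_estimate], [quadratic_bound]).

    The identity for smooth functions has two ingredients. Green's formula on the
    disc, obtained by slicing and substitution ([green_x], [green_y]), together
    with the symmetry of second derivatives ([derive_swap]) expresses the
    difference of the energies by the boundary values ([energy_boundary]). Then
    the Fourier series has to converge in mean on the circle; following Chernoff,
    the partial sum at t0 minus the value at t0 telescopes into two Fourier
    coefficients of a bounded difference quotient ([partial_fourierE]), which tend
    to zero by Bessel's inequality.

    Green's formula also shows that the pairing of del u with the monomial z^n on
    the disc is pi * u_(n+1), and likewise for delbar u and the conjugate
    monomials ([inner_cdel], [inner_cdelbar]). Bessel's inequality for monomials
    then bounds the energy of the positive frequencies by |del u|^2 and that of the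
    negative ones by |delbar u|^2. This is the trace theorem ([Hhalfsq_le]), which
    guarantees that the trace norms are finite; applied to the difference of u and
    its smooth approximations, the same argument extends the energy inequality to
    the Sobolev space ([energy_trace]). *)

Set Implicit Arguments.
Unset Strict Implicit.
Unset Printing Implicit Defensive.

Import Order.TTheory GRing.Theory Num.Theory.
Import numFieldNormedType.Exports.
Local Open Scope classical_set_scope.
Local Open Scope ring_scope.
Local Open Scope complex_scope.

(** * Complex numbers *)

Section ComplexNumbers.
Context {R : realType}.
Implicit Types x y : R[i].

Lemma complex_ext x y :
  complex.Re x = complex.Re y -> complex.Im x = complex.Im y -> x = y.
Proof. by case: x y => [a b] [c d] /= -> ->. Qed.

Lemma cReD x y : complex.Re (x + y) = complex.Re x + complex.Re y.
Proof. by case: x y => [a b] [c d]. Qed.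
Lemma cImD x y : complex.Im (x + y) = complex.Im x + complex.Im y.
Proof. by case: x y => [a b] [c d]. Qed.
Lemma cReN x : complex.Re (- x) = - complex.Re x.
Proof. by case: x. Qed.
Lemma cImN x : complex.Im (- x) = - complex.Im x.
Proof. by case: x. Qed.
Lemma cReM x y : complex.Re (x * y) =
  complex.Re x * complex.Re y - complex.Im x * complex.Im y.
Proof. by case: x y => [a b] [c d]. Qed.
Lemma cImM x y : complex.Im (x * y) =
  complex.Re x * complex.Im y + complex.Im x * complex.Re y.
Proof. by case: x y => [a b] [c d]. Qed.
Lemma cReJ x : complex.Re (conjc x) = complex.Re x.
Proof. by case: x. Qed.
Lemma cImJ x : complex.Im (conjc x) = - complex.Im x.
Proof. by case: x. Qed.
Lemma cReR (a : R) : complex.Re a%:C = a. Proof. by []. Qed.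
Lemma cImR (a : R) : complex.Im a%:C = 0. Proof. by []. Qed.

Definition ReImE := (cReD, cImD, cReN, cImN, cReM, cImM, cReJ, cImJ, cReR, cImR).

Lemma complex_half : (2^-1 : R[i]) = (2^-1 : R)%:C.
Proof. by rewrite fmorphV/= rmorph_nat. Qed.

Lemma natC n : (n%:R : R[i]) = (n%:R : R)%:C.
Proof. by rewrite rmorph_nat. Qed.

Lemma ReZl (a : R) x : complex.Re (a%:C * x) = a * complex.Re x.
Proof. by rewrite !ReImE mul0r subr0. Qed.
Lemma ImZl (a : R) x : complex.Im (a%:C * x) = a * complex.Im x.
Proof. by rewrite !ReImE mul0r addr0. Qed.

Lemma Re_sum I (s : seq I) (P : pred I) (F : I -> R[i]) :
  complex.Re (\sum_(i <- s | P i) F i) = \sum_(i <- s | P i) complex.Re (F i).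
Proof. by apply: (big_morph _ cReD). Qed.
Lemma cjD x y : conjc (x + y) = conjc x + conjc y.
Proof. by apply: complex_ext; rewrite !ReImE//; ring. Qed.
Lemma cjM x y : conjc (x * y) = conjc x * conjc y.
Proof. by apply: complex_ext; rewrite !ReImE; ring. Qed.
Lemma cjK x : conjc (conjc x) = x.
Proof. by apply: complex_ext; rewrite !ReImE ?opprK. Qed.
Lemma cjR (a : R) : conjc (a%:C) = a%:C.
Proof. by apply: complex_ext; rewrite !ReImE ?oppr0. Qed.
Lemma cj_sum I (s : seq I) (P : pred I) (F : I -> R[i]) :
  conjc (\sum_(i <- s | P i) F i) = \sum_(i <- s | P i) conjc (F i).
Proof. by apply: (big_morph _ cjD); rewrite (cjR 0). Qed.

Lemma sqmod_ge0 x : 0 <= sqmod x.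
Proof. by rewrite addr_ge0// sqr_ge0. Qed.
Lemma sqmod_eq0 x : sqmod x = 0 -> x = 0.
Proof.
move=> /eqP; rewrite paddr_eq0 ?sqr_ge0// !sqrf_eq0 => /andP[/eqP a /eqP b].
exact: complex_ext.
Qed.
Lemma sqmodM x y : sqmod (x * y) = sqmod x * sqmod y.
Proof. by rewrite /sqmod !ReImE; ring. Qed.
Lemma sqmodN x : sqmod (- x) = sqmod x.
Proof. by rewrite /sqmod !ReImE; ring. Qed.
Lemma sqmodJ x : sqmod (conjc x) = sqmod x.
Proof. by rewrite /sqmod !ReImE; ring. Qed.
Lemma sqmodR (a : R) : sqmod a%:C = a ^+ 2.
Proof. by rewrite /sqmod !ReImE expr0n/= addr0. Qed.
Lemma mul_conj x : x * conjc x = (sqmod x)%:C.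
Proof. by apply: complex_ext; rewrite /sqmod !ReImE; ring. Qed.
Lemma le_sqmodD x y : sqmod (x + y) <= 2 * sqmod x + 2 * sqmod y.
Proof.
rewrite -subr_ge0 (_ : _ - _ = sqmod (x - y)) ?sqmod_ge0//.
by rewrite /sqmod !ReImE; ring.
Qed.

End ComplexNumbers.

(** * Square-integrable complex-valued functions *)

Section ComplexIntegral.
Context d (T : measurableType d) {R : realType}.
Variables (mu : {measure set T -> \bar R}) (D : set T).
Hypothesis mD : measurable D.
Implicit Types (u w : T -> R[i]).

Definition cintegrable u :=
  mu.-integrable D (fun x => (complex.Re (u x))%:E) /\
  mu.-integrable D (fun x => (complex.Im (u x))%:E).

Lemma Rintegral0 : \int[mu]_(x in D) (0 : R) = 0.
Proof. by rewrite Rintegral_cst// mul0r. Qed.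

Lemma RintegrableZ (c : R) (f : T -> R) :
  mu.-integrable D (EFin \o f) -> mu.-integrable D (EFin \o (fun x => c * f x)).
Proof. by move=> h; exact: (integrableZl mD c h). Qed.

Lemma Re_cintegral u :
  complex.Re (cintegral mu D u) = \int[mu]_(x in D) complex.Re (u x).
Proof. by []. Qed.
Lemma Im_cintegral u :
  complex.Im (cintegral mu D u) = \int[mu]_(x in D) complex.Im (u x).
Proof. by []. Qed.

Lemma cmeasurableD u w :
  cmeasurable D u -> cmeasurable D w -> cmeasurable D (fun x => u x + w x).
Proof.
move=> [u1 u2] [w1 w2]; split.
- by under eq_fun do rewrite cReD; exact: measurable_funD.
- by under eq_fun do rewrite cImD; exact: measurable_funD.
Qed.

Lemma cmeasurableM u w :
  cmeasurable D u -> cmeasurable D w -> cmeasurable D (fun x => u x * w x).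
Proof.
move=> [u1 u2] [w1 w2]; split.
- under eq_fun do rewrite cReM.
  by apply: measurable_funB; exact: measurable_funM.
- under eq_fun do rewrite cImM.
  by apply: measurable_funD; exact: measurable_funM.
Qed.

Lemma cmeasurableJ u :
  cmeasurable D u -> cmeasurable D (fun x => conjc (u x)).
Proof.
move=> [u1 u2]; split; first by under eq_fun do rewrite cReJ.
by under eq_fun do rewrite cImJ; exact: measurableT_comp.
Qed.

Lemma cmeasurable_cst (c : R[i]) : cmeasurable D (fun=> c).
Proof. by split; exact: measurable_cst. Qed.

Lemma measurable_sqmod u : cmeasurable D u -> measurable_fun D (fun x => sqmod (u x)).
Proof.
by move=> [u1 u2]; apply: measurable_funD; exact: measurable_funX.
Qed.

Lemma eq_cintegral u w :
  {in D, u =1 w} -> cintegral mu D u = cintegral mu D w.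
Proof.
move=> uw; rewrite /cintegral.
by congr (_ +i* _); apply: eq_Rintegral => x xD; rewrite uw.
Qed.

Lemma cintegrableD u w :
  cintegrable u -> cintegrable w -> cintegrable (fun x => u x + w x).
Proof.
move=> [u1 u2] [w1 w2]; split.
- by under eq_fun do rewrite cReD EFinD; exact: integrableD.
- by under eq_fun do rewrite cImD EFinD; exact: integrableD.
Qed.

Lemma cintegralD u w : cintegrable u -> cintegrable w ->
  cintegral mu D (fun x => u x + w x) = cintegral mu D u + cintegral mu D w.
Proof.
move=> [u1 u2] [w1 w2]; apply: complex_ext.
- rewrite cReD !Re_cintegral -RintegralD//.
  by apply: eq_Rintegral => x _; rewrite cReD.
- rewrite cImD !Im_cintegral -RintegralD//.
  by apply: eq_Rintegral => x _; rewrite cImD.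
Qed.

Lemma cintegralZ c u : cintegrable u ->
  cintegral mu D (fun x => c * u x) = c * cintegral mu D u.
Proof.
move=> [u1 u2]; apply: complex_ext.
- rewrite cReM !Re_cintegral !Im_cintegral -!RintegralZl// -RintegralB//.
  + by apply: eq_Rintegral => x _; rewrite cReM.
  + exact: RintegrableZ.
  + exact: RintegrableZ.
- rewrite cImM !Re_cintegral !Im_cintegral -!RintegralZl// -RintegralD//.
  + by apply: eq_Rintegral => x _; rewrite cImM.
  + exact: RintegrableZ.
  + exact: RintegrableZ.
Qed.

Lemma cintegralJ u : cintegrable u ->
  cintegral mu D (fun x => conjc (u x)) = conjc (cintegral mu D u).
Proof.
move=> [u1 u2]; apply: complex_ext.
- by rewrite cReJ !Re_cintegral; apply: eq_Rintegral => x _; rewrite cReJ.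
- rewrite cImJ !Im_cintegral -mulN1r -RintegralZl//.
  by apply: eq_Rintegral => x _; rewrite cImJ mulN1r.
Qed.

Lemma cintegrable0 : cintegrable (fun=> 0).
Proof. by split; exact: integrable0. Qed.

Lemma cintegral0 : cintegral mu D (fun=> 0) = 0.
Proof.
by apply: complex_ext; rewrite ?Re_cintegral ?Im_cintegral; exact: Rintegral0.
Qed.

Lemma cintegrable_sum I (s : seq I) (F : I -> T -> R[i]) :
  (forall i, cintegrable (F i)) -> cintegrable (fun x => \sum_(i <- s) F i x).
Proof.
move=> iF; elim: s => [|i s ih].
  by under eq_fun do rewrite big_nil; exact: cintegrable0.
by under eq_fun do rewrite big_cons; exact: cintegrableD.
Qed.

Lemma cintegral_sum I (s : seq I) (F : I -> T -> R[i]) :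
  (forall i, cintegrable (F i)) ->
  cintegral mu D (fun x => \sum_(i <- s) F i x) =
  \sum_(i <- s) cintegral mu D (F i).
Proof.
move=> iF; elim: s => [|i s ih].
  by under eq_fun do rewrite big_nil; rewrite big_nil cintegral0.
under eq_fun do rewrite big_cons.
by rewrite cintegralD ?ih ?big_cons//; exact: cintegrable_sum.
Qed.

Definition normsq u : R := fine (L2sq mu D u).

Definition inner u w : R[i] := cintegral mu D (fun x => u x * conjc (w x)).

Lemma normsq_ge0 u : 0 <= normsq u.
Proof.
by apply: fine_ge0; apply: integral_ge0 => x _; rewrite lee_fin sqmod_ge0.
Qed.

Lemma inL2_sqmod u : inL2 mu D u ->
  mu.-integrable D (fun x => (sqmod (u x))%:E).
Proof.
move=> [mu_ lu]; apply/integrableP; split.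
  apply/measurable_EFinP; exact: measurable_sqmod.
apply: le_lt_trans lu; apply: ge0_le_integral => //=.
- apply/measurable_EFinP; apply: measurableT_comp => //; exact: measurable_sqmod.
- apply/measurable_EFinP; exact: measurable_sqmod.
- by move=> x _; rewrite ger0_norm ?sqmod_ge0.
Qed.

Lemma L2sqE u : inL2 mu D u -> L2sq mu D u = (normsq u)%:E.
Proof. by move=> /inL2_sqmod iu; rewrite fineK// integrable_fin_num. Qed.

Lemma le_inL2 u w : cmeasurable D u -> inL2 mu D w ->
  (forall x, D x -> sqmod (u x) <= sqmod (w x)) -> inL2 mu D u.
Proof.
move=> mu_ [mw lw] uw; split=> //; apply: le_lt_trans lw.
apply: ge0_le_integral => //=.
- by move=> x _; rewrite lee_fin sqmod_ge0.
- apply/measurable_EFinP; exact: measurable_sqmod.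
- apply/measurable_EFinP; exact: measurable_sqmod.
Qed.

Lemma inL2D u w :
  inL2 mu D u -> inL2 mu D w -> inL2 mu D (fun x => u x + w x).
Proof.
move=> hu hw; have [mu_ _] := hu; have [mw _] := hw.
split; first exact: cmeasurableD.
apply: (@le_lt_trans _ _
  (\int[mu]_(x in D) (2%:E * (sqmod (u x))%:E + 2%:E * (sqmod (w x))%:E))%E).
  apply: ge0_le_integral => //=.
  - by move=> x _; rewrite lee_fin sqmod_ge0.
  - apply/measurable_EFinP; apply: measurable_sqmod; exact: cmeasurableD.
  - by apply: emeasurable_funD; apply: measurable_funeM;
      apply/measurable_EFinP; exact: measurable_sqmod.
  - by move=> x _; rewrite lee_fin le_sqmodD.
apply: integrable_lty => //; apply: integrableD => //;
  by apply: integrableZl => //; exact: inL2_sqmod.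
Qed.

Lemma inL2Z c u : inL2 mu D u -> inL2 mu D (fun x => c * u x).
Proof.
move=> hu; have [mu_ _] := hu; split.
  by apply: cmeasurableM => //; exact: cmeasurable_cst.
rewrite /L2sq; under eq_integral do rewrite sqmodM EFinM.
by apply: integrable_lty => //; apply: integrableZl => //; exact: inL2_sqmod.
Qed.

Lemma normsqZ c u : inL2 mu D u ->
  normsq (fun x => c * u x) = sqmod c * normsq u.
Proof.
move=> hu; rewrite /normsq/L2sq.
under eq_integral do rewrite sqmodM EFinM.
by rewrite integralZl ?fineM ?integrable_fin_num//; exact: inL2_sqmod.
Qed.

Lemma eq_inL2 u w : {in D, u =1 w} -> inL2 mu D u -> inL2 mu D w.
Proof.
move=> uw [[u1 u2] lu]; split; first split.
- by apply: eq_measurable_fun u1 => x xD; rewrite uw.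
- by apply: eq_measurable_fun u2 => x xD; rewrite uw.
- by move: lu; rewrite /L2sq; under eq_integral => x xD do rewrite uw//.
Qed.

Lemma inL2B u w :
  inL2 mu D u -> inL2 mu D w -> inL2 mu D (fun x => u x - w x).
Proof.
move=> hu hw; apply: inL2D => //; apply: eq_inL2 (inL2Z (- 1) hw) => x _.
by rewrite mulN1r.
Qed.

Lemma inL2_0 : inL2 mu D (fun=> 0).
Proof.
split; first exact: cmeasurable_cst.
rewrite /L2sq /sqmod /= expr0n/= addr0.
by under eq_integral do []; rewrite integral0.
Qed.

Lemma inL2_sum I (s : seq I) (F : I -> T -> R[i]) :
  (forall i, inL2 mu D (F i)) -> inL2 mu D (fun x => \sum_(i <- s) F i x).
Proof.
move=> iF; elim: s => [|i s ih].
  by under eq_fun do rewrite big_nil; exact: inL2_0.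
by under eq_fun do rewrite big_cons; exact: inL2D.
Qed.

Lemma inner_integrable u w : inL2 mu D u -> inL2 mu D w ->
  cintegrable (fun x => u x * conjc (w x)).
Proof.
move=> hu hw; have [m1 m2] : cmeasurable D (fun x => u x * conjc (w x)).
  by apply: cmeasurableM; [case: hu|apply: cmeasurableJ; case: hw].
have iuw : mu.-integrable D
    (fun x => (sqmod (u x))%:E + (sqmod (w x))%:E)%E.
  by apply: integrableD => //; exact: inL2_sqmod.
split.
- apply: (le_integrable mD _ _ iuw) => //; first exact/measurable_EFinP.
  move=> x Dx /=; have hx := sqmod_ge0 (u x); have hy := sqmod_ge0 (w x).
  rewrite lee_fin [leRHS]ger0_norm; last exact: addr_ge0.
  rewrite ler_norml /sqmod !ReImE; apply/andP; split; rewrite -subr_ge0.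
  + have := sqr_ge0 (complex.Re (u x) + complex.Re (w x)).
    have := sqr_ge0 (complex.Im (u x) + complex.Im (w x)).
    have := sqr_ge0 (complex.Re (u x) - complex.Re (w x)).
    have := sqr_ge0 (complex.Im (u x) - complex.Im (w x)).
    nra.
  + have := sqr_ge0 (complex.Re (u x) - complex.Re (w x)).
    have := sqr_ge0 (complex.Im (u x) - complex.Im (w x)).
    nra.
- apply: (le_integrable mD _ _ iuw) => //; first exact/measurable_EFinP.
  move=> x Dx /=; have hx := sqmod_ge0 (u x); have hy := sqmod_ge0 (w x).
  rewrite lee_fin [leRHS]ger0_norm; last exact: addr_ge0.
  rewrite ler_norml /sqmod !ReImE; apply/andP; split; rewrite -subr_ge0.
  + have := sqr_ge0 (complex.Re (u x) - complex.Im (w x)).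
    have := sqr_ge0 (complex.Im (u x) + complex.Re (w x)).
    nra.
  + have := sqr_ge0 (complex.Re (u x) + complex.Im (w x)).
    have := sqr_ge0 (complex.Im (u x) - complex.Re (w x)).
    nra.
Qed.

Lemma innerDl u1 u2 w : inL2 mu D u1 -> inL2 mu D u2 -> inL2 mu D w ->
  inner (fun x => u1 x + u2 x) w = inner u1 w + inner u2 w.
Proof.
move=> h1 h2 hw; rewrite /inner -cintegralD//; do ?exact: inner_integrable.
by apply: eq_cintegral => x _; rewrite mulrDl.
Qed.

Lemma innerZl c u w : inL2 mu D u -> inL2 mu D w ->
  inner (fun x => c * u x) w = c * inner u w.
Proof.
move=> h1 hw; rewrite /inner -cintegralZ//; do ?exact: inner_integrable.
by apply: eq_cintegral => x _; rewrite mulrA.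
Qed.

Lemma innerJ u w : inL2 mu D u -> inL2 mu D w -> inner u w = conjc (inner w u).
Proof.
move=> hu hw; rewrite /inner -cintegralJ; last exact: inner_integrable.
by apply: eq_cintegral => x _ /=; rewrite cjM cjK mulrC.
Qed.

Lemma innerDr u w1 w2 : inL2 mu D u -> inL2 mu D w1 -> inL2 mu D w2 ->
  inner u (fun x => w1 x + w2 x) = inner u w1 + inner u w2.
Proof.
move=> hu h1 h2; rewrite innerJ//; last exact: inL2D.
by rewrite innerDl// cjD -!innerJ.
Qed.

Lemma innerZr c u w : inL2 mu D u -> inL2 mu D w ->
  inner u (fun x => c * w x) = conjc c * inner u w.
Proof.
move=> h1 hw; rewrite innerJ//; last exact: inL2Z.
by rewrite innerZl// cjM -innerJ.
Qed.

Lemma innerBl u1 u2 w : inL2 mu D u1 -> inL2 mu D u2 -> inL2 mu D w ->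
  inner (fun x => u1 x - u2 x) w = inner u1 w - inner u2 w.
Proof.
move=> h1 h2 hw; rewrite -[- inner u2 w]mulN1r -innerZl// -innerDl//.
  by congr (inner _ _); apply/funext => x; rewrite mulN1r.
exact: inL2Z.
Qed.

Lemma inner_sumr u I (s : seq I) (F : I -> T -> R[i]) :
  inL2 mu D u -> (forall i, inL2 mu D (F i)) ->
  inner u (fun x => \sum_(i <- s) F i x) = \sum_(i <- s) inner u (F i).
Proof.
move=> hu hF; rewrite /inner -cintegral_sum; last first.
  by move=> i; exact: inner_integrable.
by apply: eq_cintegral => x _; rewrite cj_sum mulr_sumr.
Qed.

Lemma inner_suml u I (s : seq I) (F : I -> T -> R[i]) :
  inL2 mu D u -> (forall i, inL2 mu D (F i)) ->
  inner (fun x => \sum_(i <- s) F i x) u = \sum_(i <- s) inner (F i) u.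
Proof.
move=> hu hF; rewrite innerJ//; last exact: inL2_sum.
by rewrite inner_sumr// cj_sum; apply: eq_bigr => i _; rewrite -innerJ.
Qed.

Lemma innerE u : inL2 mu D u -> inner u u = (normsq u)%:C.
Proof.
move=> hu; apply: complex_ext.
- rewrite [inner u u]/inner Re_cintegral -[RHS]/(normsq u) /normsq /L2sq /Rintegral; congr fine.
  by apply: eq_integral => x _; rewrite mul_conj.
- rewrite [inner u u]/inner Im_cintegral -[RHS]/(0 : R) -[RHS]Rintegral0.
  by apply: eq_Rintegral => x _; rewrite mul_conj.
Qed.

Lemma normsqD u w : inL2 mu D u -> inL2 mu D w ->
  normsq (fun x => u x + w x) =
  normsq u + 2 * complex.Re (inner u w) + normsq w.
Proof.
move=> hu hw.
have huw := inL2D hu hw.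
have -> : normsq (fun x => u x + w x) =
    complex.Re (inner (fun x => u x + w x) (fun x => u x + w x)).
  by rewrite innerE.
rewrite innerDl// !innerDr// !innerE// (innerJ hw hu) !ReImE; ring.
Qed.

Lemma Re_inner_le u w : inL2 mu D u -> inL2 mu D w ->
  complex.Re (inner u w) ^+ 2 <= normsq u * normsq w.
Proof.
move=> hu hw.
set A := normsq u; set C := normsq w; set b := complex.Re _.
have H t : 0 <= A + 2 * t * b + t ^+ 2 * C.
  have := normsq_ge0 (fun x => u x + t%:C * w x).
  rewrite normsqD//; last exact: inL2Z.
  rewrite innerZr// cjR normsqZ// sqmodR ReZl -/A -/C -/b.
  by rewrite (_ : 2 * (t * b) = 2 * t * b)//; ring.
have C0 : 0 <= C by exact: normsq_ge0.
have A0 : 0 <= A by exact: normsq_ge0.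
have [C_eq0|C_neq0] := eqVneq C 0.
  have [->|b0] := eqVneq b 0; first by rewrite C_eq0 expr0n/= mulr0.
  have := H (- (A + 1) / (2 * b)).
  have -> : 2 * (- (A + 1) / (2 * b)) * b = - (A + 1) by field.
  by rewrite C_eq0 mulr0; lra.
have := H (- b / C).
have -> : A + 2 * (- b / C) * b + (- b / C) ^+ 2 * C = (A * C - b ^+ 2) / C.
  by field.
rewrite pmulr_lge0 ?subr_ge0// invr_gt0; lra.
Qed.

Lemma sqmod_inner_le u w : inL2 mu D u -> inL2 mu D w ->
  sqmod (inner u w) <= normsq u * normsq w.
Proof.
move=> hu hw; set c := inner u w.
have := Re_inner_le (inL2Z (conjc c) hu) hw.
rewrite innerZl// mulrC mul_conj cReR normsqZ// sqmodJ -mulrA.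
have := sqmod_ge0 c; rewrite le_eqVlt => /predU1P[<-|c0].
  by rewrite mulr_ge0// normsq_ge0.
by rewrite expr2 ler_pM2l.
Qed.

Lemma normsqD_le u w : inL2 mu D u -> inL2 mu D w ->
  Num.sqrt (normsq (fun x => u x + w x)) <=
  Num.sqrt (normsq u) + Num.sqrt (normsq w).
Proof.
move=> hu hw.
rewrite -(@ler_pXn2r _ 2) ?nnegrE ?addr_ge0 ?sqrtr_ge0//.
rewrite sqr_sqrtr ?normsq_ge0// normsqD// sqrrD !sqr_sqrtr ?normsq_ge0//.
rewrite lerD2r lerD2l -[leRHS]mulr_natl ler_pM2l// -sqrtrM ?normsq_ge0//.
apply: (le_trans (ler_norm _)).
rewrite -sqrtr_sqr ler_sqrt ?mulr_ge0 ?normsq_ge0//; exact: Re_inner_le.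
Qed.

(** Bessel's inequality: the right-hand side minus the left-hand side is the
   squared distance of u to the span of the orthogonal family. *)
Lemma bessel u n (e : 'I_n -> T -> R[i]) (N : 'I_n -> R) :
  inL2 mu D u -> (forall i, inL2 mu D (e i)) -> (forall i, 0 < N i) ->
  (forall i j, inner (e i) (e j) = if i == j then (N i)%:C else 0) ->
  \sum_(i < n) sqmod (inner u (e i)) / N i <= normsq u.
Proof.
move=> hu he N0 oe.
pose c i := (- (N i)^-1)%:C * inner u (e i).
pose s x := \sum_(i <- index_enum 'I_n) c i * e i x.
have hce i : inL2 mu D (fun x => c i * e i x) by exact: inL2Z.
have hs : inL2 mu D s by exact: inL2_sum.
have cs i : inner (e i) s = conjc (c i) * (N i)%:C.
  rewrite inner_sumr//= (bigD1 i)//= big1 ?addr0 => [|j ji].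
    by rewrite innerZr// oe eqxx.
  by rewrite innerZr// oe eq_sym (negPf ji) mulr0.
have us : complex.Re (inner u s) = - \sum_(i < n) sqmod (inner u (e i)) / N i.
  rewrite inner_sumr// Re_sum -sumrN; apply: eq_bigr => i _.
  rewrite innerZr// /c cjM cjR -mulrA [conjc _ * _]mulrC mul_conj.
  by rewrite ReZl cReR mulrC mulrN.
have ss : normsq s = \sum_(i < n) sqmod (inner u (e i)) / N i.
  rewrite -[LHS]cReR -innerE// [in inner s s]/s inner_suml// Re_sum.
  apply: eq_bigr => i _; rewrite innerZl// cs mulrA mul_conj -rmorphM/=.
  rewrite /c sqmodM sqmodR sqrrN.
  by field; rewrite gt_eqF.
have := normsq_ge0 (fun x => u x + s x).
rewrite normsqD// us ss; lra.
Qed.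

End ComplexIntegral.

(** * Continuously differentiable functions on the plane *)

Section Plane.
Context {R : realType}.
Implicit Types (P Q : R * R -> R) (z e : R * R).

(** The product of the two copies of the line carrying the sigma-algebra for
    which the Lebesgue measure is declared; it differs syntactically from the
    one inferred for R * R. *)
Definition plane := (measurableTypeR R * measurableTypeR R)%type.

(** An open set of the plane is the union of the boxes with rational centres
    and radii 1 / (n + 1) that it contains. *)
Lemma continuous_measurable_plane P : continuous P -> measurable_fun [set: plane] P.
Proof.
move=> /continuousP cP; apply: (measurability _ (RGenOpens.measurableE R)).
move=> _ [_ [a [b ->] <-]]; rewrite setTI.
set U := P @^-1` _.
have oU : open U by exact/cP/interval_open.
pose box (a : rat * rat * nat) : set (R * R) :=
  (ball (ratr a.1.1 : R) a.2.+1%:R^-1) `*` (ball (ratr a.1.2 : R) a.2.+1%:R^-1).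
pose V a := if pselect (box a `<=` U) then box a else set0.
rewrite (_ : U = \bigcup_a V a); last first.
  apply/seteqP; split=> [z Uz|z [q _]]; last first.
    by rewrite /V; case: pselect => [qU Vz|//]; apply: (qU).
  have /nbhs_ballP[r /= r0 zrU] := open_nbhs_nbhs (conj oU Uz).
  have [n nr] : exists n, n.+1%:R^-1 < r / 2 :> R.
    have r2 : 0 < r / 2 by rewrite divr_gt0.
    by have [n _ /(_ n (leqnn n))] := near_infty_natSinv_lt (PosNum r2); exists n.
  have [p zp] : exists p : rat, ball z.1 n.+1%:R^-1 (ratr p).
    have /rat_in_itvoo[p pz] : z.1 - n.+1%:R^-1 < z.1 + n.+1%:R^-1.
      by rewrite ltrD2l gtrN// invr_gt0 ltr0n.
    exists p; rewrite /ball/= ltr_distlC.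
    by move: pz; rewrite in_itv.
  have [q zq] : exists q : rat, ball z.2 n.+1%:R^-1 (ratr q).
    have /rat_in_itvoo[q pz] : z.2 - n.+1%:R^-1 < z.2 + n.+1%:R^-1.
      by rewrite ltrD2l gtrN// invr_gt0 ltr0n.
    exists q; rewrite /ball/= ltr_distlC.
    by move: pz; rewrite in_itv.
  have lbr : n.+1%:R^-1 + n.+1%:R^-1 <= r by rewrite (splitr r) lerD// ltW.
  exists (p, q, n) => //; rewrite /V; case: pselect => [bU|[]].
    by split=> /=; exact: ball_sym.
  move=> w [/= w1 w2]; apply: zrU; split=> /=.
    by apply: (le_ball lbr); exact: (ball_triangle zp w1).
  by apply: (le_ball lbr); exact: (ball_triangle zq w2).
apply: countable_bigcupT_measurable => [|q]; first exact: countableP.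
rewrite /V.
case: pselect => [bU|nU]; last exact: measurable0.
exact: measurableX (measurable_ball _ _) (measurable_ball _ _).
Qed.

Lemma measurable_disc : measurable (@disc R : set plane).
Proof.
have -> : @disc R = (fun z : plane => z.1 ^+ 2 + z.2 ^+ 2 : R) @^-1` `]-oo, 1[.
  by apply/seteqP; split=> z /=; rewrite in_itv.
rewrite -[X in measurable X]setTI.
have : measurable_fun setT (fun z : plane => z.1 ^+ 2 + z.2 ^+ 2 : R).
  by apply: measurable_funD; exact: measurable_funX.
by apply.
Qed.

Definition C1 P := (forall z, differentiable P z) /\
  forall e, continuous (fun z => 'D_e P z).

Lemma smooth_derive P e : smooth P -> smooth (fun z => 'D_e P z).
Proof. by move=> sP s z; have := sP (rcons s e) z; rewrite foldr_rcons. Qed.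

Lemma smooth_C1 P : smooth P -> C1 P.
Proof.
move=> sP; split=> [z|e z]; first exact: (sP [::]).
by apply: differentiable_continuous; exact: (sP [:: e]).
Qed.

Lemma C1_continuous P : C1 P -> continuous P.
Proof. by move=> [dP _] z; exact: differentiable_continuous. Qed.

Lemma C1_derivable P : C1 P -> forall z e, derivable P z e.
Proof. by move=> [dP _] z e; exact: diff_derivable. Qed.

Lemma C1D P Q : C1 P -> C1 Q -> C1 (fun z => P z + Q z).
Proof.
move=> hP hQ; split=> [z|e].
  by apply: differentiableD; [case: hP|case: hQ].
have -> : (fun z => 'D_e (fun z => P z + Q z) z) = fun z => 'D_e P z + 'D_e Q z.
  by apply/funext => z; rewrite deriveD//; exact: C1_derivable.
by move=> z; apply: cvgD; [case: hP => _; exact|case: hQ => _; exact].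
Qed.

Lemma derivePM P Q z e : C1 P -> C1 Q ->
  'D_e (fun z => P z * Q z) z = P z * 'D_e Q z + Q z * 'D_e P z.
Proof. by move=> hP hQ; rewrite deriveM//; exact: C1_derivable. Qed.

Lemma C1M P Q : C1 P -> C1 Q -> C1 (fun z => P z * Q z).
Proof.
move=> hP hQ; split=> [z|e].
  by apply: differentiableM; [case: hP|case: hQ].
under eq_fun do rewrite derivePM//.
move=> z; apply: cvgD; apply: cvgM; do ?exact: C1_continuous.
  by case: hQ => _; exact.
by case: hP => _; exact.
Qed.

Lemma C1_cst (c : R) : C1 (fun=> c).
Proof.
split=> [z|e]; first exact: differentiable_cst.
have -> : (fun z => 'D_e (fun=> c) z) = fun=> 0 :> R.
  by apply/funext => z; exact: derive_cst.
by move=> z; exact: cvg_cst.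
Qed.

Lemma is_diff_fst z : is_diff z (fun z : R * R => z.1) (fun z => z.1).
Proof.
have lin1 : linear (fun z : R * R => z.1) by [].
pose lM := GRing.isLinear.Build _ _ _ _ _ lin1.
pose L : {linear (R * R)%type -> R} := HB.pack (fun z : R * R => z.1) lM.
have cL : continuous L by move=> w; exact: cvg_fst.
by apply: DiffDef; [exact: (@linear_differentiable _ _ _ L)|
                    exact: (@diff_lin _ _ _ L)].
Qed.

Lemma is_diff_snd z : is_diff z (fun z : R * R => z.2) (fun z => z.2).
Proof.
have lin2 : linear (fun z : R * R => z.2) by [].
pose lM := GRing.isLinear.Build _ _ _ _ _ lin2.
pose L : {linear (R * R)%type -> R} := HB.pack (fun z : R * R => z.2) lM.
have cL : continuous L by move=> w; exact: cvg_snd.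
by apply: DiffDef; [exact: (@linear_differentiable _ _ _ L)|
                    exact: (@diff_lin _ _ _ L)].
Qed.

Lemma derive_fst z e : 'D_e (fun z : R * R => z.1) z = e.1.
Proof. by have [d dE] := is_diff_fst z; rewrite deriveE ?dE. Qed.

Lemma derive_snd z e : 'D_e (fun z : R * R => z.2) z = e.2.
Proof. by have [d dE] := is_diff_snd z; rewrite deriveE ?dE. Qed.

Lemma C1_fst : C1 (fun z => z.1).
Proof.
split=> [z|e]; first by case: (is_diff_fst z).
by under eq_fun do rewrite derive_fst; move=> z; exact: cvg_cst.
Qed.

Lemma C1_snd : C1 (fun z => z.2).
Proof.
split=> [z|e]; first by case: (is_diff_snd z).
by under eq_fun do rewrite derive_snd; move=> z; exact: cvg_cst.
Qed.

Lemma derive_dir P z e : C1 P ->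
  'D_e P z = e.1 * 'D_ex P z + e.2 * 'D_ey P z.
Proof.
move=> [dP _]; rewrite !deriveE//.
have {1}-> : e = e.1 *: ex + e.2 *: ey.
  case: e => a b; congr pair.
    by rewrite /= /GRing.scale/= mulr1 mulr0 addr0.
  by rewrite /= /GRing.scale/= mulr1 mulr0 add0r.
by rewrite linearD !linearZ.
Qed.

Lemma is_derive_curve P (x y : R -> R) (t dx dy : R) : C1 P ->
  is_derive t 1 x dx -> is_derive t 1 y dy ->
  is_derive t 1 (fun t => P (x t, y t))
    (dx * 'D_ex P (x t, y t) + dy * 'D_ey P (x t, y t)).
Proof.
move=> hP hx hy; have [dP _] := hP.
have dfx : differentiable x t by apply/derivable1_diffP; case: hx.
have dfy : differentiable y t by apply/derivable1_diffP; case: hy.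
have dxy : differentiable (fun t => (x t, y t)) t by exact: differentiable_pair.
have dPxy : differentiable (P \o (fun t => (x t, y t))) t.
  exact: differentiable_comp.
apply: DeriveDef; first exact/derivable1_diffP.
rewrite deriveE// diff_comp//= diff_pair//= -!deriveE//.
have -> : 'D_1 x t = dx by case: hx.
have -> : 'D_1 y t = dy by case: hy.
by rewrite derive_dir.
Qed.

End Plane.

(** * Integrals over intervals and over the disc *)

Section OneDimensionalIntegrals.
Context {R : realType}.
Notation leb := (@lebesgue_measure R).
Implicit Types (K F f : R -> R) (a b c : R).

Lemma itv_integrable K a b : continuous K ->
  leb.-integrable `[a, b] (EFin \o K).
Proof.
move=> cK; apply: continuous_compact_integrable; first exact: segment_compact.
exact: continuous_subspaceT.
Qed.

Lemma Rintegral_itv_cat K a b c : a <= b -> b <= c -> continuous K ->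
  \int[leb]_(x in `[a, c]) K x =
  \int[leb]_(x in `[a, b]) K x + \int[leb]_(x in `[b, c]) K x.
Proof.
move=> ab bc cK.
rewrite -(@Rintegral_itv_obnd_cbnd _ b); last first.
  apply: integrableS (itv_integrable b c cK) => //.
  by apply: subset_itvr; rewrite bnd_simp.
rewrite -(@Rintegral_itvB _ _ (BLeft a) (BRight c) b) ?bnd_simp//.
  by rewrite addrC subrK.
exact: itv_integrable.
Qed.

Lemma Rintegral_reflect K a b c : a <= b -> continuous K ->
  \int[leb]_(x in `[c - b, c - a]) K x = \int[leb]_(x in `[a, b]) K (c - x).
Proof.
move=> ab cK; rewrite /Rintegral; congr fine.
have dF (x : R) : is_derive x (1 : R) (fun y : R => c - y) (- 1).
  by apply: is_derive_eq; rewrite add0r mul1r.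
have F' : derive1 (fun y : R => c - y) = cst (- 1).
  by apply/funext => x; rewrite derive1E; exact: derive_val.
have cF : continuous (fun y : R => c - y).
  by move=> x; apply: cvgB; [exact: cvg_cst|exact: cvg_id].
rewrite (@integration_by_substitution_decreasing _ (fun y : R => c - y))//.
- apply: eq_integral => x _; rewrite F' /= /GRing.mul_fun/=.
  by rewrite /GRing.opp_fun /= opprK mulr1.
- by move=> x y _ _; rewrite ltrD2l ltrN2.
- by rewrite F' => x _; exact: cvg_cst.
- by rewrite F'; exact: is_cvg_cst.
- by rewrite F'; exact: is_cvg_cst.
- split=> [x _||].
  + by case: (dF x).
  + by apply: cvg_at_right_filter; exact: cF.
  + by apply: cvg_at_left_filter; exact: cF.
- exact: continuous_subspaceT.
Qed.

Lemma Rintegral_FTC F f a b : a < b -> continuous f ->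
  (forall x : R, is_derive x (1 : R) F (f x)) ->
  \int[leb]_(x in `[a, b]) f x = F b - F a.
Proof.
move=> ab cf dF.
have cF : continuous F.
  by move=> x; apply/differentiable_continuous/derivable1_diffP; case: (dF x).
rewrite /Rintegral (@continuous_FTC2 _ f F)//.
- exact: continuous_subspaceT.
- split=> [x _||].
  + by case: (dF x).
  + by apply: cvg_at_right_filter; exact: cF.
  + by apply: cvg_at_left_filter; exact: cF.
- by move=> x _; rewrite derive1E; exact: derive_val.
Qed.

End OneDimensionalIntegrals.

Section DiscIntegrals.
Context {R : realType}.
Notation leb := (@lebesgue_measure R).
Implicit Types (P Q : R * R -> R).

Definition square : set (R * R) := `[-1, 1] `*` `[-1, 1].

Lemma disc_square : @disc R `<=` square.
Proof.
have H (a b : R) : a ^+ 2 + b ^+ 2 < 1 -> -1 <= a <= 1.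
  move=> ab; rewrite -ler_norml -(@ler_pXn2r _ 2) ?nnegrE// expr1n real_normK ?num_real//.
  by have := sqr_ge0 b; lra.
move=> [x y]; rewrite /disc /square /= !in_itv/= => xy; split; first exact: H xy.
by apply: H; rewrite addrC; exact: xy.
Qed.

Lemma bounded_square P : continuous P ->
  exists2 M, 0 <= M & forall z, square z -> `|P z| <= M.
Proof.
move=> cP.
have cs : compact square by apply: compact_setX; exact: segment_compact.
have s0 : square !=set0.
  by exists (0, 0); split; rewrite /= in_itv/= lerN10 ler01.
have cn : {within square, continuous (fun z => `|P z|)}.
  by apply: continuous_subspaceT => z; apply: cvg_norm; exact: cP.
have [z zs zM] := compact_EVT_max s0 cs cn.
by exists `|P z| => // w ws; apply: zM; rewrite inE.
Qed.

Lemma measure_disc_lty : (leb2 (@disc R) < +oo)%E.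
Proof.
apply: (@le_lt_trans _ _ (leb2 square)).
  by apply: le_measure; rewrite ?inE;
    [exact: measurable_disc|exact: measurableX|exact: disc_square].
rewrite /leb2 [ltLHS]product_measure1E//= lebesgue_measure_itv/= lte_fin.
by case: ifPn => // _; rewrite ?mule0// -EFinD -EFinM ltry.
Qed.

Lemma disc_integrable P : continuous P -> leb2.-integrable disc (EFin \o P).
Proof.
move=> cP; apply: measurable_bounded_integrable.
- exact: measurable_disc.
- exact: measure_disc_lty.
- by apply: measurable_funTS; exact: continuous_measurable_plane.
- have [M M0 PM] := bounded_square cP.
  exists M; split; first exact: num_real.
  by move=> x Mx z /disc_square/PM /le_trans; apply; exact: ltW.
Qed.

(** The slice of the disc where one coordinate is x is the set of t with t ^+ 2 < r for
    r = 1 - x ^+ 2. For r <= 0 it is empty, and the right-hand side vanishes as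
    well since Num.sqrt r = 0: no case distinction on x is needed afterwards. *)
Lemma integral_slice (F f : R -> R) (r : R) : continuous f ->
  (forall y : R, is_derive y (1 : R) F (f y)) ->
  (\int[leb]_y ((EFin \o f) \_ [set t : R | (t ^+ 2 < r)%R]) y)%E =
  (F (Num.sqrt r) - F (- Num.sqrt r))%:E.
Proof.
move=> cf dF; rewrite -integral_mkcond.
have [r0|r0] := leP r 0.
  rewrite ler0_sqrtr// oppr0 subrr (_ : [set _ | _] = set0) ?integral_set0//.
  rewrite -subset0 => y /=; rewrite ltNge => /negP; apply.
  by rewrite (le_trans r0)// sqr_ge0.
have sr : 0 < Num.sqrt r by rewrite sqrtr_gt0.
have -> : [set y | y ^+ 2 < r] = `]- Num.sqrt r, Num.sqrt r[%classic.
  apply/seteqP; split=> y /=; rewrite in_itv/= -ltr_norml.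
    by move=> yr; rewrite -sqrtr_sqr ltr_sqrt.
  by rewrite -sqrtr_sqr ltr_sqrt.
rewrite -(@integral_itv_bndoo _ _ _ _ true false); last first.
  apply/measurable_EFinP; apply: measurable_funTS.
  exact: continuous_measurable_fun.
have ab : - Num.sqrt r < Num.sqrt r by lra.
rewrite -(Rintegral_FTC ab cf dF) fineK//.
exact: integrable_fin_num (itv_integrable _ _ cf).
Qed.

Lemma continuous_slicey P (x : R) : continuous P -> continuous (fun y => P (x, y)).
Proof.
move=> cP y; apply: (@continuous_comp _ _ _ (fun y => (x, y)) P); last exact: cP.
exact: (cvg_pair (cvg_cst x) cvg_id).
Qed.

Lemma continuous_slicex P (y : R) : continuous P -> continuous (fun x => P (x, y)).
Proof.
move=> cP x; apply: (@continuous_comp _ _ _ (fun x => (x, y)) P); last exact: cP.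
exact: (cvg_pair cvg_id (cvg_cst y)).
Qed.

Lemma is_derive_slicey Q (x y : R) : C1 Q ->
  is_derive y (1 : R) (fun y => Q (x, y)) ('D_ey Q (x, y)).
Proof.
move=> hQ; have := is_derive_curve hQ (is_derive_cst x y 1) (is_derive_id y 1).
by rewrite mul0r add0r mul1r.
Qed.

Lemma is_derive_slicex Q (x y : R) : C1 Q ->
  is_derive x (1 : R) (fun x => Q (x, y)) ('D_ex Q (x, y)).
Proof.
move=> hQ; have := is_derive_curve hQ (is_derive_id x 1) (is_derive_cst y x 1).
by rewrite mul0r addr0 mul1r.
Qed.

Lemma disc_integrableT P : continuous P ->
  (leb \x leb)%E.-integrable setT ((EFin \o P) \_ disc).
Proof.
move=> cP.
exact: (proj1 (@integrable_mkcond _ (@plane R) R leb2 _ (EFin \o P) measurable_disc) (disc_integrable cP)).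
Qed.

Lemma integral_restrict_11 (K : R -> R) : (forall x, 1 <= x ^+ 2 -> K x = 0) ->
  (\int[leb]_x (K x)%:E = \int[leb]_(x in `[(-1)%R, 1%R]) (K x)%:E)%E.
Proof.
move=> K0; rewrite [RHS]integral_mkcond; apply: eq_integral => x _.
rewrite patchE; case: ifPn => //; rewrite notin_setE/= in_itv/= => x1.
rewrite K0// leNgt; apply/negP => x2; apply: x1.
by rewrite -ler_norml -(@ler_pXn2r _ 2) ?nnegrE// expr1n real_normK ?num_real// ltW.
Qed.

Lemma integral_disc_y Q : C1 Q ->
  \int[leb2]_(z in disc) 'D_ey Q z =
  \int[leb]_(x in `[-1, 1])
    (Q (x, Num.sqrt (1 - x ^+ 2)) - Q (x, - Num.sqrt (1 - x ^+ 2))).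
Proof.
move=> hQ; have cq : continuous (fun z => 'D_ey Q z) by case: hQ => _; exact.
rewrite /Rintegral; congr fine.
rewrite integral_mkcond -(integral12_prod_meas1 (disc_integrableT cq)).
rewrite -(@integral_restrict_11 (fun x => Q (x, Num.sqrt (1 - x ^+ 2)) -
  Q (x, - Num.sqrt (1 - x ^+ 2)))); last first.
  by move=> x x1; rewrite ler0_sqrtr ?subr_le0// oppr0 subrr.
apply: eq_integral => x _; rewrite /fubini_F.
rewrite -(integral_slice (1 - x ^+ 2) (continuous_slicey (x := x) cq)
  (fun y => is_derive_slicey x y hQ)).
apply: eq_integral => y _; rewrite !patchE; congr (if _ then _ else _).
by apply/idP/idP; rewrite !inE /disc/= ltrBrDl.
Qed.

Lemma integral_disc_x P : C1 P ->
  \int[leb2]_(z in disc) 'D_ex P z =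
  \int[leb]_(y in `[-1, 1])
    (P (Num.sqrt (1 - y ^+ 2), y) - P (- Num.sqrt (1 - y ^+ 2), y)).
Proof.
move=> hP; have cp : continuous (fun z => 'D_ex P z) by case: hP => _; exact.
rewrite /Rintegral; congr fine.
rewrite integral_mkcond -(integral21_prod_meas1 (disc_integrableT cp)).
rewrite -(@integral_restrict_11 (fun y => P (Num.sqrt (1 - y ^+ 2), y) -
  P (- Num.sqrt (1 - y ^+ 2), y))); last first.
  by move=> x x1; rewrite ler0_sqrtr ?subr_le0// oppr0 subrr.
apply: eq_integral => y _; rewrite /fubini_G.
rewrite -(integral_slice (1 - y ^+ 2) (continuous_slicex (y := y) cp)
  (fun x => is_derive_slicex x y hP)).
apply: eq_integral => x _; rewrite !patchE; congr (if _ then _ else _).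
by apply/idP/idP; rewrite !inE /disc/= ltrBrDr.
Qed.

End DiscIntegrals.

(** * Green's formula on the disc *)

Section GreenFormula.
Context {R : realType}.
Notation leb := (@lebesgue_measure R).
Implicit Types (P Q : R * R -> R) (K : R -> R).

Lemma Rintegral_shift K a b c : a <= b -> continuous K ->
  \int[leb]_(x in `[a + c, b + c]) K x = \int[leb]_(x in `[a, b]) K (x + c).
Proof.
move=> ab cK; have abN : - b <= - a by rewrite lerN2.
have -> : a + c = c - - a by lra.
have -> : b + c = c - - b by lra.
rewrite Rintegral_reflect//.
have -> : `[- b, - a]%classic = `[0 - b, 0 - a]%classic :> set R by rewrite !sub0r.
rewrite Rintegral_reflect//; last first.
  move=> x; apply: (@continuous_comp _ _ _ (fun x => c - x) K); last exact: cK.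
  by apply: cvgB; [exact: cvg_cst|exact: cvg_id].
by apply: eq_Rintegral => x _; congr K; lra.
Qed.

Lemma continuous_circ P : continuous P -> continuous (P \o circ).
Proof.
move=> cP x.
apply: (@continuous_comp _ _ _ (fun x => (cos x, sin x)) P); last exact: cP.
exact: (cvg_pair (@continuous_cos R x) (@continuous_sin R x)).
Qed.

Lemma continuous_sqrt1B : continuous (fun x : R => Num.sqrt (1 - x ^+ 2)).
Proof.
move=> x; apply: (@continuous_comp R R R (fun x : R => 1 - x ^+ 2) Num.sqrt).
  by apply: cvgB; [exact: cvg_cst|exact: exprn_continuous].
exact: sqrt_continuous.
Qed.

Lemma derive1_cos : derive1 (@cos R) = fun x => - sin x.
Proof. by apply/funext => x; rewrite derive1E; exact: derive_val. Qed.

Lemma derive1_sin : derive1 (@sin R) = cos.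
Proof. by apply/funext => x; rewrite derive1E; exact: derive_val. Qed.

Lemma Rintegral_subst_cos K : continuous K ->
  \int[leb]_(x in `[-1, 1]) K x = \int[leb]_(t in `[0, pi]) (K (cos t) * sin t).
Proof.
move=> cK; rewrite /Rintegral; congr fine.
have := @integration_by_substitution_decreasing R cos K 0 pi.
rewrite cospi cos0 derive1_cos => ->.
- by apply: eq_integral => x _; rewrite /= /GRing.mul_fun/= /GRing.opp_fun/= opprK.
- exact: pi_ge0.
- by move=> x y xI yI xy; rewrite ltr_cos.
- by move=> x _; apply: cvgN; exact: continuous_sin.
- by apply: is_cvgN; apply/cvg_ex; eexists; apply: cvg_at_right_filter; exact: continuous_sin.
- by apply: is_cvgN; apply/cvg_ex; eexists; apply: cvg_at_left_filter; exact: continuous_sin.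
- split=> [x _||]; first exact: derivable_cos.
  + by apply: cvg_at_right_filter; exact: continuous_cos.
  + by apply: cvg_at_left_filter; exact: continuous_cos.
- exact: continuous_subspaceT.
Qed.

Lemma Rintegral_subst_sin K : continuous K ->
  \int[leb]_(x in `[-1, 1]) K x =
  \int[leb]_(t in `[- (pi / 2), pi / 2]) (K (sin t) * cos t).
Proof.
move=> cK; rewrite /Rintegral; congr fine.
have := @integration_by_substitution_increasing R sin K (- (pi / 2)) (pi / 2).
have p0 : 0 <= pi / 2 :> R by rewrite divr_ge0// pi_ge0.
rewrite sinN sin_pihalf derive1_sin => ->.
- by apply: eq_integral.
- lra.
- by move=> x y xI yI xy; rewrite ltr_sin.
- by move=> x _; exact: continuous_cos.
- by apply/cvg_ex; eexists; apply: cvg_at_right_filter; exact: continuous_cos.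
- by apply/cvg_ex; eexists; apply: cvg_at_left_filter; exact: continuous_cos.
- split=> [x _||]; first exact: derivable_sin.
  + by apply: cvg_at_right_filter; exact: continuous_sin.
  + by apply: cvg_at_left_filter; exact: continuous_sin.
- exact: continuous_subspaceT.
Qed.

(** Integrating along vertical slices leaves the difference of Q on the upper and
    the lower half circle. The substitution x = cos t turns the first term into
    an integral over [0, pi], and the reflection t |-> 2 pi - t turns the second
    one into an integral over [pi, 2 pi]. *)
Lemma green_y Q : C1 Q ->
  \int[leb2]_(z in disc) 'D_ey Q z =
  \int[leb]_(t in angles) (Q (circ t) * sin t).
Proof.
move=> hQ; have cQ := C1_continuous hQ.
have cK : continuous (fun t => Q (circ t) * sin t).
  by move=> t; apply: cvgM; [exact: continuous_circ|exact: continuous_sin].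
have c1 : continuous (fun x : R => Q (x, Num.sqrt (1 - x ^+ 2))).
  move=> x; apply: (@continuous_comp R (R * R)%type R
    (fun x => (x, Num.sqrt (1 - x ^+ 2))) Q); last exact: cQ.
  exact: (cvg_pair cvg_id (@continuous_sqrt1B x)).
have c2 : continuous (fun x : R => Q (x, - Num.sqrt (1 - x ^+ 2))).
  move=> x; apply: (@continuous_comp R (R * R)%type R
    (fun x => (x, - Num.sqrt (1 - x ^+ 2))) Q); last exact: cQ.
  exact: (cvg_pair cvg_id (cvgN (@continuous_sqrt1B x))).
rewrite integral_disc_y// Rintegral_subst_cos; last first.
  by move=> x; apply: cvgB; [exact: c1|exact: c2].
have pi0 := pi_ge0 R.
rewrite /angles (@Rintegral_itv_cat _ _ 0 pi (2 * pi))//; last lra.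
have -> : `[pi, 2 * pi]%classic = `[2 * pi - pi, 2 * pi - 0]%classic :> set R.
  by rewrite subr0 (_ : 2 * pi - pi = pi)//; lra.
rewrite Rintegral_reflect// -RintegralD//.
- apply: eq_Rintegral => t; rewrite inE/= in_itv/= => /andP[t0 tpi].
  have st : 0 <= sin t by apply: sin_ge0_pi; rewrite t0.
  rewrite -sin2cos2 sqrtr_sqr ger0_norm// /circ.
  have -> : 2 * pi - t = - t + pi *+ 2 :> R by rewrite mulr2n; lra.
  by rewrite cosD2pi sinD2pi cosN sinN; ring.
- exact: itv_integrable.
- apply: (@itv_integrable _ (fun x => Q (circ (2 * pi - x)) * sin (2 * pi - x))).
  move=> x; apply: (@continuous_comp _ _ _ (fun x => 2 * pi - x)
    (fun t => Q (circ t) * sin t)); last exact: cK.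
  by apply: cvgB; [exact: cvg_cst|exact: cvg_id].
Qed.

(** As for the other direction, with y = sin t on [- pi / 2, pi / 2]; here the
    two half circles make up [- pi / 2, 3 pi / 2], which is brought back to
    [0, 2 pi] by periodicity. *)
Lemma green_x P : C1 P ->
  \int[leb2]_(z in disc) 'D_ex P z =
  \int[leb]_(t in angles) (P (circ t) * cos t).
Proof.
move=> hP; have cP := C1_continuous hP.
set K := fun t => P (circ t) * cos t.
have cK : continuous K.
  by move=> t; apply: cvgM; [exact: continuous_circ|exact: continuous_cos].
have c1 : continuous (fun x : R => P (Num.sqrt (1 - x ^+ 2), x)).
  move=> x; apply: (@continuous_comp R (R * R)%type R
    (fun x => (Num.sqrt (1 - x ^+ 2), x)) P); last exact: cP.
  exact: (cvg_pair (@continuous_sqrt1B x) cvg_id).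
have c2 : continuous (fun x : R => P (- Num.sqrt (1 - x ^+ 2), x)).
  move=> x; apply: (@continuous_comp R (R * R)%type R
    (fun x => (- Num.sqrt (1 - x ^+ 2), x)) P); last exact: cP.
  exact: (cvg_pair (cvgN (@continuous_sqrt1B x)) cvg_id).
rewrite integral_disc_x// Rintegral_subst_sin; last first.
  by move=> x; apply: cvgB; [exact: c1|exact: c2].
have pi0 := pi_ge0 R.
transitivity (\int[leb]_(t in `[- (pi / 2), pi / 2]) K t +
              \int[leb]_(t in `[pi / 2, pi + pi / 2]) K t).
  have -> : `[pi / 2, pi + pi / 2]%classic =
      `[pi - pi / 2, pi - - (pi / 2)]%classic :> set R.
    by rewrite opprK (_ : pi - pi / 2 = pi / 2)//; lra.
  rewrite Rintegral_reflect//; last lra.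
  rewrite -RintegralD//.
  - apply: eq_Rintegral => t; rewrite inE/= in_itv/= => /andP[t0 tpi].
    have st : 0 <= cos t by apply: cos_ge0_pihalf; rewrite t0.
    rewrite -cos2sin2 sqrtr_sqr ger0_norm// /K /circ.
    rewrite [pi - t]addrC cosDpi sinDpi cosN sinN opprK; ring.
  - exact: itv_integrable.
  - apply: (@itv_integrable _ (fun x => K (pi - x))).
    move=> x; apply: (@continuous_comp _ _ _ (fun x => pi - x) K); last exact: cK.
    by apply: cvgB; [exact: cvg_cst|exact: cvg_id].
rewrite /angles (@Rintegral_itv_cat _ _ 0 (pi / 2) (2 * pi))//; [|lra|lra].
rewrite (@Rintegral_itv_cat _ _ (pi / 2) (pi + pi / 2) (2 * pi))//; [|lra|lra].
rewrite (@Rintegral_itv_cat _ _ (- (pi / 2)) 0 (pi / 2))//; [|lra|lra].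
have -> : `[pi + pi / 2, 2 * pi]%classic =
    `[- (pi / 2) + 2 * pi, 0 + 2 * pi]%classic :> set R.
  by rewrite add0r (_ : - (pi / 2) + 2 * pi = pi + pi / 2)//; lra.
rewrite (Rintegral_shift _ _ cK); last lra.
have -> : \int[leb]_(x in `[- (pi / 2), 0]) K (x + 2 * pi) =
          \int[leb]_(x in `[- (pi / 2), 0]) K x.
  apply: eq_Rintegral => t _; rewrite /K /circ.
  by rewrite (_ : 2 * pi = pi *+ 2) ?mulr_natl// cosD2pi sinD2pi.
lra.
Qed.

End GreenFormula.

(** * Wirtinger derivatives *)

Section ComplexDerivatives.
Context {R : realType}.
Implicit Types (P Q : R * R -> R) (w u : R * R -> R[i]) (z e : R * R).

Lemma derivePD P Q z e : C1 P -> C1 Q ->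
  'D_e (fun z => P z + Q z) z = 'D_e P z + 'D_e Q z.
Proof. by move=> hP hQ; rewrite deriveD//; exact: C1_derivable. Qed.

Lemma C1N P : C1 P -> C1 (fun z => - P z).
Proof.
move=> hP; have := C1M (C1_cst (- 1)) hP.
by under eq_fun do rewrite mulN1r.
Qed.

Lemma derivePN P z e : C1 P -> 'D_e (fun z => - P z) z = - 'D_e P z.
Proof. by move=> hP; rewrite deriveN//; exact: C1_derivable. Qed.

Definition cC1 w :=
  C1 (fun z => complex.Re (w z)) /\ C1 (fun z => complex.Im (w z)).

Lemma csmooth_cC1 w : csmooth w -> cC1 w.
Proof. by move=> [? ?]; split; exact: smooth_C1. Qed.

Lemma cC1M w u : cC1 w -> cC1 u -> cC1 (fun z => w z * u z).
Proof.
move=> [w1 w2] [u1 u2]; split.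
- by under eq_fun do rewrite cReM; apply: C1D; [|apply: C1N]; exact: C1M.
- by under eq_fun do rewrite cImM; apply: C1D; exact: C1M.
Qed.

Lemma cC1J w : cC1 w -> cC1 (fun z => conjc (w z)).
Proof.
move=> [w1 w2]; split; first by under eq_fun do rewrite cReJ.
by under eq_fun do rewrite cImJ; exact: C1N.
Qed.

Lemma cC1_cst (c : R[i]) : cC1 (fun=> c).
Proof. by split; exact: C1_cst. Qed.

Lemma Re_cderive e w z :
  complex.Re (cderive e w z) = 'D_e (fun z => complex.Re (w z)) z.
Proof. by []. Qed.
Lemma Im_cderive e w z :
  complex.Im (cderive e w z) = 'D_e (fun z => complex.Im (w z)) z.
Proof. by []. Qed.

Lemma cderiveM e w u z : cC1 w -> cC1 u ->
  cderive e (fun z => w z * u z) z =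
  w z * cderive e u z + cderive e w z * u z.
Proof.
move=> [w1 w2] [u1 u2]; apply: complex_ext.
- rewrite cReD !cReM !Re_cderive !Im_cderive.
  under [in LHS]eq_fun do rewrite cReM.
  rewrite derivePD ?derivePN ?derivePM//; do ?[exact: C1M|apply: C1N].
  ring.
- rewrite cImD !cImM !Re_cderive !Im_cderive.
  under [in LHS]eq_fun do rewrite cImM.
  rewrite derivePD ?derivePM//; do ?[exact: C1M].
  ring.
Qed.

Lemma cderiveJ e w z : cC1 w ->
  cderive e (fun z => conjc (w z)) z = conjc (cderive e w z).
Proof.
move=> [w1 w2]; apply: complex_ext.
- rewrite cReJ !Re_cderive; congr ('D_e _ z).
  by apply/funext => x; rewrite cReJ.
- rewrite cImJ !Im_cderive; under eq_fun do rewrite cImJ.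
  by rewrite derivePN.
Qed.

Lemma cderive_cst e (c : R[i]) z : cderive e (fun=> c) z = 0.
Proof. by apply: complex_ext; rewrite ?Re_cderive ?Im_cderive derive_cst. Qed.

(** The counterparts of del and delbar in which the directional derivative
    replaces the chosen weak one. *)
Definition cdel w z : R[i] := (cderive ex w z - 'i%C * cderive ey w z) / 2.
Definition cdelbar w z : R[i] := (cderive ex w z + 'i%C * cderive ey w z) / 2.

Lemma cdelM w u z : cC1 w -> cC1 u ->
  cdel (fun z => w z * u z) z = w z * cdel u z + cdel w z * u z.
Proof. by move=> hw hu; rewrite /cdel !cderiveM//; ring. Qed.

Lemma cdelbarM w u z : cC1 w -> cC1 u ->
  cdelbar (fun z => w z * u z) z = w z * cdelbar u z + cdelbar w z * u z.
Proof. by move=> hw hu; rewrite /cdelbar !cderiveM//; ring. Qed.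

Lemma Re_half (x : R[i]) : complex.Re (x / 2) = complex.Re x / 2.
Proof. by rewrite complex_half cReM mulr0 subr0. Qed.
Lemma Im_half (x : R[i]) : complex.Im (x / 2) = complex.Im x / 2.
Proof. by rewrite complex_half cImM mulr0 add0r. Qed.
Lemma Re_iM (x : R[i]) : complex.Re ('i%C * x) = - complex.Im x.
Proof. by rewrite cReM /= mul0r mul1r sub0r. Qed.
Lemma Im_iM (x : R[i]) : complex.Im ('i%C * x) = complex.Re x.
Proof. by rewrite cImM /= mul0r mul1r add0r. Qed.

Lemma Re_cdel w z :
  complex.Re (cdel w z) =
  ('D_ex (fun z => complex.Re (w z)) z + 'D_ey (fun z => complex.Im (w z)) z) / 2.
Proof. by rewrite Re_half cReD cReN Re_iM opprK. Qed.
Lemma Im_cdel w z :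
  complex.Im (cdel w z) =
  ('D_ex (fun z => complex.Im (w z)) z - 'D_ey (fun z => complex.Re (w z)) z) / 2.
Proof. by rewrite Im_half cImD cImN Im_iM. Qed.
Lemma Re_cdelbar w z :
  complex.Re (cdelbar w z) =
  ('D_ex (fun z => complex.Re (w z)) z - 'D_ey (fun z => complex.Im (w z)) z) / 2.
Proof. by rewrite Re_half cReD Re_iM. Qed.
Lemma Im_cdelbar w z :
  complex.Im (cdelbar w z) =
  ('D_ex (fun z => complex.Im (w z)) z + 'D_ey (fun z => complex.Re (w z)) z) / 2.
Proof. by rewrite Im_half cImD Im_iM. Qed.

Lemma cdelJ w z : cC1 w ->
  cdel (fun z => conjc (w z)) z = conjc (cdelbar w z).
Proof.
move=> hw; apply: complex_ext.
- by rewrite cReJ Re_cdel Re_cdelbar -!Re_cderive -!Im_cderive !cderiveJ.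
- rewrite cImJ Im_cdel Im_cdelbar -!Re_cderive -!Im_cderive !cderiveJ//.
  by rewrite /= mulrBl mulrDl; lra.
Qed.

Definition zc z : R[i] := z.1 +i* z.2.

Lemma cC1_zc : cC1 zc.
Proof. by split; [exact: C1_fst|exact: C1_snd]. Qed.

Lemma cC1_zcX k : cC1 (fun z => zc z ^+ k).
Proof.
elim: k => [|k ih]; first exact: cC1_cst.
by under eq_fun do rewrite exprS; apply: cC1M => //; exact: cC1_zc.
Qed.

Lemma cdel_zc z : cdel zc z = 1.
Proof.
by apply: complex_ext;
  rewrite ?Re_cdel ?Im_cdel /= ?derive_fst ?derive_snd /=; lra.
Qed.

Lemma cdelbar_zc z : cdelbar zc z = 0.
Proof.
by apply: complex_ext;
  rewrite ?Re_cdelbar ?Im_cdelbar /= ?derive_fst ?derive_snd /=; lra.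
Qed.

Lemma cdel_zcX k z : cdel (fun z => zc z ^+ k.+1) z = k.+1%:R * zc z ^+ k.
Proof.
elim: k => [|k ih].
  by under eq_fun do rewrite expr1; rewrite cdel_zc expr0 mulr1.
under eq_fun do rewrite exprS.
rewrite cdelM; [|exact: cC1_zc|exact: cC1_zcX].
by rewrite ih cdel_zc -[in RHS](addn1 k.+1) natrD exprS; ring.
Qed.

Lemma cdelbar_zcX k z : cdelbar (fun z => zc z ^+ k) z = 0.
Proof.
elim: k => [|k ih].
  by rewrite /cdelbar !cderive_cst mulr0 addr0 mul0r.
under eq_fun do rewrite exprS.
rewrite cdelbarM; [|exact: cC1_zc|exact: cC1_zcX].
by rewrite ih cdelbar_zc mulr0 mul0r addr0.
Qed.

End ComplexDerivatives.

(** * Exponentials on the circle *)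

Section Exponentials.
Context {R : realType}.
Implicit Types (k l : int) (t : R).

Definition cexp k t : R[i] := cos (k%:~R * t) +i* sin (k%:~R * t).

Lemma cexpD k l t : cexp (k + l) t = cexp k t * cexp l t.
Proof.
apply: complex_ext; rewrite ?cReM ?cImM /= intrD mulrDl ?cosD ?sinD//.
by rewrite addrC.
Qed.

Lemma cexpN k t : cexp (- k) t = conjc (cexp k t).
Proof.
by apply: complex_ext; rewrite ?cReJ ?cImJ /= mulrNz mulNr ?cosN ?sinN.
Qed.

Lemma cexp0 t : cexp 0 t = 1.
Proof. by apply: complex_ext; rewrite /= mul0r ?cos0 ?sin0. Qed.

Lemma sqmod_cexp k t : sqmod (cexp k t) = 1.
Proof. exact: cos2Dsin2. Qed.

Lemma zc_circ t : zc (circ t) = cexp 1 t.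
Proof. by apply: complex_ext; rewrite /= mul1r. Qed.

Lemma zcX_circ n t : zc (circ t) ^+ n = cexp n%:Z t.
Proof.
elim: n => [|n ih]; first by rewrite expr0 cexp0.
by rewrite exprS ih zc_circ -cexpD.
Qed.

Lemma continuous_cos_scale k : continuous (fun t : R => cos (k%:~R * t)).
Proof.
move=> t; apply: (@continuous_comp R R R (fun t => k%:~R * t) cos).
  by apply: cvgMr; exact: cvg_id.
exact: continuous_cos.
Qed.

Lemma continuous_sin_scale k : continuous (fun t : R => sin (k%:~R * t)).
Proof.
move=> t; apply: (@continuous_comp R R R (fun t => k%:~R * t) sin).
  by apply: cvgMr; exact: cvg_id.
exact: continuous_sin.
Qed.

End Exponentials.

(** * Green's formula in complex form *)

Section ComplexGreen.
Context {R : realType}.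
Notation leb := (@lebesgue_measure R).
Implicit Types (w u : R * R -> R[i]).

Definition ccontinuous (T : topologicalType) (u : T -> R[i]) :=
  continuous (fun z => complex.Re (u z)) /\ continuous (fun z => complex.Im (u z)).

Lemma ccontinuousM (T : topologicalType) (u w : T -> R[i]) :
  ccontinuous u -> ccontinuous w -> ccontinuous (fun z => u z * w z).
Proof.
move=> [u1 u2] [w1 w2]; split=> z.
- under eq_fun do rewrite cReM.
  by apply: cvgB; apply: cvgM; [exact: u1|exact: w1|exact: u2|exact: w2].
- under eq_fun do rewrite cImM.
  by apply: cvgD; apply: cvgM; [exact: u1|exact: w2|exact: u2|exact: w1].
Qed.

Lemma ccontinuousD (T : topologicalType) (u w : T -> R[i]) :
  ccontinuous u -> ccontinuous w -> ccontinuous (fun z => u z + w z).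
Proof.
move=> [u1 u2] [w1 w2]; split=> z.
- under eq_fun do rewrite cReD.
  by apply: cvgD; [exact: u1|exact: w1].
- under eq_fun do rewrite cImD.
  by apply: cvgD; [exact: u2|exact: w2].
Qed.

Lemma ccontinuousJ (T : topologicalType) (u : T -> R[i]) :
  ccontinuous u -> ccontinuous (fun z => conjc (u z)).
Proof.
move=> [u1 u2]; split=> z; first by under eq_fun do rewrite cReJ; exact: u1.
by under eq_fun do rewrite cImJ; apply: cvgN; exact: u2.
Qed.

Lemma ccontinuous_cst (T : topologicalType) (c : R[i]) :
  ccontinuous (fun _ : T => c).
Proof. by split=> z; exact: cvg_cst. Qed.

Lemma ccontinuous_cexp k : ccontinuous (@cexp R k).
Proof. by split; [exact: continuous_cos_scale|exact: continuous_sin_scale]. Qed.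

Lemma cC1_ccontinuous w : cC1 w -> ccontinuous w.
Proof. by move=> [? ?]; split; exact: C1_continuous. Qed.

Lemma ccontinuous_cderive e w : cC1 w -> ccontinuous (cderive e w).
Proof. by move=> [[? w1] [? w2]]; split=> z; [exact: w1|exact: w2]. Qed.

Lemma ccontinuous_cdel w : cC1 w -> ccontinuous (cdel w).
Proof.
move=> hw; apply: ccontinuousM; last exact: ccontinuous_cst.
apply: ccontinuousD; first exact: ccontinuous_cderive.
have -> : (fun z => - ('i%C * cderive ey w z)) =
    fun z => (- 'i%C) * cderive ey w z.
  by apply/funext => z; rewrite mulNr.
apply: ccontinuousM; first exact: ccontinuous_cst.
exact: ccontinuous_cderive.
Qed.

Lemma ccontinuous_cdelbar w : cC1 w -> ccontinuous (cdelbar w).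
Proof.
move=> hw; apply: ccontinuousM; last exact: ccontinuous_cst.
apply: ccontinuousD; first exact: ccontinuous_cderive.
apply: ccontinuousM; first exact: ccontinuous_cst.
exact: ccontinuous_cderive.
Qed.

Lemma ccontinuous_circ w : ccontinuous w -> ccontinuous (w \o circ).
Proof.
move=> [w1 w2]; split.
- exact: (continuous_circ w1).
- exact: (continuous_circ w2).
Qed.

Lemma measurable_angles : measurable (angles : set (measurableTypeR R)).
Proof. exact: measurable_itv. Qed.

Lemma disc_cintegrable w : ccontinuous w -> cintegrable leb2 disc w.
Proof. by move=> [w1 w2]; split; exact: disc_integrable. Qed.

Lemma angles_cintegrable (u : R -> R[i]) : ccontinuous u ->
  cintegrable leb angles u.
Proof. by move=> [u1 u2]; split; exact: itv_integrable. Qed.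

Lemma continuous_sqmod (T : topologicalType) (u : T -> R[i]) :
  ccontinuous u -> continuous (fun z => sqmod (u z)).
Proof.
move=> [u1 u2] z; rewrite /sqmod; under eq_fun do rewrite !expr2.
by apply: cvgD; apply: cvgM; [exact: u1|exact: u1|exact: u2|exact: u2].
Qed.

Lemma disc_inL2 w : ccontinuous w -> inL2 leb2 disc w.
Proof.
move=> cw; have [w1 w2] := cw; split.
  by split; apply: measurable_funTS; exact: continuous_measurable_plane.
apply: integrable_lty; first exact: measurable_disc.
exact: (disc_integrable (continuous_sqmod cw)).
Qed.

Lemma angles_inL2 (u : R -> R[i]) : ccontinuous u -> inL2 leb angles u.
Proof.
move=> cw; have [w1 w2] := cw; split.
  by split; apply: measurable_funTS; exact: continuous_measurable_fun.
apply: integrable_lty; first exact: measurable_angles.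
exact: (itv_integrable _ _ (continuous_sqmod cw)).
Qed.

(** The real and the imaginary part of the Wirtinger derivative are divergences,
    and exp (- i t) = cos t - i sin t collects the two components of the normal. *)
Lemma cgreen w : cC1 w ->
  cintegral leb2 disc (cdel w) =
  cintegral leb angles (fun t => w (circ t) * conjc (cexp 1 t)) / 2.
Proof.
move=> hw; have [w1 w2] := hw.
have [d1 d2] : cintegrable leb2 disc (cdel w).
  exact/disc_cintegrable/ccontinuous_cdel.
have ca := ccontinuous_circ (cC1_ccontinuous hw).
have ic (c : R -> R) (P : R * R -> R) : continuous c -> continuous P ->
    leb.-integrable angles (EFin \o (fun t => P (circ t) * c t)).
  move=> cc cP; apply: itv_integrable => t.
  by apply: cvgM; [exact: continuous_circ|exact: cc].
have id (P : R * R -> R) e : C1 P ->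
    leb2.-integrable disc (EFin \o (fun z => 'D_e P z)).
  by move=> [_ hP]; apply: disc_integrable; exact: hP.
have cos_c := @continuous_cos R.
have sin_c := @continuous_sin R.
have c1 := C1_continuous w1.
have c2 := C1_continuous w2.
apply: complex_ext.
- rewrite Re_half !Re_cintegral.
  transitivity (\int[leb2]_(z in disc) ('D_ex (fun z => complex.Re (w z)) z +
      'D_ey (fun z => complex.Im (w z)) z) * 2^-1).
    rewrite -RintegralZr//; [|exact: measurable_disc|].
      by apply: eq_Rintegral => z _; rewrite Re_cdel.
    exact: (integrableD measurable_disc (id _ ex w1) (id _ ey w2)).
  congr (_ / 2); rewrite RintegralD//; [|exact: measurable_disc|exact: id|exact: id].
  rewrite green_x// green_y// -RintegralD//; [|exact: measurable_angles|exact: (ic _ _ cos_c c1)|exact: (ic _ _ sin_c c2)].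
  apply: eq_Rintegral => t _; rewrite cReM cReJ cImJ /= mul1r; ring.
- rewrite Im_half !Im_cintegral.
  transitivity (\int[leb2]_(z in disc) ('D_ex (fun z => complex.Im (w z)) z -
      'D_ey (fun z => complex.Re (w z)) z) * 2^-1).
    rewrite -RintegralZr//; [|exact: measurable_disc|].
      by apply: eq_Rintegral => z _; rewrite Im_cdel.
    exact: (integrableB measurable_disc (id _ ex w2) (id _ ey w1)).
  congr (_ / 2); rewrite RintegralB//; [|exact: measurable_disc|exact: id|exact: id].
  rewrite green_x// green_y// -RintegralB//; [|exact: measurable_angles|exact: (ic _ _ cos_c c2)|exact: (ic _ _ sin_c c1)].
  apply: eq_Rintegral => t _; rewrite cImM cReJ cImJ /= mul1r; ring.
Qed.

Lemma cgreenbar w : cC1 w ->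
  cintegral leb2 disc (cdelbar w) =
  cintegral leb angles (fun t => w (circ t) * cexp 1 t) / 2.
Proof.
move=> hw; have := cgreen (cC1J hw).
under eq_cintegral do rewrite cdelJ//.
rewrite cintegralJ; [|exact: measurable_disc|]; last first.
  exact/disc_cintegrable/ccontinuous_cdelbar.
move/(congr1 (@conjc _)); rewrite cjK => ->.
rewrite cjM complex_half cjR; congr (_ * _).
rewrite -cintegralJ; [|exact: measurable_angles|].
  by apply: eq_cintegral => t _; rewrite cjM !cjK.
apply: angles_cintegrable; apply: ccontinuousM.
  exact/ccontinuousJ/ccontinuous_circ/cC1_ccontinuous.
exact/ccontinuousJ/ccontinuous_cexp.
Qed.

End ComplexGreen.

(** * Fourier coefficients and monomials *)

Section CircleFourier.
Context {R : realType}.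
Notation leb := (@lebesgue_measure R).
Implicit Types (k l : int) (t : R) (u : R -> R[i]).

Definition is_cderive1 t u (du : R[i]) :=
  is_derive t (1 : R) (fun t => complex.Re (u t)) (complex.Re du) /\
  is_derive t (1 : R) (fun t => complex.Im (u t)) (complex.Im du).

Lemma cintegral_FTC u du : ccontinuous du ->
  (forall t, is_cderive1 t u (du t)) ->
  cintegral leb angles du = u (2 * pi) - u 0.
Proof.
move=> [c1 c2] hu; have pi2 : 0 < 2 * pi :> R by rewrite mulr_gt0// pi_gt0.
apply: complex_ext; rewrite ?Re_cintegral ?Im_cintegral ?cReD ?cImD ?cReN ?cImN.
- by apply: (@Rintegral_FTC _ (fun t => complex.Re (u t)) _ _ _ pi2 c1) => t; case: (hu t).
- by apply: (@Rintegral_FTC _ (fun t => complex.Im (u t)) _ _ _ pi2 c2) => t; case: (hu t).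
Qed.

Lemma is_cderive1M t (u w : R -> R[i]) du dw :
  is_cderive1 t u du -> is_cderive1 t w dw ->
  is_cderive1 t (fun t => u t * w t) (u t * dw + du * w t).
Proof.
move=> [u1 u2] [w1 w2]; split.
- under eq_fun do rewrite cReM.
  apply: is_derive_eq.
  rewrite cReD !cReM /GRing.scale/=; ring.
- under eq_fun do rewrite cImM.
  apply: is_derive_eq.
  rewrite cImD !cImM /GRing.scale/=; ring.
Qed.

Lemma is_cderive1_cexp k t : is_cderive1 t (cexp k) ('i%C * k%:~R%:C * cexp k t).
Proof.
have dk : is_derive t (1 : R) (fun t => k%:~R * t) k%:~R.
  by apply: is_derive_eq; rewrite /GRing.scale/= mulr1.
split; rewrite /cexp /=.
- by apply: (@is_derive_eq _ _ _ (fun t => cos (k%:~R * t))); ring.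
- by apply: (@is_derive_eq _ _ _ (fun t => sin (k%:~R * t))); ring.
Qed.

Lemma cexp_2pi k : cexp k (2 * pi) = 1 :> R[i].
Proof.
have H n : cexp n%:Z (2 * pi) = 1 :> R[i].
  rewrite -zcX_circ (_ : zc _ = 1) ?expr1n//.
  by apply: complex_ext; rewrite /= mulr_natl ?cos2pi ?sin2pi.
case: k => n; first exact: H.
by rewrite NegzE cexpN H; apply: complex_ext; rewrite /= ?oppr0.
Qed.

Lemma cexp_at0 k : cexp k 0 = 1 :> R[i].
Proof. by apply: complex_ext; rewrite /= mulr0 ?cos0 ?sin0. Qed.

Lemma cintegral_cexp k :
  cintegral leb angles (cexp k) = if k == 0 then (2 * pi)%:C else 0.
Proof.
have pi2 : 0 < 2 * pi :> R by rewrite mulr_gt0// pi_gt0.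
case: eqP => [->|/eqP k0].
  have -> : cexp 0 = fun=> 1 :> R[i] by apply/funext => t; rewrite cexp0.
  have mA := @measurable_angles R.
  apply: complex_ext; rewrite ?Re_cintegral ?Im_cintegral Rintegral_cst//.
    by rewrite /= lebesgue_measure_itv/= lte_fin pi2 -EFinD subr0 mul1r.
  by rewrite mul0r.
have c : ('i%C * k%:~R%:C : R[i]) != 0.
  rewrite mulf_eq0 negb_or; apply/andP; split.
    by rewrite eq_complex /= oner_eq0 andbF.
  by rewrite eq_complex /= intr_eq0 (negPf k0).
apply: (mulfI c); rewrite mulr0 -cintegralZ.
- rewrite (@cintegral_FTC (cexp k)).
  + by rewrite cexp_2pi cexp_at0 subrr.
  + by apply: ccontinuousM; [exact: ccontinuous_cst|exact: ccontinuous_cexp].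
  + by move=> t; exact: is_cderive1_cexp.
- exact: measurable_angles.
- exact/angles_cintegrable/ccontinuous_cexp.
Qed.

Lemma cexp_inL2 k : inL2 leb angles (cexp k).
Proof. exact/angles_inL2/ccontinuous_cexp. Qed.

Lemma inner_cexp k l :
  inner leb angles (cexp k) (cexp l) = if k == l then (2 * pi)%:C else 0.
Proof.
rewrite /inner -subr_eq0 -cintegral_cexp.
by apply: eq_cintegral => t _; rewrite cexpD cexpN.
Qed.

Lemma fourierE u k :
  fourier_coef u k = ((2 * pi)^-1)%:C * inner leb angles u (cexp k).
Proof. by []. Qed.

Lemma inner_fourier u k :
  inner leb angles u (cexp k) = (2 * pi)%:C * fourier_coef u k.
Proof.
have pi2 : 0 < 2 * pi :> R by rewrite mulr_gt0// pi_gt0.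
by rewrite fourierE mulrA -rmorphM/= mulfV ?rmorph1 ?mul1r ?gt_eqF.
Qed.

Lemma bessel_circle u n (k : 'I_n -> int) : injective k -> inL2 leb angles u ->
  \sum_(i < n) sqmod (fourier_coef u (k i)) <= (2 * pi)^-1 * normsq leb angles u.
Proof.
move=> kI hu; have pi2 : 0 < 2 * pi :> R by rewrite mulr_gt0// pi_gt0.
have ok i j : inner leb angles (cexp (k i)) (cexp (k j)) =
    if i == j then (2 * pi)%:C else 0.
  by rewrite inner_cexp (inj_eq kI).
have := bessel (@measurable_angles R) hu (fun i => cexp_inL2 (k i))
  (fun=> pi2) ok.
rewrite ler_pdivlMl// mulr_sumr; apply: le_trans; apply: ler_sum => i _.
rewrite inner_fourier sqmodM sqmodR le_eqVlt; apply/orP; left; apply/eqP.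
by move: (2 * pi) pi2 => q q0; field; rewrite gt_eqF.
Qed.

Lemma sqmod_fourier_le u k : inL2 leb angles u ->
  sqmod (fourier_coef u k) <= (2 * pi)^-1 * normsq leb angles u.
Proof.
move=> hu; have := @bessel_circle u 1 (fun=> k) _ hu.
by rewrite big_ord1; apply => i j _; rewrite !ord1.
Qed.

End CircleFourier.

Section DiscMonomials.
Context {R : realType}.
Notation leb := (@lebesgue_measure R).
Implicit Types (w : R * R -> R[i]) (n j : nat).

Lemma zcX_inL2 n : inL2 leb2 disc (fun z : R * R => zc z ^+ n).
Proof. exact/disc_inL2/cC1_ccontinuous/cC1_zcX. Qed.

Lemma zcXJ_inL2 n : inL2 leb2 disc (fun z : R * R => conjc (zc z ^+ n)).
Proof. exact/disc_inL2/cC1_ccontinuous/cC1J/cC1_zcX. Qed.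

Lemma piC_half (x : R[i]) : (2 * pi)%:C * x / 2 = pi%:C * x.
Proof. by rewrite rmorphM/= rmorph_nat; move: (pi%:C) => p; field. Qed.

(** Pairing the Wirtinger derivatives with monomials reads off the Fourier
    coefficients of the boundary values: conjugates of holomorphic monomials
    are annihilated by the derivative, so the integrand is itself a derivative
    and Green's formula applies. *)
Lemma inner_cdel w n : cC1 w ->
  inner leb2 disc (cdel w) (fun z => zc z ^+ n) =
  pi%:C * fourier_coef (w \o circ) n.+1%:Z.
Proof.
move=> hw; have hz := cC1J (@cC1_zcX R n).
transitivity (cintegral leb2 disc (cdel (fun z => w z * conjc (zc z ^+ n)))).
  apply: eq_cintegral => z _; rewrite cdelM// cdelJ; last exact: cC1_zcX.
  by rewrite cdelbar_zcX (cjR 0) mulr0 add0r.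
rewrite cgreen; last exact: cC1M.
rewrite -piC_half -inner_fourier; congr (_ / 2); apply: eq_cintegral => t _.
by rewrite zcX_circ -mulrA -cjM -cexpD intS addrC.
Qed.

Lemma inner_cdelbar w n : cC1 w ->
  inner leb2 disc (cdelbar w) (fun z => conjc (zc z ^+ n)) =
  pi%:C * fourier_coef (w \o circ) (- n.+1%:Z).
Proof.
move=> hw; have hz := @cC1_zcX R n.
transitivity (cintegral leb2 disc (cdelbar (fun z => w z * zc z ^+ n))).
  apply: eq_cintegral => z _; rewrite cdelbarM// cdelbar_zcX cjK.
  by rewrite mulr0 add0r.
rewrite cgreenbar; last exact: cC1M.
rewrite -piC_half -inner_fourier; congr (_ / 2); apply: eq_cintegral => t _.
by rewrite zcX_circ -mulrA -cexpD cexpN cjK intS addrC.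
Qed.

(** Pairing the derivative of w with monomials loses the mean of w on the circle;
    differentiating w times the coordinate recovers it. *)
Lemma fourier0_circ w : cC1 w ->
  pi%:C * fourier_coef (w \o circ) 0 =
  inner leb2 disc w (fun=> 1) +
  inner leb2 disc (cdel w) (fun z => conjc (zc z)).
Proof.
move=> hw.
have h1 : inL2 leb2 disc w by exact/disc_inL2/cC1_ccontinuous.
have h2 : inL2 leb2 disc (cdel w) by exact/disc_inL2/ccontinuous_cdel.
have h3 : inL2 leb2 disc (fun z : R * R => conjc (zc z)).
  exact/disc_inL2/ccontinuousJ/cC1_ccontinuous/cC1_zc.
have h4 : inL2 leb2 disc (fun _ : R * R => 1 : R[i]).
  exact/disc_inL2/ccontinuous_cst.
have md := @measurable_disc R.
transitivity (cintegral leb2 disc (cdel (fun z => w z * zc z))).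
  rewrite cgreen; last by apply: cC1M => //; exact: cC1_zc.
  rewrite -piC_half -inner_fourier; congr (_ / 2); apply: eq_cintegral => t _.
  rewrite zc_circ -mulrA mul_conj sqmod_cexp cexp0 /=.
  by congr (_ * _); apply: complex_ext; rewrite /= ?oppr0.
rewrite /inner -cintegralD//; [|exact: inner_integrable|exact: inner_integrable].
apply: eq_cintegral => z _; rewrite cdelM//; last exact: cC1_zc.
rewrite cdel_zc cjK (_ : conjc 1 = 1)//.
by apply: complex_ext; rewrite /= ?oppr0.
Qed.

(** A monomial is, up to a factor, the derivative of the next one, so that
    orthogonality on the disc follows from orthogonality on the circle. *)
Lemma inner_zcX n j : inner leb2 disc (fun z : R * R => zc z ^+ n) (fun z => zc z ^+ j) =
  if n == j then (pi / n.+1%:R)%:C else 0.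
Proof.
have md := @measurable_disc R.
have h n := zcX_inL2 n.
have n0 : n.+1%:R != 0 :> R[i] by rewrite natC eq_complex /= pnatr_eq0.
apply: (mulfI n0).
have <- : inner leb2 disc (cdel (fun z : R * R => zc z ^+ n.+1)) (fun z => zc z ^+ j) =
    n.+1%:R * inner leb2 disc (fun z => zc z ^+ n) (fun z => zc z ^+ j).
  rewrite -innerZl//; apply: eq_cintegral => z _.
  by rewrite cdel_zcX.
rewrite inner_cdel; last exact: cC1_zcX.
have -> : (fun z : R * R => zc z ^+ n.+1) \o circ = cexp n.+1%:Z.
  by apply/funext => t /=; rewrite zcX_circ.
rewrite fourierE inner_cexp eqz_nat eqSS; case: eqP => _; last by rewrite !mulr0.
rewrite natC -!rmorphM/=; congr (_%:C).
by move: (@pi R) (pi_gt0 R) => p p0; field; rewrite nat1r pnatr_eq0 /= gt_eqF.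
Qed.

Lemma inner_zcXJ n j :
  inner leb2 disc (fun z : R * R => conjc (zc z ^+ n)) (fun z => conjc (zc z ^+ j)) =
  if n == j then (pi / n.+1%:R)%:C else 0.
Proof.
transitivity (inner leb2 disc (fun z : R * R => zc z ^+ j) (fun z => zc z ^+ n)).
  by apply: eq_cintegral => z _; rewrite cjK mulrC.
by rewrite inner_zcX eq_sym; case: eqP => // ->.
Qed.

(** Bessel's inequality for the monomials, whose squared norms pi / (n + 1)
    produce the weights n + 1 of the energy. *)
Lemma bessel_disc (phi : R * R -> R[i]) (c : nat -> R[i]) N :
  inL2 leb2 disc phi ->
  (forall n, inner leb2 disc phi (fun z => zc z ^+ n) = pi%:C * c n.+1) ->
  pi * \sum_(n < N) n.+1%:R * sqmod (c n.+1) <= normsq leb2 disc phi.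
Proof.
move=> hphi hc; have md := @measurable_disc R.
have N0 (n : 'I_N) : 0 < pi / n.+1%:R :> R by rewrite divr_gt0 ?pi_gt0.
apply: le_trans (bessel md hphi (fun n : 'I_N => zcX_inL2 n) N0 _).
  rewrite mulr_sumr; apply: ler_sum => n _; rewrite hc sqmodM sqmodR.
  rewrite le_eqVlt; apply/orP; left; apply/eqP.
  by move: (@pi R) (pi_gt0 R) => p p0; field; rewrite nat1r pnatr_eq0 /= gt_eqF.
by move=> n j; rewrite inner_zcX.
Qed.

Lemma bessel_discJ (phi : R * R -> R[i]) (c : nat -> R[i]) N :
  inL2 leb2 disc phi ->
  (forall n, inner leb2 disc phi (fun z => conjc (zc z ^+ n)) = pi%:C * c n.+1) ->
  pi * \sum_(n < N) n.+1%:R * sqmod (c n.+1) <= normsq leb2 disc phi.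
Proof.
move=> hphi hc; have md := @measurable_disc R.
have N0 (n : 'I_N) : 0 < pi / n.+1%:R :> R by rewrite divr_gt0 ?pi_gt0.
apply: le_trans (bessel md hphi (fun n : 'I_N => zcXJ_inL2 n) N0 _).
  rewrite mulr_sumr; apply: ler_sum => n _; rewrite hc sqmodM sqmodR.
  rewrite le_eqVlt; apply/orP; left; apply/eqP.
  by move: (@pi R) (pi_gt0 R) => p p0; field; rewrite nat1r pnatr_eq0 /= gt_eqF.
by move=> n j; rewrite inner_zcXJ.
Qed.

End DiscMonomials.

(** * The energy identity for smooth functions *)

Section SmoothFunctions.
Context {R : realType}.
Notation leb := (@lebesgue_measure R).
Implicit Types (P Q : R * R -> R) (w : R * R -> R[i]).

Lemma mvt (F f : R -> R) (a b : R) : a < b ->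
  (forall x : R, is_derive x (1 : R) F (f x)) ->
  exists2 c, c \in `]a, b[%R & F b - F a = f c * (b - a).
Proof.
move=> ab dF; apply: MVT => //.
by apply: continuous_subspaceT => x; apply/differentiable_continuous/derivable1_diffP;
  case: (dF x).
Qed.

(** Divided by h * h, the quantity del h is a value of U and a value of V at
    points that tend to (x, y) with h. *)
Lemma eq_density (U V : R * R -> R) (x y : R) (del : R -> R) :
  continuous U -> continuous V ->
  (forall h, 0 < h -> exists c d,
    [/\ c \in `]x, (x + h)[%R, d \in `]y, (y + h)[%R & del h = U (c, d) * (h * h)]) ->
  (forall h, 0 < h -> exists c d,
    [/\ c \in `]x, (x + h)[%R, d \in `]y, (y + h)[%R & del h = V (c, d) * (h * h)]) ->
  U (x, y) = V (x, y).
Proof.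
move=> cU cV AU AV.
have near1 (S : R * R -> R) e : continuous S -> 0 < e ->
    exists2 h0, 0 < h0 & forall h c d, 0 < h -> h < h0 ->
      c \in `]x, (x + h)[%R -> d \in `]y, (y + h)[%R -> `|S (x, y) - S (c, d)| < e.
  move=> cS e0; have /cvgrPdist_lt/(_ e e0) := cS (x, y).
  move=> /nbhs_ballP[r /= r0 hr]; exists r => // h c d h0 hlt.
  rewrite !in_itv/= => /andP[c1 c2] /andP[d1 d2]; apply: hr; split=> /=.
    by rewrite /ball/= ltr_distlC; apply/andP; split; lra.
  by rewrite /ball/= ltr_distlC; apply/andP; split; lra.
apply/eqP; rewrite -subr_eq0 -normr_le0; apply/ler_addgt0Pr => e e0.
have e2 : 0 < e / 2 by rewrite divr_gt0.
have [h1 h10 H1] := near1 _ _ cV e2.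
have [h2 h20 H2] := near1 _ _ cU e2.
pose h := Num.min h1 h2 / 2.
have m0 : 0 < Num.min h1 h2 by rewrite lt_min h10.
have h0 : 0 < h by rewrite /h divr_gt0.
have hm : h < Num.min h1 h2 by rewrite /h; lra.
have hh1 : h < h1 by move: hm; rewrite lt_min => /andP[].
have hh2 : h < h2 by move: hm; rewrite lt_min => /andP[].
have [c [d [cI dI E1]]] := AV h h0.
have [c' [d' [cI' dI' E2]]] := AU h h0.
have {H1} := H1 h c d h0 hh1 cI dI.
have {H2} := H2 h c' d' h0 hh2 cI' dI'.
have -> : U (c', d') = V (c, d).
  apply: (mulIf (_ : h * h != 0)); first by rewrite mulf_neq0 ?gt_eqF.
  by rewrite -E1 -E2.
rewrite !ltr_norml add0r => /andP[? ?] /andP[? ?].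
by rewrite ler_norml; apply/andP; split; lra.
Qed.

(** Second differences of P around a point, divided by the area of the
    rectangle, are values of either mixed derivative at nearby points. *)
Lemma derive_swap P (z : R * R) : smooth P ->
  'D_ex (fun z => 'D_ey P z) z = 'D_ey (fun z => 'D_ex P z) z.
Proof.
move=> sP; have hP := smooth_C1 sP.
have hx := smooth_C1 (smooth_derive ex sP).
have hy := smooth_C1 (smooth_derive ey sP).
case: z => x y.
pose del h := P (x + h, y + h) - P (x + h, y) - P (x, y + h) + P (x, y).
have A1 h : 0 < h -> exists c d, [/\ c \in `]x, (x + h)[%R, d \in `]y, (y + h)[%R &
    del h = 'D_ey (fun z => 'D_ex P z) (c, d) * (h * h)].
  move=> h0; have xh : x < x + h by lra.
  have yh : y < y + h by lra.
  have [c cI] := @mvt (fun s => P (s, y + h) - P (s, y))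
    (fun s => 'D_ex P (s, y + h) - 'D_ex P (s, y)) x (x + h) xh
    (fun s => is_deriveB (is_derive_slicex s (y + h) hP) (is_derive_slicex s y hP)).
  have [d dI -> E] := @mvt (fun t => 'D_ex P (c, t))
    (fun t => 'D_ey (fun z => 'D_ex P z) (c, t)) y (y + h) yh
    (fun t => is_derive_slicey c t hx).
  exists c, d; split=> //; rewrite /del.
  transitivity (P (x + h, y + h) - P (x + h, y) - (P (x, y + h) - P (x, y))).
    by lra.
  by rewrite E; ring.
have A2 h : 0 < h -> exists c d, [/\ c \in `]x, (x + h)[%R, d \in `]y, (y + h)[%R &
    del h = 'D_ex (fun z => 'D_ey P z) (c, d) * (h * h)].
  move=> h0; have xh : x < x + h by lra.
  have yh : y < y + h by lra.
  have [d dI] := @mvt (fun s => P (x + h, s) - P (x, s))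
    (fun s => 'D_ey P (x + h, s) - 'D_ey P (x, s)) y (y + h) yh
    (fun s => is_deriveB (is_derive_slicey (x + h) s hP) (is_derive_slicey x s hP)).
  have [c cI -> E] := @mvt (fun t => 'D_ey P (t, d))
    (fun t => 'D_ex (fun z => 'D_ey P z) (t, d)) x (x + h) xh
    (fun t => is_derive_slicex t d hy).
  exists c, d; split=> //; rewrite /del.
  transitivity (P (x + h, y + h) - P (x, y + h) - (P (x + h, y) - P (x, y))).
    by lra.
  by rewrite E; ring.
exact: (eq_density (hy.2 ex) (hx.2 ey) A2 A1).
Qed.

Lemma square_convex (z u : R * R) (t : R) : square z -> square u -> 0 <= t <= 1 ->
  square (z.1 + t * (u.1 - z.1), z.2 + t * (u.2 - z.2)).
Proof.
rewrite /square /= !in_itv/= => -[/andP[? ?] /andP[? ?]] [/andP[? ?] /andP[? ?]].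
by move=> /andP[? ?]; split; apply/andP; split; nra.
Qed.

Lemma lipschitz_square P : C1 P -> exists2 L, 0 <= L &
  forall z u, square z -> square u ->
    (P u - P z) ^+ 2 <= L * ((u.1 - z.1) ^+ 2 + (u.2 - z.2) ^+ 2).
Proof.
move=> hP.
have [M1 M10 H1] := bounded_square (hP.2 ex).
have [M2 M20 H2] := bounded_square (hP.2 ey).
exists (2 * (M1 ^+ 2 + M2 ^+ 2)); first by rewrite mulr_ge0// addr_ge0// sqr_ge0.
move=> z u zs us; set a := u.1 - z.1; set b := u.2 - z.2.
have dl (c e t : R) : is_derive t (1 : R) (fun t => c + t * e) e.
  by apply: is_derive_eq; rewrite /GRing.scale/=; ring.
have [c cI] := @mvt (fun t => P (z.1 + t * a, z.2 + t * b))
  (fun t => a * 'D_ex P (z.1 + t * a, z.2 + t * b) +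
            b * 'D_ey P (z.1 + t * a, z.2 + t * b)) 0 1 ltr01
  (fun t => is_derive_curve hP (dl z.1 a t) (dl z.2 b t)).
have -> : (z.1 + 1 * a, z.2 + 1 * b) = u.
  by case: u @a @b us => u1 u2 /= _; congr pair; lra.
have -> : (z.1 + 0 * a, z.2 + 0 * b) = z.
  by rewrite !mul0r !addr0; case: z {zs} @a @b cI.
move=> ->; rewrite subr0 mulr1.
have cs : square (z.1 + c * a, z.2 + c * b).
  apply: square_convex => //; move: cI; rewrite in_itv/= => /andP[? ?].
  by apply/andP; split; exact: ltW.
have D1 := H1 _ cs; have D2 := H2 _ cs.
set p := 'D_ex P _ in D1 *; set q := 'D_ey P _ in D2 *.
have p2 : p ^+ 2 <= M1 ^+ 2.
  by rewrite -[p ^+ 2]real_normK ?num_real// lerXn2r ?nnegrE.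
have q2 : q ^+ 2 <= M2 ^+ 2.
  by rewrite -[q ^+ 2]real_normK ?num_real// lerXn2r ?nnegrE.
have := sqr_ge0 (a * p - b * q); have := sqr_ge0 a; have := sqr_ge0 b.
have := sqr_ge0 p; have := sqr_ge0 q.
move=> ? ? ? ? ?.
apply: (@le_trans _ _ (2 * (a ^+ 2 * p ^+ 2 + b ^+ 2 * q ^+ 2))); first nra.
have : a ^+ 2 * p ^+ 2 <= a ^+ 2 * M1 ^+ 2 by rewrite ler_wpM2l.
have : b ^+ 2 * q ^+ 2 <= b ^+ 2 * M2 ^+ 2 by rewrite ler_wpM2l.
nra.
Qed.

Lemma circ_square (t : R) : square (circ t).
Proof. by split; rewrite /= in_itv/= ?cos_geN1 ?cos_le1 ?sin_geN1 ?sin_le1. Qed.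

(** The mean value theorem on the chord, which lies in the convex square on
    which the partial derivatives are bounded. *)
Lemma lipschitz_circ w : cC1 w -> exists2 L, 0 <= L &
  forall t s, sqmod (w (circ t) - w (circ s)) <= L * sqmod (cexp 1 t - cexp 1 s).
Proof.
move=> [w1 w2].
have [L1 L10 H1] := lipschitz_square w1.
have [L2 L20 H2] := lipschitz_square w2.
exists (L1 + L2); first exact: addr_ge0.
move=> t s; have := H1 _ _ (circ_square s) (circ_square t).
have := H2 _ _ (circ_square s) (circ_square t).
by rewrite /sqmod !cReD !cImD !cReN !cImN /= !mul1r mulrDl; lra.
Qed.

Definition circ_derive w (t : R) : R[i] :=
  (- sin t)%:C * cderive ex w (circ t) + (cos t)%:C * cderive ey w (circ t).

Lemma is_cderive1_circ w t : cC1 w -> is_cderive1 t (w \o circ) (circ_derive w t).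
Proof.
move=> [w1 w2].
have dc : is_derive t (1 : R) cos (- sin t) by exact: is_derive_eq.
have ds : is_derive t (1 : R) sin (cos t) by exact: is_derive_eq.
split.
- rewrite cReD !ReZl; exact: (is_derive_curve w1 dc ds).
- rewrite cImD !ImZl; exact: (is_derive_curve w2 dc ds).
Qed.

Lemma ccontinuous_circ_derive w : cC1 w -> ccontinuous (circ_derive w).
Proof.
move=> hw; apply: ccontinuousD; apply: ccontinuousM.
- split=> t; last exact: cvg_cst.
  by apply: cvgN; exact: continuous_sin.
- exact/ccontinuous_circ/ccontinuous_cderive.
- by split=> t; [exact: continuous_cos|exact: cvg_cst].
- exact/ccontinuous_circ/ccontinuous_cderive.
Qed.

Lemma derive_wronskian (a b p q : R * R -> R) e z : C1 a -> C1 b -> C1 p -> C1 q ->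
  'D_e (fun z => a z * q z - b z * p z) z =
  a z * 'D_e q z + q z * 'D_e a z - (b z * 'D_e p z + p z * 'D_e b z).
Proof.
move=> ha hb hp hq; have haq := C1M ha hq; have hbp := C1M hb hp.
rewrite (derivePD z e haq (C1N hbp)) (derivePN z e hbp).
by rewrite (derivePM z e ha hq) (derivePM z e hb hp).
Qed.

(** The integrand on the left is the Jacobian determinant of w. It is half the
    divergence of (P, - Q) below, because the mixed second derivatives cancel;
    on the circle, the flux involves tangential derivatives only. *)
Lemma energy_boundary w : csmooth w ->
  normsq leb2 disc (cdel w) - normsq leb2 disc (cdelbar w) =
  complex.Im (inner leb angles (circ_derive w) (w \o circ)) / 2.
Proof.
move=> [s1 s2]; set a := (fun z => complex.Re (w z)) in s1.
set b := (fun z => complex.Im (w z)) in s2.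
have hw : cC1 w by exact: csmooth_cC1.
have a1 := smooth_C1 s1; have b1 := smooth_C1 s2.
have ax := smooth_C1 (smooth_derive ex s1); have ay := smooth_C1 (smooth_derive ey s1).
have bx := smooth_C1 (smooth_derive ex s2); have by_ := smooth_C1 (smooth_derive ey s2).
pose P z := a z * 'D_ey b z - b z * 'D_ey a z.
pose Q z := a z * 'D_ex b z - b z * 'D_ex a z.
have hP : C1 P by apply: C1D; [|apply: C1N]; exact: C1M.
have hQ : C1 Q by apply: C1D; [|apply: C1N]; exact: C1M.
have dP z : 'D_ex P z - 'D_ey Q z =
    2 * ('D_ex a z * 'D_ey b z - 'D_ey a z * 'D_ex b z).
  have E1 := derive_wronskian ex z a1 b1 ay by_.
  have E2 := derive_wronskian ey z a1 b1 ax bx.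
  have S1 := derive_swap z s1; have S2 := derive_swap z s2.
  have alg (A B m n p q r s : R) : (A * m + q * p - (B * n + r * s)) -
      (A * m + s * r - (B * n + p * q)) = 2 * (p * q - r * s) by ring.
  rewrite S1 in E1.
  rewrite S2 in E1.
  rewrite [LHS](congr2 (fun x y => x - y) E1 E2).
  exact: alg.
have PE z : P z = a z * 'D_ey b z - b z * 'D_ey a z by [].
have QE z : Q z = a z * 'D_ex b z - b z * 'D_ex a z by [].
clearbody P Q.
have md := @measurable_disc R; have ma := @measurable_angles R.
have i1 := inL2_sqmod md (disc_inL2 (ccontinuous_cdel hw)).
have i2 := inL2_sqmod md (disc_inL2 (ccontinuous_cdelbar hw)).
have iP : leb2.-integrable disc (EFin \o (fun z => 'D_ex P z)).
  by apply: disc_integrable; exact: hP.2.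
have iQ : leb2.-integrable disc (EFin \o (fun z => 'D_ey Q z)).
  by apply: disc_integrable; exact: hQ.2.
have -> : normsq leb2 disc (cdel w) - normsq leb2 disc (cdelbar w) =
    \int[leb2]_(z in disc) (sqmod (cdel w z) - sqmod (cdelbar w z)).
  by rewrite RintegralB.
transitivity (\int[leb2]_(z in disc) (('D_ex P z - 'D_ey Q z) * 2^-1)).
  apply: eq_Rintegral => z _; rewrite dP /sqmod !Re_cdel !Im_cdel.
  by rewrite !Re_cdelbar !Im_cdelbar -/a -/b; field.
rewrite (RintegralZr _ md (integrableB md iP iQ)).
rewrite (RintegralB md iP iQ) (green_x hP) (green_y hQ); congr (_ / 2).
have iPc : leb.-integrable angles (EFin \o (fun t => P (circ t) * cos t)).
  apply: itv_integrable => t; apply: cvgM; last exact: continuous_cos.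
  exact/continuous_circ/C1_continuous.
have iQc : leb.-integrable angles (EFin \o (fun t => Q (circ t) * sin t)).
  apply: itv_integrable => t; apply: cvgM; last exact: continuous_sin.
  exact/continuous_circ/C1_continuous.
rewrite -(RintegralB ma iPc iQc) Im_cintegral; apply: eq_Rintegral => t _.
rewrite cImM cReJ cImJ /circ_derive cReD cImD !ReZl !ImZl.
rewrite !Re_cderive !Im_cderive -/a -/b PE QE /=; ring.
Qed.

End SmoothFunctions.

(** * Convergence of Fourier series *)

Section Chernoff.
Context {R : realType}.
Notation leb := (@lebesgue_measure R).
Implicit Types (w : R * R -> R[i]).

Lemma bounded_sum_cvg0 (u : nat -> R) (M : R) : (forall n, 0 <= u n) ->
  (forall n, \sum_(i < n) u i <= M) -> u @ \oo --> 0.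
Proof.
move=> u0 uM; apply: cvg_series_cvg_0; apply: nondecreasing_is_cvgn.
  apply/nondecreasing_seqP => n; rewrite /series/= big_nat_recr//=.
  by rewrite lerDl.
by exists M => _ [n _ <-]; rewrite /series/= big_mkord.
Qed.

(** By Bessel's inequality these terms are summable. *)
Lemma fourier_cvg0 (u : R -> R[i]) (k : nat -> int) : injective k ->
  inL2 leb angles u -> (fun n => sqmod (fourier_coef u (k n))) @ \oo --> 0.
Proof.
move=> kI hu.
apply: (@bounded_sum_cvg0 _ ((2 * pi)^-1 * normsq leb angles u)).
  by move=> n; exact: sqmod_ge0.
move=> n; apply: (@bessel_circle _ u n (fun i : 'I_n => k i)) => //.
by move=> i j /kI /val_inj.
Qed.

Lemma measurable_sqmodV (u : R -> R[i]) : cmeasurable angles u ->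
  measurable_fun (angles : set (measurableTypeR R)) (fun t => (sqmod (u t))^-1).
Proof.
move=> hu; under eq_fun do rewrite -(powR_inv1 (sqmod_ge0 _)).
exact: (measurableT_comp (measurable_powR (- 1)) (measurable_sqmod hu)).
Qed.

Lemma cmeasurableV (u : R -> R[i]) : cmeasurable angles u ->
  cmeasurable angles (fun t => (u t)^-1).
Proof.
move=> hu; have mV := measurable_sqmodV hu.
have -> : (fun t => (u t)^-1) =
    (fun t => conjc (u t) * ((sqmod (u t))^-1)%:C).
  apply/funext => t; case: (eqVneq (u t) 0) => [->|u0].
    by rewrite invr0 (cjR 0) mul0r.
  have s0 : sqmod (u t) != 0.
    by apply: (contra_neq _ u0); exact: sqmod_eq0.
  apply: (mulfI u0); rewrite mulfV// mulrA mul_conj -rmorphM/= mulfV//.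
apply: cmeasurableM; first exact: cmeasurableJ.
by split => //=; exact: measurable_cst.
Qed.

(** Chernoff's quotient: the Fourier series of w at t0 telescopes into two
    Fourier coefficients of this function of t, which is bounded because w is
    Lipschitz. Where the denominator vanishes so does the numerator, and the
    default value 0 of the quotient does no harm. *)
Definition chernoff w (t0 t : R) : R[i] :=
  (w (circ t) - w (circ t0)) / (cexp 1 t - cexp 1 t0).

Lemma chernoffE w t0 t :
  w (circ t) = w (circ t0) + chernoff w t0 t * (cexp 1 t - cexp 1 t0).
Proof.
rewrite /chernoff; have [e0|e0] := eqVneq (cexp 1 t - cexp 1 t0) 0.
  move/eqP: e0; rewrite subr_eq0 => /eqP [].
  rewrite !mul1r => c s; have -> : circ t = circ t0 by rewrite /circ c s.
  by rewrite subrr !mul0r addr0.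
by rewrite divfK// addrC subrK.
Qed.

Lemma sqmod_chernoff_le w t0 t L : 0 <= L ->
  (forall t s, sqmod (w (circ t) - w (circ s)) <= L * sqmod (cexp 1 t - cexp 1 s)) ->
  sqmod (chernoff w t0 t) <= L.
Proof.
move=> L0 wL; rewrite /chernoff.
have [e0|e0] := eqVneq (cexp 1 t - cexp 1 t0) 0.
  by rewrite e0 invr0 mulr0 sqmodR expr0n.
have s0 : 0 < sqmod (cexp 1 t - cexp 1 t0).
  rewrite lt_neqAle sqmod_ge0 andbT eq_sym.
  by apply: (contra_neq _ e0); exact: sqmod_eq0.
rewrite -(ler_pM2r s0) -sqmodM divfK//.
Qed.

Lemma chernoff_inL2 w t0 : cC1 w -> inL2 leb angles (chernoff w t0).
Proof.
move=> hw; have [L L0 wL] := lipschitz_circ hw.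
apply: (@le_inL2 _ _ _ leb angles measurable_angles _ (fun=> (Num.sqrt L)%:C)).
- apply: cmeasurableM.
    apply: cmeasurableD; last exact: cmeasurable_cst.
    by case: (angles_inL2 (ccontinuous_circ (cC1_ccontinuous hw))).
  apply: cmeasurableV; apply: cmeasurableD; last exact: cmeasurable_cst.
  by case: (@cexp_inL2 R 1).
- exact/angles_inL2/ccontinuous_cst.
- by move=> t _; rewrite sqmodR sqr_sqrtr//; exact: sqmod_chernoff_le.
Qed.

(** Multiplying by exp (i t) shifts Fourier coefficients, so the product of the
    quotient with exp (i t) - exp (i t0) has differences as coefficients. *)
Lemma fourier_chernoff w t0 k : cC1 w ->
  fourier_coef (w \o circ) k = (k == 0)%:R * w (circ t0) +
    (fourier_coef (chernoff w t0) (k - 1) -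
     cexp 1 t0 * fourier_coef (chernoff w t0) k).
Proof.
move=> hw; have ma := @measurable_angles R.
have hh := chernoff_inL2 t0 hw.
have pi2 : 0 < 2 * pi :> R by rewrite mulr_gt0// pi_gt0.
have pC : (2 * pi)%:C != 0 :> R[i].
  by rewrite eq_complex /= negb_and gt_eqF.
have h1 : inL2 leb angles (fun t => chernoff w t0 t * cexp 1 t).
  apply: (le_inL2 ma _ hh) => [|t _].
    by apply: cmeasurableM; [case: hh|case: (@cexp_inL2 R 1)].
  by rewrite sqmodM sqmod_cexp mulr1.
have h2 := inL2Z ma (- cexp 1 t0) hh.
have h3 : inL2 leb angles (fun=> w (circ t0)) by exact/angles_inL2/ccontinuous_cst.
have hc l := @cexp_inL2 R l.
apply: (mulfI pC); rewrite -inner_fourier.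
have -> : w \o circ = fun t => w (circ t0) +
    (chernoff w t0 t * cexp 1 t + (- cexp 1 t0) * chernoff w t0 t).
  by apply/funext => t /=; rewrite {1}(chernoffE w t0 t); ring.
rewrite innerDl//; last exact: inL2D.
rewrite innerDl// innerZl//.
have -> : inner leb angles (fun=> w (circ t0)) (cexp k) =
    w (circ t0) * inner leb angles (cexp 0) (cexp k).
  rewrite -innerZl//; congr (inner _ _ _ _).
  by apply/funext => t; rewrite cexp0 mulr1.
have -> : inner leb angles (fun t => chernoff w t0 t * cexp 1 t) (cexp k) =
    inner leb angles (chernoff w t0) (cexp (k - 1)).
  apply: eq_cintegral => t _; rewrite -mulrA; congr (_ * _).
  by rewrite -!cexpN -cexpD opprB.
rewrite !inner_fourier fourierE inner_cexp eq_sym.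
case: eqP => _; last by rewrite !mulr0 mul0r; ring.
by rewrite mul1r -rmorphM/= mulVf ?gt_eqF// mulr1; ring.
Qed.

Definition partial_fourier (u : R -> R[i]) N (t : R) : R[i] :=
  \sum_(j < N + N.+1) fourier_coef u (j%:Z - N%:Z) * cexp (j%:Z - N%:Z) t.

Lemma partial_fourierE w t0 N : cC1 w ->
  partial_fourier (w \o circ) N t0 - w (circ t0) =
  cexp (- N%:Z) t0 * fourier_coef (chernoff w t0) (- N.+1%:Z) -
  cexp N.+1%:Z t0 * fourier_coef (chernoff w t0) N%:Z.
Proof.
move=> hw.
pose a (j : nat) := - (cexp (j%:Z - N%:Z) t0 *
  fourier_coef (chernoff w t0) (j%:Z - N.+1%:Z)).
have E (j : nat) : fourier_coef (w \o circ) (j%:Z - N%:Z) * cexp (j%:Z - N%:Z) t0 =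
    (j%:Z - N%:Z == 0)%:R * w (circ t0) + (a j.+1 - a j).
  rewrite (fourier_chernoff t0 _ hw) /a.
  have -> : j.+1%:Z - N%:Z = 1 + (j%:Z - N%:Z) by lia.
  have -> : j.+1%:Z - N.+1%:Z = j%:Z - N%:Z by lia.
  have -> : j%:Z - N.+1%:Z = j%:Z - N%:Z - 1 by lia.
  move: (j%:Z - N%:Z) => m; rewrite (cexpD 1 m).
  case: eqP => [->|_]; last by rewrite !mul0r; ring.
  by rewrite cexp0; ring.
rewrite /partial_fourier (eq_bigr _ (fun (j : 'I_(N + N.+1)) _ => E j)) big_split/=.
rewrite -mulr_suml.
have -> : \sum_(j < N + N.+1) (j%:Z - N%:Z == 0)%:R = 1 :> R[i].
  have NN : (N < N + N.+1)%N by rewrite addnS ltnS leq_addr.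
  rewrite (bigD1 (Ordinal NN))//= subrr eqxx big1 ?addr0// => j jN.
  rewrite subr_eq0 eqz_nat; case: eqP => // jE.
  by move: jN; rewrite -val_eqE /= jE eqxx.
rewrite mul1r -(big_mkord xpredT (fun j => a j.+1 - a j)) telescope_sumr ?leq0n//.
rewrite addrAC subrr add0r /a.
have -> : (N + N.+1)%:Z - N%:Z = N.+1%:Z by lia.
have -> : (N + N.+1)%:Z - N.+1%:Z = N%:Z by lia.
by rewrite !sub0r opprK addrC.
Qed.

Lemma sqmod_partial_fourier_le w t0 N : cC1 w ->
  sqmod (partial_fourier (w \o circ) N t0 - w (circ t0)) <=
  2 * sqmod (fourier_coef (chernoff w t0) (- N.+1%:Z)) +
  2 * sqmod (fourier_coef (chernoff w t0) N%:Z).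
Proof.
move=> hw; rewrite partial_fourierE//.
by apply: (le_trans (le_sqmodD _ _)); rewrite sqmodN !sqmodM !sqmod_cexp !mul1r.
Qed.

Lemma partial_fourier_cvg w t0 : cC1 w ->
  (fun N => sqmod (partial_fourier (w \o circ) N t0 - w (circ t0))) @ \oo --> 0.
Proof.
move=> hw; have hh := chernoff_inL2 t0 hw.
have c1 := @fourier_cvg0 _ (fun n => - n.+1%:Z) _ hh.
have c2 := @fourier_cvg0 _ (fun n => n%:Z) _ hh.
have {}c1 : (fun n => sqmod (fourier_coef (chernoff w t0) (- n.+1%:Z))) @ \oo --> 0.
  by apply: c1 => i j /oppr_inj [].
have {}c2 : (fun n => sqmod (fourier_coef (chernoff w t0) n%:Z)) @ \oo --> 0.
  by apply: c2 => i j [].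
apply: (@squeeze_cvgr _ _ _ _ (fun=> 0) (fun N =>
  2 * sqmod (fourier_coef (chernoff w t0) (- N.+1%:Z)) +
  2 * sqmod (fourier_coef (chernoff w t0) N%:Z))).
- apply: nearW => N; rewrite sqmod_ge0; exact: sqmod_partial_fourier_le.
- exact: cvg_cst.
- rewrite (_ : 0 = 2 * 0 + 2 * 0 :> R); last by rewrite !mulr0 addr0.
  by apply: cvgD; apply: cvgMr.
Qed.

Lemma partial_fourier_bounded w : cC1 w -> exists2 M, 0 <= M &
  forall N t, sqmod (partial_fourier (w \o circ) N t - w (circ t)) <= M.
Proof.
move=> hw; have [L L0 wL] := lipschitz_circ hw.
have ma := @measurable_angles R.
have pi2 : 0 < 2 * pi :> R by rewrite mulr_gt0// pi_gt0.
have H k t0 : sqmod (fourier_coef (chernoff w t0) k) <= L.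
  apply: (le_trans (sqmod_fourier_le k (chernoff_inL2 t0 hw))).
  rewrite ler_pdivrMl//.
  have hL : inL2 leb angles (fun=> (Num.sqrt L)%:C) by exact/angles_inL2/ccontinuous_cst.
  have -> : 2 * pi * L = normsq leb angles (fun=> (Num.sqrt L)%:C).
    have -> : (fun=> (Num.sqrt L)%:C) = (fun t : R => (Num.sqrt L)%:C * cexp 0 t).
      by apply/funext => t; rewrite cexp0 mulr1.
    rewrite normsqZ//; last exact: cexp_inL2.
    have := innerE ma (@cexp_inL2 R 0); rewrite inner_cexp eqxx => -[<-].
    by rewrite sqmodR sqr_sqrtr// mulrC.
  apply: le_Rintegral => //.
  - exact: inL2_sqmod (chernoff_inL2 t0 hw).
  - exact: inL2_sqmod hL.
  - by move=> t _; rewrite sqmodR sqr_sqrtr//; exact: sqmod_chernoff_le.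
exists (2 * L + 2 * L); first by rewrite addr_ge0// mulr_ge0.
move=> N t; apply: (le_trans (sqmod_partial_fourier_le t N hw)).
by rewrite lerD// ler_pM2l//.
Qed.

Lemma partial_fourier_inL2 u N : inL2 leb angles (partial_fourier u N).
Proof.
have ma := @measurable_angles R.
by apply: inL2_sum => // j; apply: inL2Z => //; exact: cexp_inL2.
Qed.

(** Pointwise convergence with a uniform bound, hence convergence in mean by
    dominated convergence. *)
Lemma partial_fourier_L2 w : cC1 w ->
  (fun N => normsq leb angles (fun t => w (circ t) - partial_fourier (w \o circ) N t))
  @ \oo --> 0.
Proof.
move=> hw; have ma := @measurable_angles R.
have hf : inL2 leb angles (w \o circ) by exact/angles_inL2/ccontinuous_circ/cC1_ccontinuous.
have hd N : inL2 leb angles (fun t => w (circ t) - partial_fourier (w \o circ) N t).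
  by apply: inL2B => //; exact: partial_fourier_inL2.
have [M M0 HM] := partial_fourier_bounded hw.
have hdE N t : sqmod (w (circ t) - partial_fourier (w \o circ) N t) =
    sqmod (partial_fourier (w \o circ) N t - w (circ t)) by rewrite -sqmodN opprB.
have hM : inL2 leb angles (fun=> (Num.sqrt M)%:C) by exact/angles_inL2/ccontinuous_cst.
pose F N t : \bar R := (sqmod (w (circ t) - partial_fourier (w \o circ) N t))%:E.
have mF N : measurable_fun (angles : set (measurableTypeR R)) (F N).
  exact: measurable_int _ (inL2_sqmod ma (hd N)).
have cF : {ae leb, forall t, angles t -> F ^~ t @ \oo --> (cst 0%E) t}.
  apply: aeW => t _; apply: cvg_EFin; first by apply: nearW.
  have -> : fine \o F^~ t =
      fun N => sqmod (partial_fourier (w \o circ) N t - w (circ t)).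
    by apply/funext => N /=; rewrite hdE.
  exact: partial_fourier_cvg.
have iM : leb.-integrable angles (fun=> M%:E).
  have := inL2_sqmod ma hM; apply: eq_integrable => // t _.
  by rewrite sqmodR sqr_sqrtr.
have FM : {ae leb, forall t N, angles t -> (`|F N t| <= M%:E)%E}.
  apply: aeW => t N _; rewrite /F /= lee_fin ger0_norm ?sqmod_ge0// hdE.
  exact: HM.
have [_ _] := dominated_convergence ma mF (measurable_cst _) cF iM FM.
rewrite integral0 => /fine_cvg; exact.
Qed.

(** Parseval's identity for the boundary form of the energy, as an upper
    bound: the partial sums of the Fourier series may be inserted in the
    second argument, and only the positive frequencies increase the result. *)
Lemma boundary_form_le w B : cC1 w ->
  (forall N, pi * \sum_(n < N) n.+1%:R * sqmod (fourier_coef (w \o circ) n.+1%:Z) <= B) ->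
  complex.Im (inner leb angles (circ_derive w) (w \o circ)) / 2 <= B.
Proof.
move=> hw HB; have ma := @measurable_angles R.
set f := w \o circ; set f' := circ_derive w.
have hf : inL2 leb angles f by exact/angles_inL2/ccontinuous_circ/cC1_ccontinuous.
have hf' : inL2 leb angles f' by exact/angles_inL2/ccontinuous_circ_derive.
have hc k := @cexp_inL2 R k.
have f'_coef k : inner leb angles f' (cexp k) =
    'i%C * k%:~R%:C * inner leb angles f (cexp k).
  have dfc t : is_cderive1 t (fun t => f t * cexp (- k) t)
      (f t * ('i%C * (- k)%:~R%:C * cexp (- k) t) + f' t * cexp (- k) t).
    by apply: is_cderive1M; [exact: is_cderive1_circ|exact: is_cderive1_cexp].
  have cfc : ccontinuous (fun t =>
      f t * ('i%C * (- k)%:~R%:C * cexp (- k) t) + f' t * cexp (- k) t).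
    apply: ccontinuousD; apply: ccontinuousM.
    - exact/ccontinuous_circ/cC1_ccontinuous.
    - by apply: ccontinuousM; [exact: ccontinuous_cst|exact: ccontinuous_cexp].
    - exact: ccontinuous_circ_derive.
    - exact: ccontinuous_cexp.
  have := cintegral_FTC cfc dfc; rewrite !cexp_2pi !cexp_at0 !mulr1.
  have -> : f (2 * pi) = f 0.
    by rewrite /f /= /circ mulr_natl cos2pi sin2pi cos0 sin0.
  rewrite subrr => E; apply/eqP; rewrite -subr_eq0; apply/eqP.
  rewrite -[RHS]E addrC -mulNr -(innerZl ma)// -(innerDl ma)//; last exact: inL2Z.
  apply: eq_cintegral => t _; rewrite cexpN mulrNz.
  by rewrite rmorphN/=; ring.
pose S N := partial_fourier f N.
have hS N : inL2 leb angles (S N) by exact: partial_fourier_inL2.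
have fS N : complex.Im (inner leb angles f' (S N)) / 2 <= B.
  have -> : inner leb angles f' (S N) =
      'i%C * (2 * pi * \sum_(j < N + N.+1)
        (j%:Z - N%:Z)%:~R * sqmod (fourier_coef f (j%:Z - N%:Z)))%:C.
    rewrite inner_sumr//; last by move=> j; exact: inL2Z.
    rewrite mulr_sumr rmorph_sum/= mulr_sumr; apply: eq_bigr => j _.
    rewrite innerZr// f'_coef inner_fourier.
    by move: (fourier_coef f _) => x; rewrite !rmorphM/= -mul_conj; ring.
  rewrite Im_iM /=; apply: le_trans (HB N).
  set X := \sum_(j < _) _.
  have -> : 2 * pi * X / 2 = pi * X by move: (@pi R) => p; field.
  rewrite ler_pM2l ?pi_gt0// /X.
  pose G (j : nat) : R :=
    (j%:Z - N%:Z)%:~R * sqmod (fourier_coef f (j%:Z - N%:Z)).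
  rewrite -(big_mkord xpredT G) (big_cat_nat (n := N.+1)) ?leq_addl//=.
  have -> : \sum_(N.+1 <= i < N + N.+1) G i = \sum_(i < N) G (i + N.+1)%N.
    by rewrite -{1}[N.+1]add0n big_addn addnK big_mkord.
  rewrite -[leRHS]add0r lerD//.
    rewrite big_mkord; apply: sumr_le0 => -[j /= jN] _; rewrite /G.
    rewrite mulr_le0_ge0 ?sqmod_ge0// -(mulr0z 1) ler_int; lia.
  apply: ler_sum => n _; rewrite /G.
  by have -> : (n + N.+1)%:Z - N%:Z = n.+1%:Z by lia.
pose u N := inner leb angles f' (fun t => f t - S N t).
have uE N : u N = inner leb angles f' f - inner leb angles f' (S N).
  rewrite /u -[- inner _ _ _ _]mulN1r -[- 1 in RHS](_ : conjc (- 1) = - 1).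
    rewrite -innerZr// -innerDr//; last exact: inL2Z.
    by congr (inner _ _ _ _); apply/funext => t; rewrite mulN1r.
  by apply: complex_ext; rewrite /= ?oppr0.
have u0 : (fun N => sqmod (u N)) @ \oo --> 0.
  apply: (@squeeze_cvgr _ _ _ _ (fun=> 0) (fun N =>
    normsq leb angles f' * normsq leb angles (fun t => f t - S N t))).
  - apply: nearW => N; rewrite sqmod_ge0 /=; apply: sqmod_inner_le => //.
    exact: inL2B.
  - exact: cvg_cst.
  - rewrite -(mulr0 (normsq leb angles f')).
    by apply: cvgMr; exact: partial_fourier_L2.
rewrite leNgt; apply/negP => Bf.
set d := complex.Im (inner leb angles f' f) / 2 - B.
have d0 : 0 < d by rewrite subr_gt0.
have /cvgrPdist_lt/(_ (d ^+ 2) (exprn_gt0 2 d0))[N _ /(_ N (leqnn N))] := u0.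
rewrite sub0r normrN ger0_norm ?sqmod_ge0//; apply/negP; rewrite -leNgt.
have dN : d <= complex.Im (u N).
  have := fS N; rewrite uE cImD cImN /d; move: Bf => /ltW; lra.
rewrite /sqmod (le_trans (_ : _ <= complex.Im (u N) ^+ 2))//.
  have i0 : 0 <= complex.Im (u N) by exact: le_trans (ltW d0) dN.
  by rewrite ler_pXn2r ?nnegrE// ltW.
by rewrite lerDr sqr_ge0.
Qed.

(** In the application to traces, B is the energy of the trace plus an
    approximation error, which bounds partial sums; hence this form. *)
Lemma energy_smooth w B : csmooth w ->
  (forall N, pi * \sum_(n < N) n.+1%:R * sqmod (fourier_coef (w \o circ) n.+1%:Z) <= B) ->
  normsq leb2 disc (cdel w) <= normsq leb2 disc (cdelbar w) + B.
Proof.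
move=> sw /(boundary_form_le (csmooth_cC1 sw)).
by rewrite -energy_boundary// lerBlDl.
Qed.

End Chernoff.

(** * Traces and convergence in mean *)

Section NonnegativeSeries.
Context {R : realType}.
Implicit Types (u : nat -> R) (M : R).

Lemma nnseries_le u M : (forall n, 0 <= u n) ->
  (forall n, \sum_(i < n) u i <= M) -> (\sum_(0 <= i <oo) (u i)%:E <= M%:E)%E.
Proof.
move=> u0 uM; apply: lime_le.
  by apply: is_cvg_nneseries => n _ _; rewrite lee_fin.
by apply: nearW => n; rewrite big_mkord sumEFin lee_fin.
Qed.

Lemma nnseries_ge u n : (forall n, 0 <= u n) ->
  ((\sum_(i < n) u i)%:E <= \sum_(0 <= i <oo) (u i)%:E)%E.
Proof.
move=> u0; rewrite -sumEFin -(big_mkord xpredT (fun i => (u i)%:E)).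
by apply: nneseries_lim_ge => m _ _; rewrite lee_fin.
Qed.

Lemma esum_int (a : int -> R) : (forall k, 0 <= a k) ->
  (\esum_(k in [set: int]) (a k)%:E =
   \sum_(0 <= n <oo) (a n%:Z)%:E + \sum_(0 <= n <oo) (a (- n.+1%:Z))%:E)%E.
Proof.
move=> a0; rewrite (esumID (range Posz)); last by move=> k _; rewrite lee_fin.
rewrite !setTI (_ : ~` range Posz = range (fun n : nat => - n.+1%:Z)); last first.
  apply/seteqP; split=> [[n|n] /=|_ [n _ <-] [m _]].
  - by move=> /(_ (ex_intro2 _ _ n I erefl)).
  - by move=> _; exists n => //; rewrite NegzE.
  - lia.
congr (_ + _)%E.
- rewrite esum_image; last by move=> i j _ _ [].
  by rewrite nneseries_esumT// => n; rewrite lee_fin.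
- rewrite esum_image; last by move=> i j _ _ /oppr_inj [].
  by rewrite nneseries_esumT// => n; rewrite lee_fin.
Qed.

End NonnegativeSeries.

Section L2Convergence.
Context d (T : measurableType d) {R : realType}.
Variables (mu : {measure set T -> \bar R}) (D : set T).
Hypothesis mD : measurable D.
Implicit Types (u e : T -> R[i]) (U : nat -> T -> R[i]).

Lemma normsq_cvg U u : (forall n, inL2 mu D (U n)) -> inL2 mu D u ->
  (fun n => normsq mu D (fun x => U n x - u x)) @ \oo --> 0 ->
  (fun n => normsq mu D (U n)) @ \oo --> normsq mu D u.
Proof.
move=> hU hu U0.
have hd n : inL2 mu D (fun x => U n x - u x) by exact: inL2B.
have E n : normsq mu D (U n) = normsq mu D u +
    2 * complex.Re (inner mu D u (fun x => U n x - u x)) +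
    normsq mu D (fun x => U n x - u x).
  rewrite -normsqD//; congr (normsq _ _ _); apply/funext => x.
  by rewrite addrC subrK.
have Re0 : (fun n => complex.Re (inner mu D u (fun x => U n x - u x))) @ \oo --> 0.
  apply/cvgr0Pnorm_lt => e e0.
  have e2 : 0 < e ^+ 2 / (normsq mu D u + 1).
    by rewrite divr_gt0 ?exprn_gt0// ltr_wpDl// normsq_ge0.
  move/cvgr0Pnorm_lt : U0 => /(_ _ e2); apply: filterS => n.
  rewrite ger0_norm ?normsq_ge0// ltr_pdivlMr; last first.
    by rewrite ltr_wpDl// normsq_ge0.
  move=> Hn; rewrite -(@ltr_pXn2r _ 2) ?nnegrE ?normr_ge0 ?(ltW e0)//.
  rewrite real_normK ?num_real//.
  apply: (le_lt_trans (Re_inner_le mD hu (hd n))).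
  apply: le_lt_trans Hn; rewrite mulrC ler_wpM2l ?normsq_ge0// lerDl//.
have : (fun n => normsq mu D u +
    2 * complex.Re (inner mu D u (fun x => U n x - u x)) +
    normsq mu D (fun x => U n x - u x)) @ \oo --> normsq mu D u + 2 * 0 + 0.
  by apply: cvgD => //; apply: cvgD; [exact: cvg_cst|exact: cvgMr].
by rewrite mulr0 !addr0; under eq_fun do rewrite -E.
Qed.

Lemma inner_cvg U u e : (forall n, inL2 mu D (U n)) -> inL2 mu D u ->
  inL2 mu D e ->
  (fun n => normsq mu D (fun x => U n x - u x)) @ \oo --> 0 ->
  (fun n => sqmod (inner mu D (U n) e - inner mu D u e)) @ \oo --> 0.
Proof.
move=> hU hu he U0.
apply: (@squeeze_cvgr _ _ _ _ (fun=> 0) (fun n =>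
    normsq mu D (fun x => U n x - u x) * normsq mu D e)).
- apply: nearW => n; rewrite sqmod_ge0 -innerBl//=.
  by apply: sqmod_inner_le => //; exact: inL2B.
- exact: cvg_cst.
- by rewrite -(mul0r (normsq mu D e)); apply: cvgMl.
Qed.

Lemma normsq_cvgP U : (forall n, inL2 mu D (U n)) ->
  (fun n => L2sq mu D (U n)) @ \oo --> 0%E -> (fun n => normsq mu D (U n)) @ \oo --> 0.
Proof. by move=> hU /fine_cvg; exact. Qed.

End L2Convergence.

Section Traces.
Context {R : realType}.
Notation leb := (@lebesgue_measure R).
Implicit Types (u w : R * R -> R[i]) (g : R -> R[i]) (x y : R[i]).

Lemma sqmod_cvg_unique x y (p : nat -> R[i]) :
  (fun n => sqmod (p n - x)) @ \oo --> 0 ->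
  (fun n => sqmod (p n - y)) @ \oo --> 0 -> x = y.
Proof.
move=> px py; apply/eqP; rewrite -subr_eq0; apply/eqP; apply: sqmod_eq0.
apply/eqP; rewrite eq_le sqmod_ge0 andbT.
have H : (fun n => 2 * sqmod (p n - x) + 2 * sqmod (p n - y)) @ \oo --> (0 : R).
  rewrite (_ : 0 = 2 * 0 + 2 * 0 :> R); last by rewrite !mulr0 addr0.
  by apply: cvgD; apply: cvgMr.
rewrite -(cvg_lim _ H)//; apply: limr_ge; first by apply/cvg_ex; exists 0.
apply: nearW => n; have := le_sqmodD (x - p n) (p n - y).
by rewrite addrA subrK -[sqmod (x - p n)]sqmodN opprB.
Qed.

Lemma fourier_cvg (f : nat -> R -> R[i]) g k :
  (forall n, inL2 leb angles (f n)) -> inL2 leb angles g ->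
  (fun n => normsq leb angles (fun t => f n t - g t)) @ \oo --> 0 ->
  (fun n => sqmod (fourier_coef (f n) k - fourier_coef g k)) @ \oo --> 0.
Proof.
move=> hf hg fg.
have := inner_cvg (@measurable_angles R) hf hg (@cexp_inL2 R k) fg.
move=> H; under eq_fun do rewrite !fourierE -mulrBr sqmodM.
by rewrite -(mulr0 (sqmod ((2 * pi)^-1)%:C)); apply: cvgMr.
Qed.

Lemma wderive_inL2 u : inH1 u ->
  inL2 leb2 disc (wderive ex u) /\ inL2 leb2 disc (wderive ey u).
Proof.
move=> [_ hu]; split; rewrite /wderive.
- have [gx hx] := hu ex (or_introl erefl).
  have H : exists h, [set h | inL2 leb2 disc h /\ is_weak_derive ex u h] h.
    by exists gx.
  by have [] := xgetPex (fun=> 0) H.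
- have [gy hy] := hu ey (or_intror erefl).
  have H : exists h, [set h | inL2 leb2 disc h /\ is_weak_derive ey u h] h.
    by exists gy.
  by have [] := xgetPex (fun=> 0) H.
Qed.

Section Wirtinger.
Variables (a b : R * R -> R[i]).
Hypotheses (ha : inL2 leb2 disc a) (hb : inL2 leb2 disc b).
Let md := @measurable_disc R.

Lemma wirtinger_inL2 (c : R[i]) :
  inL2 leb2 disc (fun z => (a z + c * b z) / 2).
Proof.
have -> : (fun z => (a z + c * b z) / 2) = (fun z => 2^-1 * (a z + c * b z)).
  by apply/funext => z; rewrite mulrC.
by apply: inL2Z => //; apply: inL2D => //; exact: inL2Z.
Qed.

Lemma del_inL2 : inL2 leb2 disc (fun z => (a z - 'i%C * b z) / 2).
Proof.
have -> : (fun z => (a z - 'i%C * b z) / 2) = fun z => (a z + (- 'i%C) * b z) / 2.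
  by apply/funext => z; rewrite mulNr.
exact: wirtinger_inL2.
Qed.

(** Pointwise this is the parallelogram identity. *)
Lemma normsq_wirtinger :
  normsq leb2 disc (fun z => (a z - 'i%C * b z) / 2) +
  normsq leb2 disc (fun z => (a z + 'i%C * b z) / 2) =
  (normsq leb2 disc a + normsq leb2 disc b) / 2.
Proof.
have h1 := inL2_sqmod md del_inL2.
have h2 := inL2_sqmod md (wirtinger_inL2 'i%C).
have ha' := inL2_sqmod md ha.
have hb' := inL2_sqmod md hb.
rewrite /normsq -!/(Rintegral _ _ _) -!(RintegralD md)//.
rewrite -RintegralZr//; last exact: (integrableD md ha' hb').
apply: eq_Rintegral => z _.
rewrite complex_half sqmodM sqmodM sqmodR /sqmod !(cReD, cImD, cReN, cImN).
by rewrite Re_iM Im_iM; field.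
Qed.

Lemma normsq_del_le :
  normsq leb2 disc (fun z => (a z - 'i%C * b z) / 2) <=
  (normsq leb2 disc a + normsq leb2 disc b) / 2.
Proof. by rewrite -normsq_wirtinger lerDl normsq_ge0. Qed.

Lemma normsq_delbar_le :
  normsq leb2 disc (fun z => (a z + 'i%C * b z) / 2) <=
  (normsq leb2 disc a + normsq leb2 disc b) / 2.
Proof. by rewrite -normsq_wirtinger lerDr normsq_ge0. Qed.

End Wirtinger.

End Traces.

(** * The trace theorem and the energy inequality *)

(* Unfolding the choice of a weak derivative makes unification diverge. *)
Local Opaque wderive.

Section TraceTheorem.
Context {R : realType}.
Notation leb := (@lebesgue_measure R).
Variables (u : R * R -> R[i]) (g : R -> R[i]).
Hypotheses (hu : inH1 u) (tr : is_trace u g).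
Let md := @measurable_disc R.
Let ma := @measurable_angles R.
Let u2 : inL2 leb2 disc u. Proof. by case: hu. Qed.
Let g2 : inL2 leb angles g. Proof. by case: tr. Qed.

Lemma inL2_del : inL2 leb2 disc (del u).
Proof. exact: (del_inL2 (wderive_inL2 hu).1 (wderive_inL2 hu).2). Qed.

Lemma inL2_delbar : inL2 leb2 disc (delbar u).
Proof. exact: (wirtinger_inL2 (wderive_inL2 hu).1 (wderive_inL2 hu).2). Qed.

(** The convergences in the definition of the trace, restated for the Wirtinger
    derivatives. *)
Lemma trace_approx : exists w : nat -> R * R -> R[i],
  [/\ forall n, csmooth (w n),
      (fun n => normsq leb2 disc (fun z => w n z - u z)) @ \oo --> 0,
      (fun n => normsq leb2 disc (fun z => cdel (w n) z - del u z)) @ \oo --> 0,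
      (fun n => normsq leb2 disc (fun z => cdelbar (w n) z - delbar u z)) @ \oo --> 0
    & (fun n => normsq leb angles (fun t => (w n \o circ) t - g t)) @ \oo --> 0].
Proof.
have [_ [w [sw wu wx wy wg]]] := tr; exists w.
have cw m : cC1 (w m) by exact: csmooth_cC1.
have d0 n : inL2 leb2 disc (fun z => w n z - u z).
  by apply: inL2B => //; exact/disc_inL2/cC1_ccontinuous.
have dx n : inL2 leb2 disc (fun z => cderive ex (w n) z - wderive ex u z).
  exact: (inL2B md (disc_inL2 (ccontinuous_cderive ex (cw n))) (wderive_inL2 hu).1).
have dy n : inL2 leb2 disc (fun z => cderive ey (w n) z - wderive ey u z).
  exact: (inL2B md (disc_inL2 (ccontinuous_cderive ey (cw n))) (wderive_inL2 hu).2).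
have dg n : inL2 leb angles (fun t => (w n \o circ) t - g t).
  by apply: inL2B => //; exact/angles_inL2/ccontinuous_circ/cC1_ccontinuous.
have {}wx := normsq_cvgP dx wx.
have {}wy := normsq_cvgP dy wy.
have wxy : (fun n => (normsq leb2 disc (fun z => cderive ex (w n) z - wderive ex u z) +
    normsq leb2 disc (fun z => cderive ey (w n) z - wderive ey u z)) / 2) @ \oo --> (0 : R).
  have -> : 0 = (0 + 0) / 2 :> R by rewrite addr0 mul0r.
  exact: (cvgMl (cvgD wx wy)).
split=> //.
- exact: (normsq_cvgP d0 wu).
- apply: squeeze_cvgr wxy; last exact: cvg_cst.
  apply: nearW => n; rewrite normsq_ge0/=.
  have -> : (fun z => cdel (w n) z - del u z) = fun z =>
      ((cderive ex (w n) z - wderive ex u z) -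
       'i%C * (cderive ey (w n) z - wderive ey u z)) / 2.
    apply/funext => z; rewrite /cdel /del.
    move: (wderive ex u z) (wderive ey u z) (cderive ex _ z) (cderive ey _ z).
    by move=> p q r s; ring.
  exact: (normsq_del_le (dx n) (dy n)).
- apply: squeeze_cvgr wxy; last exact: cvg_cst.
  apply: nearW => n; rewrite normsq_ge0/=.
  have -> : (fun z => cdelbar (w n) z - delbar u z) = fun z =>
      ((cderive ex (w n) z - wderive ex u z) +
       'i%C * (cderive ey (w n) z - wderive ey u z)) / 2.
    apply/funext => z; rewrite /cdelbar /delbar.
    move: (wderive ex u z) (wderive ey u z) (cderive ex _ z) (cderive ey _ z).
    by move=> p q r s; ring.
  exact: (normsq_delbar_le (dx n) (dy n)).
- exact: (normsq_cvgP dg wg).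
Qed.

Lemma sqmod_cvgM (c : R[i]) (p : nat -> R[i]) (q : R[i]) :
  (fun n => sqmod (p n - q)) @ \oo --> 0 ->
  (fun n => sqmod (c * p n - c * q)) @ \oo --> 0.
Proof.
move=> pq; under eq_fun do rewrite -mulrBr sqmodM.
by rewrite -(mulr0 (sqmod c)); apply: cvgMr.
Qed.

(** Both sides are continuous for the convergences of the approximation, and the
    identity holds for smooth functions. *)
Lemma inner_del n : inner leb2 disc (del u) (fun z => zc z ^+ n) =
  pi%:C * fourier_coef g n.+1%:Z.
Proof.
have [w [sw wu wd wdb wg]] := trace_approx.
have cw m : cC1 (w m) by exact: csmooth_cC1.
apply: (@sqmod_cvg_unique _ _ _ (fun m => pi%:C * fourier_coef (w m \o circ) n.+1%:Z)).
  under eq_fun do rewrite -inner_cdel//.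
  apply: inner_cvg => //; first by move=> m; exact/disc_inL2/ccontinuous_cdel.
  - exact: inL2_del.
  - exact: zcX_inL2.
apply: sqmod_cvgM; apply: fourier_cvg => // m.
exact/angles_inL2/ccontinuous_circ/cC1_ccontinuous.
Qed.

Lemma inner_delbar n : inner leb2 disc (delbar u) (fun z => conjc (zc z ^+ n)) =
  pi%:C * fourier_coef g (- n.+1%:Z).
Proof.
have [w [sw wu wd wdb wg]] := trace_approx.
have cw m : cC1 (w m) by exact: csmooth_cC1.
apply: (@sqmod_cvg_unique _ _ _ (fun m => pi%:C * fourier_coef (w m \o circ) (- n.+1%:Z))).
  under eq_fun do rewrite -inner_cdelbar//.
  apply: inner_cvg => //; first by move=> m; exact/disc_inL2/ccontinuous_cdelbar.
  - exact: inL2_delbar.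
  - exact: zcXJ_inL2.
apply: sqmod_cvgM; apply: fourier_cvg => // m.
exact/angles_inL2/ccontinuous_circ/cC1_ccontinuous.
Qed.

Lemma fourier0_trace : pi%:C * fourier_coef g 0 =
  inner leb2 disc u (fun z => zc z ^+ 0) +
  inner leb2 disc (del u) (fun z => conjc (zc z ^+ 1)).
Proof.
have [w [sw wu wd wdb wg]] := trace_approx.
have cw m : cC1 (w m) by exact: csmooth_cC1.
apply: (@sqmod_cvg_unique _ _ _ (fun m => pi%:C * fourier_coef (w m \o circ) 0)).
  apply: sqmod_cvgM; apply: fourier_cvg => // m.
  exact/angles_inL2/ccontinuous_circ/cC1_ccontinuous.
have c1 : (fun m => sqmod (inner leb2 disc (w m) (fun z => zc z ^+ 0) -
    inner leb2 disc u (fun z => zc z ^+ 0))) @ \oo --> 0.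
  apply: inner_cvg => //; last exact: zcX_inL2.
  by move=> m; exact/disc_inL2/cC1_ccontinuous.
have c2 : (fun m => sqmod (inner leb2 disc (cdel (w m)) (fun z => conjc (zc z ^+ 1)) -
    inner leb2 disc (del u) (fun z => conjc (zc z ^+ 1)))) @ \oo --> 0.
  apply: inner_cvg => //; first by move=> m; exact/disc_inL2/ccontinuous_cdel.
  - exact: inL2_del.
  - exact: zcXJ_inL2.
have c12 : (fun m => 2 * sqmod (inner leb2 disc (w m) (fun z => zc z ^+ 0) -
    inner leb2 disc u (fun z => zc z ^+ 0)) +
    2 * sqmod (inner leb2 disc (cdel (w m)) (fun z => conjc (zc z ^+ 1)) -
    inner leb2 disc (del u) (fun z => conjc (zc z ^+ 1)))) @ \oo --> (0 : R).
  rewrite (_ : 0 = 2 * 0 + 2 * 0 :> R); last by rewrite !mulr0 addr0.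
  by apply: cvgD; apply: cvgMr.
apply: squeeze_cvgr c12; last exact: cvg_cst.
apply: nearW => m; rewrite sqmod_ge0/= fourier0_circ//.
apply: le_trans (le_sqmodD _ _); rewrite le_eqVlt; apply/orP; left; apply/eqP.
congr sqmod.
have -> : (fun=> 1) = (fun z : R * R => zc z ^+ 0) by [].
have -> : (fun z : R * R => conjc (zc z)) = (fun z => conjc (zc z ^+ 1)) by [].
ring.
Qed.

Let H k := Num.sqrt (1 + k%:~R ^+ 2) * sqmod (fourier_coef g k).

Let H_ge0 k : 0 <= H k.
Proof. by rewrite mulr_ge0// ?sqrtr_ge0 ?sqmod_ge0. Qed.

Lemma positive_frequencies N :
  pi * \sum_(n < N) n.+1%:R * sqmod (fourier_coef g n.+1%:Z) <= normsq leb2 disc (del u).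
Proof.
apply: (@bessel_disc _ (del u) (fun n => fourier_coef g n%:Z)); first exact: inL2_del.
by move=> n; exact: inner_del.
Qed.

Lemma negative_frequencies N :
  pi * \sum_(n < N) n.+1%:R * sqmod (fourier_coef g (- n.+1%:Z)) <=
  normsq leb2 disc (delbar u).
Proof.
apply: (@bessel_discJ _ (delbar u) (fun n => fourier_coef g (- n%:Z))).
  exact: inL2_delbar.
by move=> n; exact: inner_delbar.
Qed.

Lemma zero_frequency :
  pi * sqmod (fourier_coef g 0) <=
  2 * (normsq leb2 disc u + normsq leb2 disc (del u)).
Proof.
have p0 := pi_gt0 R.
have := le_sqmodD (inner leb2 disc u (fun z => zc z ^+ 0))
  (inner leb2 disc (del u) (fun z => conjc (zc z ^+ 1))).
rewrite -fourier0_trace sqmodM sqmodR => /le_trans E.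
have n1 : normsq leb2 disc (fun z : R * R => zc z ^+ 0) = pi.
  have := innerE md (@zcX_inL2 R 0); rewrite inner_zcX eqxx => -[<-].
  by rewrite divr1.
have n2 : normsq leb2 disc (fun z : R * R => conjc (zc z ^+ 1)) = pi / 2.
  by have := innerE md (@zcXJ_inL2 R 1); rewrite inner_zcXJ eqxx => -[<-].
have I1 := sqmod_inner_le md u2 (@zcX_inL2 R 0).
have I2 := sqmod_inner_le md inL2_del (@zcXJ_inL2 R 1).
rewrite -(ler_pM2l p0) mulrA -expr2; apply: E.
rewrite n1 in I1; rewrite n2 in I2.
have := normsq_ge0 leb2 disc (del u).
move: I1 I2; set A := normsq _ _ _; set B := normsq _ _ _ => I1 I2 B0.
have : 0 <= pi * B by rewrite mulr_ge0// ltW.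
move: (@pi R) I1 I2 => p; lra.
Qed.

Lemma sqrt_frequency (n : nat) : Num.sqrt (1 + (n.+1%:R : R) ^+ 2) <= 2 * n.+1%:R.
Proof.
have n0 : (1 : R) <= n.+1%:R by rewrite ler1n.
rewrite -(@ler_pXn2r _ 2) ?nnegrE ?sqrtr_ge0 ?mulr_ge0//.
rewrite sqr_sqrtr; last by rewrite addr_ge0// sqr_ge0.
by move: (n.+1%:R : R) n0 => x x1; nra.
Qed.

(** The derivatives del u and delbar u control the positive and the negative
    frequencies by Bessel's inequality; the mean is bounded by u and del u. *)
Lemma Hhalfsq_le : (Hhalfsq g <=
  ((6 / pi) * (normsq leb2 disc u + normsq leb2 disc (wderive ex u) +
    normsq leb2 disc (wderive ey u)))%:E)%E.
Proof.
have arith (x y z a b : R) : 0 <= x -> 0 <= y -> 0 <= z -> x + y = (a + b) / 2 ->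
    2 * (z + x) + 2 * x + 2 * y <= 6 * (z + a + b) by lra.
have p0 := pi_gt0 R.
set X := normsq leb2 disc (del u); set Y := normsq leb2 disc (delbar u).
set U := normsq leb2 disc u.
have XY : X + Y = (normsq leb2 disc (wderive ex u) + normsq leb2 disc (wderive ey u)) / 2.
  exact: (normsq_wirtinger (wderive_inL2 hu).1 (wderive_inL2 hu).2).
have X0 : 0 <= X := normsq_ge0 _ _ _.
have Y0 : 0 <= Y := normsq_ge0 _ _ _.
have U0 : 0 <= U := normsq_ge0 _ _ _.
have H0 : H 0 = sqmod (fourier_coef g 0) by rewrite /H expr0n/= addr0 sqrtr1 mul1r.
have z0 := zero_frequency.
have S1 : (\sum_(0 <= n <oo) (H n%:Z)%:E <= ((2 * (U + X) + 2 * X) / pi)%:E)%E.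
  apply: nnseries_le => // -[|N].
    rewrite big_ord0; apply: divr_ge0; last exact: ltW.
    by apply: addr_ge0; apply: mulr_ge0 => //; exact: addr_ge0.
  rewrite big_ord_recl/= H0 ler_pdivlMr// mulrC mulrDr lerD//.
  rewrite mulr_sumr.
  apply: le_trans (_ : 2 * (pi * \sum_(n < N) n.+1%:R * sqmod (fourier_coef g n.+1%:Z)) <= _).
    rewrite !mulr_sumr; apply: ler_sum => n _.
    rewrite [leRHS]mulrCA ler_pM2l// [leRHS]mulrA /H ler_wpM2r ?sqmod_ge0//.
    exact: sqrt_frequency.
  by rewrite ler_pM2l//; exact: positive_frequencies.
have S2 : (\sum_(0 <= n <oo) (H (- n.+1%:Z))%:E <= ((2 * Y) / pi)%:E)%E.
  apply: nnseries_le => // N.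
  rewrite ler_pdivlMr// mulrC mulr_sumr.
  apply: le_trans (_ : 2 * (pi * \sum_(n < N) n.+1%:R * sqmod (fourier_coef g (- n.+1%:Z))) <= _).
    rewrite !mulr_sumr; apply: ler_sum => n _.
    rewrite [leRHS]mulrCA ler_pM2l// [leRHS]mulrA /H ler_wpM2r ?sqmod_ge0//.
    by rewrite mulrNz sqrrN; exact: sqrt_frequency.
  by rewrite ler_pM2l//; exact: negative_frequencies.
rewrite /Hhalfsq (esum_int H_ge0); apply: (le_trans (leeD S1 S2)).
rewrite -EFinD lee_fin -mulrDl mulrAC ler_pM2r ?invr_gt0//.
exact: (arith _ _ _ _ _ X0 Y0 U0 XY).
Qed.

Lemma Hhalfsq_ge0 : (0 <= Hhalfsq g)%E.
Proof. by apply: esum_ge0 => k _; rewrite lee_fin; exact: H_ge0. Qed.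

Lemma Hhalfsq_fin : Hhalfsq g \is a fin_num.
Proof.
rewrite ge0_fin_numE; last exact: Hhalfsq_ge0.
exact: le_lt_trans Hhalfsq_le (ltry _).
Qed.

Lemma positive_frequencies_le N :
  \sum_(n < N) n.+1%:R * sqmod (fourier_coef g n.+1%:Z) <= fine (Hhalfsq g).
Proof.
rewrite -lee_fin fineK ?Hhalfsq_fin// /Hhalfsq (esum_int H_ge0).
apply: (@le_trans _ _ (\sum_(i < N.+1) H i%:Z)%:E).
  rewrite lee_fin big_ord_recl -[leLHS]add0r lerD//; apply: ler_sum => n _.
  rewrite /H ler_wpM2r ?sqmod_ge0//= -[leLHS]ger0_norm// -sqrtr_sqr.
  by rewrite ler_sqrt ?addr_ge0 ?sqr_ge0// lerDr.
apply: (le_trans (nnseries_ge N.+1 (fun n : nat => H_ge0 n%:Z))).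
by rewrite leeDl// nneseries_ge0// => n _ _; rewrite lee_fin.
Qed.

Lemma sqmod_young (x y : R[i]) (t : R) : 0 < t ->
  sqmod x <= (1 + t) * sqmod y + (1 + t^-1) * sqmod (x - y).
Proof.
move=> t0; have t1 : 0 < t^-1 by rewrite invr_gt0.
have E : (1 + t) * sqmod y + (1 + t^-1) * sqmod (x - y) - sqmod x =
    t^-1 * sqmod (t%:C * y - (x - y)).
  rewrite /sqmod !(cReD, cImD, cReN, cImN) !ReZl !ImZl.
  by field; rewrite gt_eqF.
by rewrite -subr_ge0 E mulr_ge0 ?sqmod_ge0// ltW.
Qed.

(** The inequality holds for smooth w n with the positive-frequency energy of
    its own boundary values on the right. The latter differ from g by functions
    whose energy is at most dl n, again by Bessel's inequality for w n - u; Young's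
    inequality with an arbitrary parameter t absorbs this error in the limit. *)
Lemma energy_trace :
  normsq leb2 disc (del u) <= normsq leb2 disc (delbar u) + pi * fine (Hhalfsq g).
Proof.
have p0 := pi_gt0 R.
have [w [sw wu wd wdb wg]] := trace_approx.
have cw m : cC1 (w m) by exact: csmooth_cC1.
set h := fine (Hhalfsq g).
have h0 : 0 <= h by rewrite fine_ge0// Hhalfsq_ge0.
have w2 n : inL2 leb2 disc (cdel (w n)) by exact/disc_inL2/ccontinuous_cdel.
have w2b n : inL2 leb2 disc (cdelbar (w n)) by exact/disc_inL2/ccontinuous_cdelbar.
pose dl n := normsq leb2 disc (fun z => cdel (w n) z - del u z).
have step t n : 0 < t ->
    normsq leb2 disc (cdel (w n)) <= normsq leb2 disc (cdelbar (w n)) +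
      ((1 + t) * (pi * h) + (1 + t^-1) * dl n).
  move=> t0; apply: energy_smooth => // N.
  have t1 : 0 < t^-1 by rewrite invr_gt0.
  apply: (@le_trans _ _ ((1 + t) *
      (pi * \sum_(i < N) i.+1%:R * sqmod (fourier_coef g i.+1%:Z)) + (1 + t^-1) *
      (pi * \sum_(i < N) i.+1%:R *
        sqmod (fourier_coef (w n \o circ) i.+1%:Z - fourier_coef g i.+1%:Z)))).
    rewrite !mulr_sumr -big_split/=; apply: ler_sum => i _.
    set x := fourier_coef (w n \o circ) _; set y := fourier_coef g _.
    rewrite [leRHS](_ : _ = pi * i.+1%:R *
      ((1 + t) * sqmod y + (1 + t^-1) * sqmod (x - y))).
      by rewrite -mulrA ler_pM2l// ler_pM2l//; exact: sqmod_young.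
    by move: (@pi R) => p; ring.
  apply: lerD; rewrite ler_pM2l ?addr_gt0//.
    by rewrite ler_pM2l//; exact: positive_frequencies_le.
  apply: (@bessel_disc _ (fun z => cdel (w n) z - del u z)
    (fun k => fourier_coef (w n \o circ) k%:Z - fourier_coef g k%:Z)).
    by apply: inL2B => //; exact: inL2_del.
  move=> k; rewrite innerBl//; [|exact: inL2_del|exact: zcX_inL2].
  by rewrite inner_del inner_cdel// mulrBr.
have lim1 := normsq_cvg md w2 inL2_del wd.
have lim2 := normsq_cvg md w2b inL2_delbar wdb.
have lim t : 0 < t -> normsq leb2 disc (del u) <=
    normsq leb2 disc (delbar u) + ((1 + t) * (pi * h) + (1 + t^-1) * 0).
  move=> t0; apply: (ler_cvg_to lim1 _ (nearW _ (fun n => step t n t0))).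
  by apply: cvgD => //; apply: cvgD; [exact: cvg_cst|exact: cvgMr].
apply/ler_addgt0Pr => e e0.
have d0 : 0 < pi * h + 1 by rewrite ltr_wpDl// mulr_ge0// ltW.
have t0 : 0 < e / (pi * h + 1) by rewrite divr_gt0.
apply: (le_trans (lim _ t0)); rewrite -addrA lerD2l mulr0 addr0 mulrDl mul1r lerD2l.
rewrite mulrAC ler_pdivrMr// ler_pM2l//; lra.
Qed.

End TraceTheorem.

(** * Iterating the energy inequality *)

Section RealSequences.
Context {R : realType}.
Implicit Types (x y f G : nat -> R).

Lemma sum_cauchy_schwarz n x y :
  \sum_(j < n) x j * y j <=
  Num.sqrt (\sum_(j < n) x j ^+ 2) * Num.sqrt (\sum_(j < n) y j ^+ 2).
Proof.
elim: n => [|n ih]; first by rewrite !big_ord0 sqrtr0 mulr0.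
rewrite !big_ord_recr/=.
set A := \sum_(j < n) x j ^+ 2; set B := \sum_(j < n) y j ^+ 2.
have A0 : 0 <= A by apply: sumr_ge0 => j _; exact: sqr_ge0.
have B0 : 0 <= B by apply: sumr_ge0 => j _; exact: sqr_ge0.
apply: (le_trans (lerD ih (lexx _))); rewrite -/A -/B.
have pA : 0 <= Num.sqrt A by exact: sqrtr_ge0.
have pB : 0 <= Num.sqrt B by exact: sqrtr_ge0.
rewrite -{2}[A]sqr_sqrtr// -{2}[B]sqr_sqrtr//.
move: (Num.sqrt A) (Num.sqrt B) pA pB (x n) (y n) => p q p0 q0 a b.
rewrite -sqrtrM ?addr_ge0 ?sqr_ge0//; apply: (le_trans (ler_norm _)).
rewrite -sqrtr_sqr ler_sqrt ?mulr_ge0 ?addr_ge0 ?sqr_ge0//.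
have := sqr_ge0 (p * b - q * a); nra.
Qed.

Definition jweight (j : nat) : R := Num.sqrt (1 + j%:R ^+ 2).

Lemma jweight_sqr j : jweight j ^+ 2 = 1 + j%:R ^+ 2.
Proof. by rewrite sqr_sqrtr// addr_ge0// sqr_ge0. Qed.

Lemma jweight_ge0 j : 0 <= jweight j.
Proof. exact: sqrtr_ge0. Qed.

Lemma jweight_ge1 j : 1 <= jweight j.
Proof. by rewrite -sqrtr1 ler_sqrt ?lerDl ?sqr_ge0// addr_ge0// sqr_ge0. Qed.

(** This comparison is where the weight (1 + j ^+ 2) `^ (1 / 2) of the space comes
    from: summing over the steps j, j + 2, j + 4, and then over j counts the
    index j exactly j./2 + 1 times. *)
Lemma half_le_jweight j : (j.+2./2)%:R <= jweight j.
Proof.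
have -> : (j.+2./2)%:R = 1 + (j./2)%:R :> R by rewrite /= -natr1 addrC.
rewrite -[leLHS]ger0_norm ?addr_ge0// -sqrtr_sqr ler_sqrt ?addr_ge0 ?sqr_ge0//.
have h : ((1 + j./2) ^ 2 <= 1 + j ^ 2)%N.
  have := odd_double_half j; rewrite -muln2; nia.
by move: h; rewrite -(ler_nat R) natrX !natrD natrX.
Qed.

(** Summation by parts with the weights j./2, whose increments from j to j + 2
    equal one. *)
Lemma half_weights_sum (X T : nat -> R) N : (forall j, X j <= X j.+2 + T j) ->
  \sum_(j < N) X j <= \sum_(j < N) (j.+2./2)%:R * T j +
    ((N./2)%:R * X N + (N.+1./2)%:R * X N.+1).
Proof.
move=> XT; elim: N => [|N ih].
  by rewrite !big_ord0 /= !mul0r !addr0.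
rewrite !big_ord_recr/=; apply: (le_trans (lerD ih (lexx _))).
have E : (N.+2./2)%:R = (N./2)%:R + 1 :> R by rewrite /= -natr1.
have := ler_wpM2l (ler0n R N.+2./2) (XT N).
rewrite E.
move: (\sum_(j < N) _) => S; lra.
Qed.

(** Here x j, f j and G j stand for the norms of del v_j and of the right-hand
    side, and for the squared trace norm. The boundary terms of the summation by
    parts vanish in the limit because x is square-summable with weights; in the
    cross terms the weight is put on f, whence the weight jweight j ^+ 2 for f. *)
Lemma iterated_energy x f G (S Gam Phi M : R) :
  (forall j, 0 <= x j) -> (forall j, 0 <= f j) -> (forall j, 0 <= G j) ->
  (forall j, x j ^+ 2 <= (x j.+2 + f j) ^+ 2 + pi * G j) ->
  (fun n => \sum_(j < n) x j ^+ 2) @ \oo --> S ->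
  (forall n, \sum_(j < n) x j ^+ 2 <= S) ->
  (forall n, \sum_(j < n) jweight j * x j ^+ 2 <= M) ->
  (forall n, \sum_(j < n) jweight j * G j <= Gam) ->
  (forall n, \sum_(j < n) jweight j ^+ 2 * f j ^+ 2 <= Phi) ->
  S <= pi * Gam + 2 * (Num.sqrt S * Num.sqrt Phi) + Phi.
Proof.
move=> x0 f0 G0 xfG cS uS uM uG uF.
have p0 : 0 <= pi :> R by exact: pi_ge0.
pose X j := x j ^+ 2.
pose T j := pi * G j + 2 * (x j.+2 * f j) + f j ^+ 2.
have X0 j : 0 <= X j by exact: sqr_ge0.
have XT j : X j <= X j.+2 + T j.
  by apply: (le_trans (xfG j)); rewrite /X /T le_eqVlt; apply/orP; left; apply/eqP; ring.
have w0 := jweight_ge0; have w1 := jweight_ge1; have hw := half_le_jweight.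
have T0 j : 0 <= T j.
  apply: addr_ge0; last exact: sqr_ge0.
  by apply: addr_ge0; apply: mulr_ge0 => //; exact: mulr_ge0.
have main N : \sum_(j < N) (j.+2./2)%:R * T j <=
    pi * Gam + 2 * (Num.sqrt S * Num.sqrt Phi) + Phi.
  apply: (@le_trans _ _ (\sum_(j < N) (pi * (jweight j * G j) +
      2 * (x j.+2 * (jweight j * f j)) + jweight j ^+ 2 * f j ^+ 2))).
    apply: ler_sum => j _; apply: (@le_trans _ _ (jweight j * T j)).
      by rewrite ler_wpM2r.
    rewrite /T !mulrDr; apply: lerD.
      by rewrite le_eqVlt; apply/orP; left; apply/eqP; move: (@pi R) => p; ring.
    by rewrite ler_wpM2r ?sqr_ge0// expr2 ler_peMl.
  rewrite !big_split/= -!mulr_sumr; apply: lerD; last exact: uF.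
  apply: lerD; first by apply: ler_wpM2l => //; exact: uG.
  rewrite ler_pM2l//.
  apply: (le_trans (@sum_cauchy_schwarz N (fun j => x j.+2) (fun j => jweight j * f j))).
  have S0 : 0 <= S by have := uS 0%N; rewrite big_ord0.
  have P0 : 0 <= Phi by have := uF 0%N; rewrite big_ord0.
  apply: ler_pM; rewrite ?sqrtr_ge0// ler_sqrt//.
    apply: le_trans (uS N.+2); rewrite !big_ord_recl/= addrA -[leLHS]add0r.
    by rewrite lerD// addr_ge0// sqr_ge0.
  by apply: le_trans (uF N); apply: ler_sum => j _; rewrite exprMn.
have tail0 : (fun N => jweight N * X N) @ \oo --> 0.
  by apply: (@bounded_sum_cvg0 _ _ M) => // n; rewrite mulr_ge0.
have tail1 : (fun N => jweight N.+1 * X N.+1) @ \oo --> 0.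
  by rewrite -(cvg_shiftS (fun N => jweight N * X N)) in tail0.
have cR : (fun N => pi * Gam + 2 * (Num.sqrt S * Num.sqrt Phi) + Phi +
    (jweight N * X N + jweight N.+1 * X N.+1)) @ \oo -->
    pi * Gam + 2 * (Num.sqrt S * Num.sqrt Phi) + Phi + (0 + 0).
  by apply: cvgD; [exact: cvg_cst|exact: cvgD].
rewrite -[leRHS]addr0 -[X in _ + X]addr0.
apply: (ler_cvg_to cS cR); apply: nearW => N.
apply: (le_trans (half_weights_sum N XT)); apply: lerD => //.
have hwN j : (j./2)%:R <= jweight j.
  by apply: le_trans (hw j); rewrite ler_nat /= leqnSn.
by apply: lerD; rewrite ler_wpM2r.
Qed.

(** The bound of the operator and Poincare's inequality give
    2 * beta ^+ 2 <= eps ^+ 2 * (X ^+ 2 + G ^+ 2), so both the linear and the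
    quadratic term in the right-hand side f of the iterated inequality are
    expressed through X, G and phi. *)
Lemma closing_estimate (mu CB eps X G phi beta nu Gam : R) :
  0 <= eps -> eps ^+ 2 = 2 * mu * CB ^+ 2 -> 0 <= CB ->
  0 <= X -> 0 <= G -> 0 <= phi -> 0 <= beta -> 0 <= nu ->
  beta <= CB * nu -> nu ^+ 2 <= mu * (X ^+ 2 + G ^+ 2) ->
  X ^+ 2 <= Gam +
    2 * (Num.sqrt (X ^+ 2) * Num.sqrt (2 * beta ^+ 2 + 2 * phi ^+ 2)) +
    (2 * beta ^+ 2 + 2 * phi ^+ 2) ->
  (1 - 2 * eps - eps ^+ 2) * X ^+ 2 <=
  (2 * eps * G + 2 * Num.sqrt 2 * phi) * X +
    (eps ^+ 2 * G ^+ 2 + Gam + 2 * phi ^+ 2).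
Proof.
move=> eps0 eps2 CB0 X0 G0 phi0 beta0 nu0 bB pv.
set P := 2 * beta ^+ 2 + 2 * phi ^+ 2; rewrite sqrtr_sqr ger0_norm// => iter.
have PE : P <= eps ^+ 2 * (X ^+ 2 + G ^+ 2) + 2 * phi ^+ 2.
  rewrite /P lerD2r eps2; apply: (@le_trans _ _ (2 * (CB * nu) ^+ 2)).
    by rewrite ler_pM2l// ler_pXn2r ?nnegrE// mulr_ge0.
  rewrite exprMn (_ : 2 * mu * CB ^+ 2 * (X ^+ 2 + G ^+ 2) =
    2 * (CB ^+ 2 * (mu * (X ^+ 2 + G ^+ 2)))); last by ring.
  by rewrite ler_pM2l//; apply: ler_wpM2l; [exact: sqr_ge0|exact: pv].
have h1 : 0 <= eps * X by rewrite mulr_ge0.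
have h2 : 0 <= eps * G by rewrite mulr_ge0.
have h3 : 0 <= Num.sqrt 2 * phi by rewrite mulr_ge0 ?sqrtr_ge0.
have QE : Num.sqrt P <= eps * X + eps * G + Num.sqrt 2 * phi.
  have s0 := addr_ge0 (addr_ge0 h1 h2) h3.
  rewrite -[leRHS]ger0_norm// -sqrtr_sqr ler_sqrt ?sqr_ge0//.
  apply: (le_trans PE).
  have h4 : (Num.sqrt 2 * phi) ^+ 2 = 2 * phi ^+ 2 by rewrite exprMn sqr_sqrtr.
  rewrite -h4 mulrDr -!exprMn.
  move: (eps * X) (eps * G) (Num.sqrt 2 * phi) h1 h2 h3 => p q r p0 q0 r0.
  by have := mulr_ge0 p0 q0; have := mulr_ge0 p0 r0; have := mulr_ge0 q0 r0; nra.
have := ler_wpM2l X0 QE; move: (Num.sqrt P) (Num.sqrt 2) iter PE => Q s; nra.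
Qed.

Lemma quadratic_bound (a b c X : R) : 0 < a -> a * X ^+ 2 <= b * X + c ->
  X <= (b + Num.sqrt (b ^+ 2 + 4 * a * c)) / (2 * a).
Proof.
move=> a0 H; rewrite ler_pdivlMr ?mulr_gt0// -lerBlDl.
have D : (2 * a * X - b) ^+ 2 <= b ^+ 2 + 4 * a * c by nra.
have D0 : 0 <= b ^+ 2 + 4 * a * c by apply: le_trans D; exact: sqr_ge0.
apply: (le_trans (ler_norm _)); rewrite -sqrtr_sqr ler_sqrt//.
by rewrite (_ : X * (2 * a) = 2 * a * X)// mulrC.
Qed.

End RealSequences.

Section WeightedSequences.
Context {R : realType}.
Implicit Types (a : nat -> R) (p : R).

Lemma wsumE p (N : nat -> \bar R) a : (forall j, N j = (a j)%:E) ->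
  wsum p N = (\sum_(0 <= j <oo) ((1 + j%:R ^+ 2) `^ p * a j)%:E)%E.
Proof. by move=> Na; apply: eq_eseriesr => j _; rewrite Na -EFinM. Qed.

Lemma wsum_partial p (N : nat -> \bar R) a n :
  (forall j, N j = (a j)%:E) -> (forall j, 0 <= a j) -> (wsum p N < +oo)%E ->
  \sum_(j < n) (1 + j%:R ^+ 2) `^ p * a j <= fine (wsum p N).
Proof.
move=> Na a0 fN.
have t0 j : 0 <= (1 + j%:R ^+ 2) `^ p * a j by rewrite mulr_ge0// powR_ge0.
have w0 : (0 <= wsum p N)%E.
  by rewrite (wsumE p Na); apply: nneseries_ge0 => j _ _; rewrite lee_fin.
rewrite -lee_fin fineK ?ge0_fin_numE// (wsumE p Na).
exact: (nnseries_ge n t0).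
Qed.

Lemma wsum_le p (N : nat -> \bar R) a M :
  (forall j, N j = (a j)%:E) -> (forall j, 0 <= a j) ->
  (forall n, \sum_(j < n) (1 + j%:R ^+ 2) `^ p * a j <= M) ->
  (wsum p N <= M%:E)%E.
Proof.
move=> Na a0 aM; rewrite (wsumE p Na); apply: nnseries_le => // j.
by rewrite mulr_ge0// powR_ge0.
Qed.

Lemma wsum_ge0 p (N : nat -> \bar R) : (forall j, 0 <= N j)%E -> (0 <= wsum p N)%E.
Proof.
move=> N0; apply: nneseries_ge0 => j _ _.
by apply: mule_ge0 => //; rewrite lee_fin powR_ge0.
Qed.

Lemma wsum_cvg p (N : nat -> \bar R) a :
  (forall j, N j = (a j)%:E) -> (forall j, 0 <= a j) -> (wsum p N < +oo)%E ->
  (fun n => \sum_(j < n) (1 + j%:R ^+ 2) `^ p * a j) @ \oo --> fine (wsum p N).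
Proof.
move=> Na a0 fN.
have t0 j : 0 <= (1 + j%:R ^+ 2) `^ p * a j by rewrite mulr_ge0// powR_ge0.
have w0 : (0 <= wsum p N)%E by apply: wsum_ge0 => j; rewrite Na lee_fin.
have : (fun n => \sum_(0 <= j < n) ((1 + j%:R ^+ 2) `^ p * a j)%:E)%E @ \oo -->
    (fine (wsum p N))%:E.
  rewrite fineK ?ge0_fin_numE// (wsumE p Na).
  by apply: is_cvg_nneseries => j _ _; rewrite lee_fin.
move/fine_cvg; apply: cvg_trans; apply: near_eq_cvg; apply: nearW => n /=.
by rewrite big_mkord sumEFin.
Qed.

Lemma powR_half (j : nat) : (1 + (j%:R : R) ^+ 2) `^ (1 / 2) = jweight j.
Proof. by rewrite div1r powR12_sqrt// addr_ge0// sqr_ge0. Qed.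

Lemma powR_one (j : nat) : (1 + (j%:R : R) ^+ 2) `^ 1 = jweight j ^+ 2.
Proof. by rewrite jweight_sqr powRr1// addr_ge0// sqr_ge0. Qed.

End WeightedSequences.

(** * The gradient estimate *)

Section SpacesOfSequences.
Context {R : realType}.
Implicit Types (u w : R * R -> R[i]).

Definition h1sq u : R := normsq leb2 disc u +
  normsq leb2 disc (wderive ex u) + normsq leb2 disc (wderive ey u).

Lemma h1sq_ge0 u : 0 <= h1sq u.
Proof.
by apply: addr_ge0; [apply: addr_ge0|]; exact: normsq_ge0.
Qed.

Lemma H1sqE u : inH1 u -> H1sq u = (h1sq u)%:E.
Proof.
move=> hu; have md := @measurable_disc R.
rewrite /H1sq /h1sq !EFinD; congr (_ + _ + _)%E; first exact: (L2sqE md (proj1 hu)).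
- exact: (L2sqE md (wderive_inL2 hu).1).
- exact: (L2sqE md (wderive_inL2 hu).2).
Qed.

Lemma normsq_le_h1sq u : normsq leb2 disc u <= h1sq u.
Proof. by rewrite /h1sq -addrA lerDl addr_ge0// normsq_ge0. Qed.

Lemma normsq_del_le_h1sq u : inH1 u -> normsq leb2 disc (del u) <= h1sq u.
Proof.
have arith (p q r : R) : 0 <= p -> 0 <= q -> 0 <= r -> (q + r) / 2 <= p + q + r.
  by lra.
move=> hu.
apply: (le_trans (normsq_del_le (wderive_inL2 hu).1 (wderive_inL2 hu).2)).
exact: (arith _ _ _ (normsq_ge0 _ _ _) (normsq_ge0 _ _ _) (normsq_ge0 _ _ _)).
Qed.

Lemma ae_eq_normsq u w : cmeasurable (disc : set (@plane R)) u ->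
  cmeasurable (disc : set (@plane R)) w -> ae_eq_disc u w ->
  normsq leb2 disc u = normsq leb2 disc w.
Proof.
move=> mu_ mw uw; congr fine.
apply: ge0_ae_eq_integral.
- exact: measurable_disc.
- exact/measurable_EFinP/measurable_sqmod.
- exact/measurable_EFinP/measurable_sqmod.
- by move=> z _; rewrite lee_fin sqmod_ge0.
- by move=> z _; rewrite lee_fin sqmod_ge0.
- by apply: (negligibleS _ uw) => z /= uwz uw'; apply: uwz => Dz; rewrite uw'.
Qed.

End SpacesOfSequences.

Section EnergyEstimates.
Context {R : realType}.
Implicit Types (u w : R * R -> R[i]).
Let md := @measurable_disc R.

Lemma L2sq_ge0 u : (0 <= L2sq leb2 disc u)%E.
Proof. by apply: integral_ge0 => z _; rewrite lee_fin sqmod_ge0. Qed.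

Lemma norm_l2L2_sqr p (u : nat -> R * R -> R[i]) :
  norm_l2L2 p u ^+ 2 = fine (l2L2sq p u).
Proof.
rewrite sqr_sqrtr//; apply: fine_ge0; apply: wsum_ge0 => j; exact: L2sq_ge0.
Qed.

Lemma norm_l2Hhalf_sqr p (g : nat -> R -> R[i]) :
  norm_l2Hhalf p g ^+ 2 = fine (l2Hhalfsq p g).
Proof.
rewrite sqr_sqrtr//; apply: fine_ge0; apply: wsum_ge0 => j; exact: Hhalfsq_ge0.
Qed.

Lemma normsqD_le2 u w : inL2 leb2 disc u -> inL2 leb2 disc w ->
  normsq leb2 disc (fun z => u z + w z) <= 2 * normsq leb2 disc u + 2 * normsq leb2 disc w.
Proof.
move=> hu hw; have := normsqD_le md hu hw.
rewrite -(@ler_pXn2r _ 2) ?nnegrE ?addr_ge0 ?sqrtr_ge0// sqr_sqrtr ?normsq_ge0//.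
move/le_trans; apply.
have A := sqr_sqrtr (normsq_ge0 leb2 disc u).
have B := sqr_sqrtr (normsq_ge0 leb2 disc w).
rewrite -[X in 2 * X + _]A -[X in _ + 2 * X]B.
move: (Num.sqrt _) (Num.sqrt _) => p q.
have := sqr_ge0 (p - q); nra.
Qed.

(** One step of the iteration: w is the component two places after u, and the
    equation trades delbar u for del w. *)
Lemma energy_step u w (F : R * R -> R[i]) (g : R -> R[i]) :
  inH1 u -> inH1 w -> is_trace u g -> inL2 leb2 disc F ->
  ae_eq_disc (fun z => delbar u z + del w z) F ->
  normsq leb2 disc (del u) <=
  (Num.sqrt (normsq leb2 disc (del w)) + Num.sqrt (normsq leb2 disc F)) ^+ 2 +
  pi * fine (Hhalfsq g).
Proof.
move=> hu hw ug hF uwF.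
apply: (le_trans (energy_trace hu ug)); rewrite lerD2r.
have du := inL2_delbar hu; have dw := inL2_del hw.
have hs := inL2D md du dw.
have hN := inL2Z md (- 1) dw.
have E : delbar u = fun z => (delbar u z + del w z) + (- 1) * del w z.
  by apply/funext => z; rewrite mulN1r addrK.
have := normsqD_le md hs hN; rewrite -E normsqZ// sqmodN (sqmodR 1) expr1n mul1r.
rewrite (ae_eq_normsq _ _ uwF); [|by case: hs|by case: hF].
rewrite -(@ler_pXn2r _ 2) ?nnegrE ?addr_ge0 ?sqrtr_ge0// sqr_sqrtr ?normsq_ge0//.
by rewrite addrC.
Qed.

End EnergyEstimates.

Theorem theorem4p2 (R : realType)
    (mu : R) (mu_gt0 : 0 < mu) (poincare : poincare_constant mu)
    (f : nat -> R * R -> R[i]) (hf : in_l2L2 1 f)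
    (B : (nat -> R * R -> R[i]) -> nat -> R * R -> R[i])
    (linB : linear_operator B)
    (B_L2 : forall v, in_l2L2 0 v -> in_l2L2 1 (B v))
    (B_H1 : forall v, in_l2H1 0 v -> in_l2H1 1 (B v))
    (CB : R) (CB_gt0 : 0 < CB)
    (bound_L2 : forall v, in_l2L2 0 v ->
       norm_l2L2 1 (B v) <= CB * norm_l2L2 0 v)
    (bound_H1 : forall v, in_l2H1 0 v ->
       norm_l2H1 1 (B v) <= CB * norm_l2H1 0 v)
    (eps : R) (eps_def : eps = Num.sqrt (2 * mu) * CB)
    (eps_lt : eps < Num.sqrt 2 - 1)
    (v : nat -> R * R -> R[i]) (hv : in_l2H1 (1 / 2) v)
    (g : nat -> R -> R[i]) (hg : is_trace_seq v g)
    (v_solution : bukhgeim_beltrami B f v) :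
  let a := 1 - 2 * eps - eps ^+ 2 in
  let b := 2 * eps * norm_l2Hhalf 0 g + 2 * Num.sqrt 2 * norm_l2L2 1 f in
  let c := eps ^+ 2 * norm_l2Hhalf 0 g ^+ 2 + pi * norm_l2Hhalf (1 / 2) g ^+ 2
           + 2 * norm_l2L2 1 f ^+ 2 in
  [/\ 0 < a,
      0 <= norm_l2L2 0 (del_seq v)
    & norm_l2L2 0 (del_seq v) <= (b + Num.sqrt (b ^+ 2 + 4 * a * c)) / (2 * a)].
Proof.
move=> a b c.
have md := @measurable_disc R.
have eps0 : 0 <= eps by rewrite eps_def mulr_ge0 ?sqrtr_ge0 ?ltW.
have eps2 : eps ^+ 2 = 2 * mu * CB ^+ 2.
  by rewrite eps_def exprMn sqr_sqrtr// mulr_ge0// ltW.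
have s2 : Num.sqrt 2 ^+ 2 = 2 :> R by rewrite sqr_sqrtr.
have s20 : 0 <= Num.sqrt 2 :> R by exact: sqrtr_ge0.
have a_gt0 : 0 < a by rewrite /a; nra.
split=> //; first exact: sqrtr_ge0.
apply: quadratic_bound => //.
have [v1 hvfin] := hv.
have w0 := @jweight_ge0 R; have w1 := @jweight_ge1 R.
(* All the series below are dominated by the one defining M, hence finite. *)
set M := fine (l2H1sq (1 / 2) v).
have hM n : \sum_(j < n) jweight j * h1sq (v j) <= M.
  have := wsum_partial n (fun j => H1sqE (v1 j)) (fun j => h1sq_ge0 (v j)) hvfin.
  by under eq_bigr do rewrite powR_half.
have hM0 n : \sum_(j < n) h1sq (v j) <= M.
  apply: le_trans (hM n); apply: ler_sum => j _.
  by apply: ler_peMl; [exact: h1sq_ge0|exact: w1].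
have v2 j : inL2 leb2 disc (v j) by have [h _] := v1 j.
have ge0_del j : 0 <= normsq leb2 disc (del (v j)) by exact: normsq_ge0.
have ge0_v j : 0 <= normsq leb2 disc (v j) by exact: normsq_ge0.
have delE j : L2sq leb2 disc (del (v j)) = (normsq leb2 disc (del (v j)))%:E.
  exact: (L2sqE md (inL2_del (v1 j))).
have vE j : L2sq leb2 disc (v j) = (normsq leb2 disc (v j))%:E.
  exact: (L2sqE md (v2 j)).
have v_H1 : in_l2H1 0 v.
  split; first exact: v1.
  apply: le_lt_trans (ltry M).
  apply: (wsum_le (fun j => H1sqE (v1 j)) (fun j => h1sq_ge0 (v j))) => n.
  by under eq_bigr do rewrite powRr0 mul1r.
have v_L2 : in_l2L2 0 v.
  split=> [j|]; first exact: v2.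
  apply: le_lt_trans (ltry M); apply: (wsum_le vE ge0_v) => n.
  under eq_bigr do rewrite powRr0 mul1r.
  by apply: le_trans (hM0 n); apply: ler_sum => j _; exact: normsq_le_h1sq.
have del_fin : (l2L2sq 0 (del_seq v) < +oo)%E.
  apply: le_lt_trans (ltry M); apply: (wsum_le delE ge0_del) => n.
  under eq_bigr do rewrite powRr0 mul1r.
  by apply: le_trans (hM0 n); apply: ler_sum => j _; exact: normsq_del_le_h1sq.
(* The weighted trace norm in c is a fine part, worthless if the series were
   infinite: the trace theorem is needed here. *)
have gE j : Hhalfsq (g j) = (fine (Hhalfsq (g j)))%:E.
  by rewrite fineK//; exact: (Hhalfsq_fin (v1 j) (hg j)).
have ge0_g j : 0 <= fine (Hhalfsq (g j)).
  by apply: fine_ge0; exact: Hhalfsq_ge0.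
have g_fin : (l2Hhalfsq (1 / 2) g < +oo)%E.
  apply: le_lt_trans (ltry (6 / pi * M)); apply: (wsum_le gE ge0_g) => n.
  apply: (@le_trans _ _ (6 / pi * \sum_(j < n) jweight j * h1sq (v j))); last first.
    by apply: ler_wpM2l; [rewrite divr_ge0// pi_ge0|exact: hM].
  rewrite mulr_sumr; apply: ler_sum => j _; rewrite powR_half mulrCA.
  apply: ler_wpM2l; first exact: w0.
  by rewrite -lee_fin -gE; exact: (Hhalfsq_le (v1 j) (hg j)).
have Bv := B_L2 v v_L2.
pose F j := fun z => B v j z + f j z.
have hB j : inL2 leb2 disc (B v j) by exact: (Bv.1 j).
have hfj j : inL2 leb2 disc (f j) by exact: (hf.1 j).
have hF j : inL2 leb2 disc (F j) by exact: (inL2D md (hB j) (hfj j)).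
have BE j : L2sq leb2 disc (B v j) = (normsq leb2 disc (B v j))%:E.
  exact: (L2sqE md (hB j)).
have fE j : L2sq leb2 disc (f j) = (normsq leb2 disc (f j))%:E.
  exact: (L2sqE md (hfj j)).
have ge0_B j : 0 <= normsq leb2 disc (B v j) by exact: normsq_ge0.
have ge0_f j : 0 <= normsq leb2 disc (f j) by exact: normsq_ge0.
set X := norm_l2L2 0 (del_seq v).
set G := norm_l2Hhalf 0 g.
set phi := norm_l2L2 1 f.
set beta := norm_l2L2 1 (B v).
set Phi := 2 * beta ^+ 2 + 2 * phi ^+ 2.
have X0 : 0 <= X by exact: sqrtr_ge0.
have G0 : 0 <= G by exact: sqrtr_ge0.
have phi0 : 0 <= phi by exact: sqrtr_ge0.
have beta0 : 0 <= beta by exact: sqrtr_ge0.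
have iter : X ^+ 2 <= pi * norm_l2Hhalf (1 / 2) g ^+ 2 +
    2 * (Num.sqrt (X ^+ 2) * Num.sqrt Phi) + Phi.
  apply: (@iterated_energy _ (fun j => Num.sqrt (normsq leb2 disc (del (v j))))
    (fun j => Num.sqrt (normsq leb2 disc (F j))) (fun j => fine (Hhalfsq (g j)))
    _ _ _ M).
  - by move=> j; exact: sqrtr_ge0.
  - by move=> j; exact: sqrtr_ge0.
  - exact: ge0_g.
  - move=> j; rewrite [leLHS]sqr_sqrtr; last exact: ge0_del.
    exact: (energy_step (v1 j) (v1 j.+2) (hg j) (hF j) (v_solution j)).
  - have := wsum_cvg delE ge0_del del_fin; rewrite norm_l2L2_sqr.
    apply: cvg_trans; apply: near_eq_cvg; apply: nearW => n.
    by apply: eq_bigr => j _; rewrite powRr0 mul1r sqr_sqrtr.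
  - move=> n; rewrite norm_l2L2_sqr.
    apply: le_trans (wsum_partial n delE ge0_del del_fin).
    by apply: ler_sum => j _; rewrite powRr0 mul1r sqr_sqrtr.
  - move=> n; apply: le_trans (hM n); apply: ler_sum => j _.
    rewrite sqr_sqrtr//; apply: ler_wpM2l; first exact: w0.
    exact: normsq_del_le_h1sq.
  - move=> n; rewrite norm_l2Hhalf_sqr.
    apply: le_trans (wsum_partial n gE ge0_g g_fin).
    by apply: ler_sum => j _; rewrite powR_half.
  - move=> n; rewrite /Phi /beta /phi (norm_l2L2_sqr 1 (B v)) (norm_l2L2_sqr 1 f).
    apply: le_trans (lerD (ler_wpM2l _ (wsum_partial n BE ge0_B Bv.2))
      (ler_wpM2l _ (wsum_partial n fE ge0_f hf.2))) => //.
    rewrite !mulr_sumr -big_split/=; apply: ler_sum => j _.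
    rewrite powR_one [X in _ * X <= _]sqr_sqrtr; last exact: normsq_ge0.
    rewrite !(mulrCA 2) -mulrDr; apply: ler_wpM2l; first exact: sqr_ge0.
    exact: normsqD_le2.
exact: (closing_estimate eps0 eps2 (ltW CB_gt0) X0 G0 phi0 beta0 (sqrtr_ge0 _)
  (bound_L2 v v_L2) (poincare v g v_H1 hg) iter).
Qed.
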